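(* The space $X_{ius}$ is not isomorphic to any proper subspace of it.
   Context: Isomorphic means linearly homeomorphic. Scalars are real, $\mathbb{N}=\{1,2,\dots\}$. $c_{00}$ is the space of finitely supported sequences, with standard basis $(e_n)$, also written $(e_n^* )$ when its elements are viewed as functionals; $f(x)=\langle f,x\rangle=\sum_n f(n)x(n)$, $\|f\|_\infty=\max_n|f(n)|$. $\operatorname{supp}x=\{n:x(n)\ne 0\}$, $\operatorname{range}(x)$ is the smallest interval of $\mathbb{N}$ containing $\operatorname{supp}x$. For sets, $A<B$ means $\max A<\min B$; $x<y$ means $\operatorname{supp}x<\operatorname{supp}y$. For an interval $E\subset\mathbb{N}$, $Ex$ is the restriction of $x$ to $E$. Fix positive integers $m_j,n_j,s_j$ with $m_1=2$, $m_{j+1}=m_j^5$, $n_1=4$, $n_{j+1}=(4n_j)^{s_j}$, $2^{s_j}\ge m_{j+1}^3$. Let $\mathbf{Q}$ be the set of sequences with finite nonempty support, rational coordinates, all of modulus at most $1$, and $\mathbf{Q_s}$ the set of all $(x_1,f_1,\dots,x_n,f_n)$ with $x_i,f_i\in\mathbf{Q}$ and $\operatorname{range}(x_i)\cup\operatorname{range}(f_i)<\operatorname{range}(x_{i+1})\cup\operatorname{range}(f_{i+1})$ for $i<n$. Fix an injection $\sigma:\mathbf{Q_s}\to\{2j:j\in\mathbb{N}\}$ such that for every $\phi=(x_1,f_1,\dots,x_n,f_n)\in\mathbf{Q_s}$: $\sigma(x_1,f_1,\dots,x_{n-1},f_{n-1})<\sigma(\phi)$ and $\max\{\operatorname{range}(x_n)\cup\operatorname{range}(f_n)\}\le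 m_{\sigma(\phi)}^{1/2}$. Special sequences: $\phi=(x_1,f_1,\dots,x_{2k},f_{2k})\in\mathbf{Q_s}$, with $\phi_i=(x_1,f_1,\dots,x_i,f_i)$, is a special sequence of length $2k$ if: (1) for some $j\in\mathbb{N}$ with $m_{2j}^{1/2}>2k$, $x_1=\frac1{n_{2j}}\sum_{l=1}^{n_{2j}}e_{1,l}$ and $f_1=\frac1{m_{2j}}\sum_{l=1}^{n_{2j}}e^*_{1,l}$, where $(e_{1,l})_l$ are $n_{2j}$ distinct standard basis vectors; (2) for $1\le i\le k$, $\|f_{2i}\|_\infty\le\frac1{m_{\sigma(\phi_{2i-1})}}$ and $|f_{2i}(x_{2i})|\le\frac1{m_{\sigma(\phi_{2i-1})}}$; (3) for $1\le i<k$, with $p=\sigma(\phi_{2i})$, $x_{2i+1}=\frac1{n_p}\sum_{l=1}^{n_p}e_{2i+1,l}$ and $f_{2i+1}=\frac1{m_p}\sum_{l=1}^{n_p}e^*_{2i+1,l}$, where $(e_{2i+1,l})_l$ are $n_p$ distinct standard basis vectors. Norming set: $K_0=K_0^0=\{\pm e_n^*:n\in\mathbb{N}\}$, $K_0^j=\emptyset$ for $j\ge1$, and $K_n^0=K_0$ for all $n$. For $n\ge1$, $j\in\mathbb{N}$: $K_n^{2j}=K_{n-1}^{2j}\cup\{\frac1{m_{2j}}\sum_{i=1}^d f_i:d\le n_{2j},\ f_1<\dots<f_d,\ f_i\in K_{n-1}\}$. For a special sequence $\phi=(x_1,f_1,\dots,x_{n_{2j+1}},f_{n_{2j+1}})$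 of length $n_{2j+1}$ with $f_{2i}\in K_{n-1}^{\sigma(\phi_{2i-1})}$ for $i\le n_{2j+1}/2$, $K_{n,\phi}^{2j+1}$ is the set of all $\frac{\pm1}{m_{2j+1}}E\bigl(\sum_{i=1}^{n_{2j+1}/2}(\lambda_{f'_{2i}}f_{2i-1}+f'_{2i})\bigr)$, where $E$ is an interval, $f'_{2i}\in K_{n-1}^{\sigma(\phi_{2i-1})}$, $\operatorname{supp}f'_{2i}=\operatorname{supp}f_{2i}$, $|g(x_{2i})|\le\frac1{m_{\sigma(\phi_{2i-1})}}$ for all $g\in K_{n-1}^{\sigma(\phi_{2i-1})}$, and $\lambda_{f'_{2i}}=f'_{2i}(m_{\sigma(\phi_{2i-1})}x_{2i})$ if $f'_{2i}(x_{2i})\ne0$, $\lambda_{f'_{2i}}=\pm\frac1{n_{2j+1}^2}$ otherwise. $K_n^{2j+1}$ is the union of $K_{n-1}^{2j+1}$ and all $K_{n,\phi}^{2j+1}$, $\phi$ a special sequence of length $n_{2j+1}$. $K_n=\bigcup_jK_n^j$, $K=\bigcup_nK_n$. $X_{ius}$ is the completion of $c_{00}$ under $\|x\|=\|x\|_K=\sup\{f(x):f\in K\}$. *)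

(* Defs.v *)
From HB Require Import structures.
From mathcomp Require Import all_boot all_order all_algebra.
From mathcomp Require Import all_classical all_reals all_analysis.

Set Implicit Arguments.
Unset Strict Implicit.
Unset Printing Implicit Defensive.

Import Order.TTheory GRing.Theory Num.Theory.
Import numFieldNormedType.Exports.

Local Open Scope classical_set_scope.
Local Open Scope ring_scope.

(** Index sets start at 1. A scalar sequence (x(1), x(2), ...) is a function
    x : nat -> R with x 0 = 0. *)

Section Sequences.
Variable R : realType.
Implicit Types x y f : nat -> R.

Definition supp x : set nat := [set k | x k != 0].

Definition finitely_supported x : Prop := finite_set (supp x) /\ x 0%N = 0.

Definition c00_pred : {pred nat -> R} :=
  fun x => `[< finitely_supported x >].

Lemma c00_submod : submod_closed c00_pred.
Proof.
have supp0 : supp (0 : nat -> R) = set0.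
  by apply/seteqP; split=> k //=; rewrite /supp /= eqxx.
split; first by apply/asboolP; split; rewrite ?supp0.
move=> a x y /asboolP[fx x0] /asboolP[fy y0]; apply/asboolP.
have E k : (a *: x + y) k = a * x k + y k by [].
split; last by rewrite E x0 y0 mulr0 addr0.
apply: (@sub_finite_set _ _ (supp x `|` supp y)); last by rewrite finite_setU.
move=> k; rewrite /supp /= E => axy.
have [xk|xk] := eqVneq (x k) 0; last by left.
by right; move: axy; rewrite xk mulr0 add0r.
Qed.

HB.instance Definition _ :=
  GRing.isSubmodClosed.Build R (nat -> R) c00_pred c00_submod.

Record c00 := C00 { c00_val :> nat -> R ; _ : c00_val \in c00_pred }.

HB.instance Definition _ := [isSub for c00_val].
HB.instance Definition _ := [Choice of c00 by <:].
HB.instance Definition _ := [SubChoice_isSubLmodule of c00 by <:].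

Definition basis_vec (k : nat) : nat -> R := fun i => (i == k)%:R.

Definition pairing f x : R := \sum_(k \in [set: nat]) f k * x k.

Definition norm_infty f : R := sup [set `|f k| | k in [set: nat]].

(* the smallest interval of positive integers containing the support *)
Definition rng x : set nat :=
  [set k | exists a b, [/\ supp x a, supp x b & (a <= k <= b)%N]].

(* max A < min B, for nonempty finite A and B *)
Definition set_lt (A B : set nat) : Prop :=
  forall a b, A a -> B b -> (a < b)%N.

Definition is_nat_interval (E : set nat) : Prop :=
  forall a b k, E a -> E b -> (a <= k <= b)%N -> E k.

Definition restrict_to (E : set nat) x : nat -> R :=
  fun k => if k \in E then x k else 0.

Definition Qset : set (nat -> R) := [set x |
  [/\ finitely_supported x, supp x !=set0,
      forall k, exists q : rat, x k = ratr q & forall k, `|x k| <= 1]].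

(* A sequence (x_1, f_1, ..., x_n, f_n) is encoded as the list of the pairs
   (x_i, f_i). *)
Definition pseq := seq ((nat -> R) * (nat -> R)).

Definition xs (phi : pseq) (i : nat) : nat -> R := (nth (0, 0) phi i.-1).1.
Definition fs (phi : pseq) (i : nat) : nat -> R := (nth (0, 0) phi i.-1).2.

Definition rng_pair (phi : pseq) (i : nat) : set nat :=
  rng (xs phi i) `|` rng (fs phi i).

Definition Qs : set pseq := [set phi |
  [/\ (0 < size phi)%N,
      forall i, (1 <= i <= size phi)%N -> Qset (xs phi i) /\ Qset (fs phi i)
    & forall i, (1 <= i < size phi)%N ->
        set_lt (rng_pair phi i) (rng_pair phi i.+1)]].

End Sequences.

(* The values of m, n, s at 0 are irrelevant. *)
Record ius_parameters (m n s : nat -> nat) : Prop := IusParameters {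
  params_gt0 : forall j, (1 <= j)%N -> [/\ (0 < m j)%N, (0 < n j)%N & (0 < s j)%N] ;
  m_1 : m 1%N = 2%N ;
  m_succ : forall j, (1 <= j)%N -> m j.+1 = (m j ^ 5)%N ;
  n_1 : n 1%N = 4%N ;
  n_succ : forall j, (1 <= j)%N -> n j.+1 = ((4 * n j) ^ s j)%N ;
  s_large : forall j, (1 <= j)%N -> (m j.+1 ^ 3 <= 2 ^ s j)%N
}.

(* The values of sigma outside Qs are irrelevant. *)
Record coding_function (R : realType) (m : nat -> nat) (sigma : pseq R -> nat)
    : Prop := CodingFunction {
  sigma_even : forall phi, Qs phi ->
    exists2 j, (1 <= j)%N & sigma phi = (2 * j)%N ;
  sigma_inj : forall phi psi, Qs phi -> Qs psi ->
    sigma phi = sigma psi -> phi = psi ;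
  sigma_lt : forall phi, Qs phi -> (2 <= size phi)%N ->
    (sigma (take (size phi).-1 phi) < sigma phi)%N ;
  sigma_max : forall phi, Qs phi ->
    forall k, rng_pair phi (size phi) k ->
      k%:R <= Num.sqrt (m (sigma phi))%:R :> R
}.

Section NormingSet.
Variables (R : realType) (m n : nat -> nat) (sigma : pseq R -> nat).

(* x = (e_{a_1} + ... + e_{a_N}) / N and f = (e*_{a_1} + ... + e*_{a_N}) / m_p,
   where N = n_p and the a_l are distinct. *)
Definition basic_pair (p : nat) (x f : nat -> R) : Prop :=
  exists A : seq nat,
    [/\ uniq A, size A = n p, {in A, forall a, (1 <= a)%N},
        x = (n p)%:R^-1 *: \sum_(a <- A) basis_vec R a
      & f = (m p)%:R^-1 *: \sum_(a <- A) basis_vec R a].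

Definition special (k : nat) (phi : pseq R) : Prop :=
  [/\ Qs phi /\ size phi = (2 * k)%N,
      exists j, [/\ (1 <= j)%N,
        (2 * k)%:R < Num.sqrt (m (2 * j))%:R :> R
        & basic_pair (2 * j) (xs phi 1) (fs phi 1)],
      forall i, (1 <= i <= k)%N ->
        let M : R := (m (sigma (take (2 * i).-1 phi)))%:R in
        norm_infty (fs phi (2 * i)) <= M^-1 /\
        `|pairing (fs phi (2 * i)) (xs phi (2 * i))| <= M^-1
    & forall i, (1 <= i < k)%N ->
        basic_pair (sigma (take (2 * i) phi))
          (xs phi (2 * i).+1) (fs phi (2 * i).+1)].

Definition K_init : set (nat -> R) := [set f | exists2 k, (1 <= k)%N &
  f = basis_vec R k \/ f = - basis_vec R k].

Definition even_step (q : nat) (Kprev : set (nat -> R)) : set (nat -> R) :=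
  [set h | exists (d : nat) (f : 'I_d -> nat -> R),
    [/\ (1 <= d <= n q)%N,
        forall i, Kprev (f i),
        forall i j : 'I_d, (i < j)%N -> set_lt (supp (f i)) (supp (f j))
      & h = (m q)%:R^-1 *: \sum_(i < d) f i]].

(* [Kprev p] stands for $K_{n-1}^p$; [f' i] and [lam i] stand for $f'_{2i}$
   and $\lambda_{f'_{2i}}$. *)
Definition odd_step_at (q : nat) (Kprev : nat -> set (nat -> R)) (phi : pseq R)
    : set (nat -> R) :=
  let k := (n q)./2 in
  let sg i := sigma (take (2 * i).-1 phi) in
  [set h | exists (eps : bool) (E : set nat) (f' : nat -> nat -> R)
                  (lam : nat -> R),
    [/\ is_nat_interval E,
        forall i, (1 <= i <= k)%N ->
          [/\ Kprev (sg i) (f' i),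
              supp (f' i) = supp (fs phi (2 * i)),
              forall g, Kprev (sg i) g ->
                `|pairing g (xs phi (2 * i))| <= (m (sg i))%:R^-1,
              pairing (f' i) (xs phi (2 * i)) != 0 ->
                lam i = pairing (f' i) ((m (sg i))%:R *: xs phi (2 * i))
            & pairing (f' i) (xs phi (2 * i)) = 0 ->
                lam i = ((n q) ^ 2)%:R^-1 \/ lam i = - ((n q) ^ 2)%:R^-1]
      & h = ((-1) ^+ eps / (m q)%:R) *:
              restrict_to E
                (\sum_(1 <= i < k.+1) (lam i *: fs phi (2 * i).-1 + f' i))]].

(* The special sequence has length n q = 2k. *)
Definition odd_step (q : nat) (Kprev : nat -> set (nat -> R)) : set (nat -> R) :=
  [set h | exists phi k,
    [/\ n q = (2 * k)%N, special k phi,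
        forall i, (1 <= i <= k)%N ->
          Kprev (sigma (take (2 * i).-1 phi)) (fs phi (2 * i))
      & odd_step_at q Kprev phi h]].

(* [K_level r j] is $K_r^j$. Odd-indexed steps occur only for j = 3, 5, ...,
   so $K_r^1$ is empty. *)
Fixpoint K_level (r j : nat) : set (nat -> R) :=
  match r, j with
  | _, 0%N => K_init
  | 0%N, _ => set0
  | _, 1%N => set0
  | r'.+1, _ =>
      K_level r' j `|`
      (if odd j then odd_step j (K_level r')
       else even_step j (\bigcup_i K_level r' i))
  end.

Definition norming_set : set (nat -> R) := \bigcup_r \bigcup_j K_level r j.

Definition ius_norm (x : c00 R) : R :=
  sup [set pairing f x | f in norming_set].

End NormingSet.

(* (X, J) is a completion of V for the norm p: X is complete and J embeds
   (V, p) isometrically onto a dense subspace of X. *)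
Definition is_completion (R : realType) (V : lmodType R) (p : V -> R)
    (X : completeNormedModType R) (J : {linear V -> X}) : Prop :=
  (forall x, `|J x| = p x) /\ dense (range J).

(* X is linearly homeomorphic to its subspace Y. *)
Definition isomorphic_to_subspace (R : realType) (X : normedModType R)
    (Y : set X) : Prop :=
  exists (T : {linear X -> X}) (S : X -> X),
    [/\ forall x, Y (T x), cancel T S, {in Y, cancel S T},
        continuous T & {within Y, continuous S}].

(* Main.v *)
Require Import Defs.
From HB Require Import structures.
From mathcomp Require Import all_boot all_order all_algebra.
From mathcomp Require Import all_classical all_reals all_analysis.
From mathcomp Require Import zify ring lra.
Require Import Defs.

Set Implicit Arguments.
Unset Strict Implicit.
Unset Printing Implicit Defensive.

Import Order.TTheory GRing.Theory Num.Theory.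
Import numFieldNormedType.Exports.

Local Open Scope classical_set_scope.
Local Open Scope ring_scope.

(** Let T be an isomorphism of X onto a subspace. T is bounded and bounded
    below, so its range is closed, and everything reduces to showing that the
    range is dense. This is an index argument: T turns out to be homotopic to a
    multiple of the identity through operators that are bounded below on a
    common tail of the basis, and along such a homotopy the codimension of the
    closure of the image of the tail cannot grow.

    Two facts about a bounded operator make the homotopy possible.

    - [approx_eigen]: the vectors T e_i come arbitrarily close to the lines
      spanned by the e_i. Otherwise, infinitely many T e_i are normed, up to a
      constant, by functionals that vanish at e_i. A special sequence is built
      whose even vectors are averages of such e_i and whose even functionals
      are averages of the norming functionals. The sum of its normalised even
      vectors has norm of order k / m_q^2, because the functionals of all special
      sequences nearly vanish on it, whereas the odd functional of the sequence
      itself is of order k / m_q on the image.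

    - [not_singular]: if A e_i is arbitrarily close to e_i for infinitely many
      i, then A is bounded below on the vectors supported far enough. Otherwise
      there is a special sequence whose odd vectors are averages of basis
      vectors that A nearly fixes, and whose even vectors are averages of
      vectors that A nearly kills. The difference of the sum of the odd vectors
      and the sum of the even ones has norm of order k / m_q^2, but A maps it
      close to the sum of the odd vectors, of norm of order k / m_q.

    Both use the same upper estimate, [special_sum_nbd]. An odd functional of
    weight q that follows a special sequence psi is compared with the given
    special sequence phi. As long as psi and phi agree, the coefficient lambda
    produces an exact cancellation; once they have separated, the injectivity
    of the coding makes all weights different, and functionals of one weight
    nearly annihilate normalised averages of another ([sum_T]). The other
    weights are handled by unfolding functionals into trees ([tree_final]).

    The approximate eigenvalues of T on the basis have a cluster point l, and l
    is not 0 because T is bounded below. Each operator (1 - th) id + (th / l) T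
    with 0 <= th <= 1 satisfies the assumption of [not_singular], and a
    compactness argument gives one tail and one lower bound for all th
    ([homotopy_bounded_below]). At th = 0 the image of the tail beyond N has
    codimension N; by [codim_le_gap] the image under T has codimension at most
    N as well. Since T e_1, ..., T e_N are independent modulo this image, they
    complete it ([codim_le_exchange]), and the range of T is dense. *)

(** Real inequalities in the context are useless to lia and slow it down. *)
Ltac nlia :=
  repeat match goal with
  | H : ?T |- _ =>
      lazymatch T with
      | nat => fail
      | @eq nat _ _ => fail
      | is_true (leq _ _) => fail
      | is_true (andb (leq _ _) (leq _ _)) => fail
      | is_true (odd _) => fail
      | is_true (negb (odd _)) => fail
      | is_true (negb (leq _ _)) => fail
      | is_true (negb (andb (leq _ _) (leq _ _))) => fail
      | odd _ = _ => fail
      | is_true (negb (eq_op _ _)) => fail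
      | is_true (eq_op _ _) => fail
      | _ => clear H
      end
  end; lia.

Lemma cut_mono (c : nat -> nat) : (forall l, (c l <= c l.+1)%N) ->
  forall i j, (i <= j)%N -> (c i <= c j)%N.
Proof.
move=> h i; elim=> [|j IH]; first by case: i.
by rewrite leq_eqVlt => /orP[/eqP->//|/IH h1]; apply: leq_trans h1 (h j).
Qed.

(** * Growth of the parameter sequences *)
Section Growth.
Variables (m n s : nat -> nat).
Hypothesis hpar : ius_parameters m n s.
Local Open Scope nat_scope.

Lemma m_eq Q : 1 <= Q -> m Q = 2 ^ (5 ^ Q.-1).
Proof.
case: Q => // Q _; elim: Q => [|Q IH]; first by rewrite (m_1 hpar).
by rewrite (m_succ hpar) // IH /= -expnM -expnSr.
Qed.

Lemma m_mono i j : 1 <= i -> i <= j -> m i <= m j.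
Proof.
move=> i1 ij; rewrite !m_eq //; last exact: leq_trans ij.
by rewrite leq_exp2l // leq_exp2l //; lia.
Qed.

Lemma m_ltX i j : 1 <= i -> i < j -> m i ^ 5 <= m j.
Proof. by move=> i1 ij; rewrite -(m_succ hpar) //; apply: m_mono. Qed.

Lemma m_ge32 w : 2 <= w -> 32 <= m w.
Proof.
move=> w2; have := @m_ltX 1 w isT w2; rewrite (m_1 hpar); exact.
Qed.

Lemma m_gt0 w : 1 <= w -> 0 < m w.
Proof. by move=> w1; case: (params_gt0 hpar w1). Qed.

Lemma m_gtid w : 1 <= w -> w < m w.
Proof.
case: w => // w _; rewrite m_eq //=; apply: (@leq_trans (2 ^ w.+1)).
  exact: ltn_expl.
by rewrite leq_exp2l //; apply: ltn_expl.
Qed.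

Lemma n_gt0 w : 1 <= w -> 0 < n w.
Proof. by move=> w1; case: (params_gt0 hpar w1). Qed.

Lemma s_ge Q : 1 <= Q -> 3 * 5 ^ Q <= s Q.
Proof.
move=> Q1; have := s_large hpar Q1; rewrite m_eq //= -expnM leq_exp2l //.
by rewrite mulnC.
Qed.

Lemma n_step Q : 1 <= Q -> 4 * n Q <= n Q.+1.
Proof.
move=> Q1; rewrite (n_succ hpar) //; case: (params_gt0 hpar Q1) => _ n0.
case: (s Q) => // t _; rewrite expnS leq_pmulr // expn_gt0; lia.
Qed.

Lemma n_mono i j : 1 <= i -> i <= j -> n i <= n j.
Proof.
move=> i1; elim: j => [|j IH]; first by case: i i1.
rewrite leq_eqVlt => /orP[/eqP->//|ij]; apply: leq_trans (IH ij) _.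
have := @n_step j; lia.
Qed.

(** The exponent of n_Q is large enough for D = 5^(Q-1) rounds of an estimate
    each of which costs a factor 3 n_{Q-1} and gains a factor 4: by [pow4_ge],
    what is left after D rounds is below m_Q^-2. *)
Lemma n_large Q : 2 <= Q ->
  (3 * n Q.-1) ^ (5 ^ Q.-1).+1 * m Q ^ 2 <= n Q.
Proof.
case: Q => [|[|Q]] // _ /=; rewrite (n_succ hpar (isT : 0 < Q.+1)) m_eq //=.
have := @s_ge Q.+1 isT; have n0 := @n_gt0 Q.+1 isT.
set e := 5 ^ Q.+1; have e1 : 1 <= e by rewrite expn_gt0.
set N := n Q.+1 in n0 *; move=> se.
apply: (@leq_trans ((4 * N) ^ (e.+1 + e))); last first.
  by apply: leq_pexp2l; lia.
rewrite expnD leq_mul //; first by rewrite leq_exp2r //; lia.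
by rewrite -expnM mulnC expnM leq_exp2r //; lia.
Qed.

Lemma pow4_ge Q : 2 <= Q -> m Q ^ 2 <= 4 ^ (5 ^ Q.-1).
Proof.
move=> Q2; rewrite m_eq; last lia.
by rewrite -expnM mulnC expnM.
Qed.

Lemma n_ge_msqr Q : 2 <= Q -> m Q ^ 2 <= n Q.
Proof.
move=> Q2; apply: leq_trans (n_large Q2); rewrite leq_pmull //.
by rewrite expn_gt0 muln_gt0 n_gt0 //; lia.
Qed.

Lemma n_even Q : 2 <= Q -> ~~ odd (n Q).
Proof.
case: Q => [|[|Q]] // _; rewrite (n_succ hpar) //.
case: (params_gt0 hpar (isT : 0 < Q.+1)) => _ _; case: (s Q.+1) => // t _.
by rewrite oddX orFb oddM.
Qed.

End Growth.

(** * Finitely supported vectors and functionals *)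
Section Pairing.
Variable R : realType.
Implicit Types (f g : nat -> R) (x y : c00 R).

Lemma c00_bound x : exists B, forall k, (B <= k)%N -> x k = 0.
Proof.
case: (asboolW (valP x)) => /finite_seqP[l supl] _.
exists (\max_(i <- l) i).+1 => k Bk; apply/eqP; apply: contraTT Bk => xk.
rewrite -ltnNge ltnS; have kl : k \in l.
  by have : supp x k by []; rewrite supl.
by rewrite (big_rem k) //= leq_max leqnn.
Qed.

Lemma c00_0 x : x 0%N = 0.
Proof. by case: (asboolW (valP x)). Qed.

Lemma c00_finsupp x : finitely_supported x.
Proof. exact: asboolW (valP x). Qed.

Lemma c00_eqP x y : (forall k, x k = y k) -> x = y.
Proof. by move=> xy; apply: val_inj; apply/funext. Qed.

Lemma c00D x y k : (x + y) k = x k + y k.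
Proof. by []. Qed.

Lemma c00B x y k : (x - y) k = x k - y k.
Proof. by []. Qed.

Lemma c00Z (a : R) x k : (a *: x) k = a * x k.
Proof. by []. Qed.

Lemma c00sum I (r : seq I) (P : pred I) (F : I -> c00 R) k :
  (\sum_(i <- r | P i) F i) k = \sum_(i <- r | P i) F i k.
Proof. exact: (big_morph (fun x : c00 R => x k)). Qed.

Lemma fscale (a : R) f k : (a *: f) k = a * f k.
Proof. by []. Qed.

Lemma fsum I (r : seq I) (P : pred I) (F : I -> nat -> R) k :
  (\sum_(i <- r | P i) F i) k = \sum_(i <- r | P i) F i k.
Proof. exact: (big_morph (fun x : nat -> R => x k)). Qed.

(** The pairing, with its second argument in the space where it is linear. The
    codomain is the regular module so that linearity can be declared. *)
Definition ev f x : R^o := pairing f x.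

Lemma evE f x B : (forall k, (B <= k)%N -> x k = 0) ->
  ev f x = \sum_(k < B) f k * x k.
Proof.
move=> xB; rewrite /ev /pairing (fsbig_ord _ B (fun k => f k * x k)).
apply/esym/fsbig_widen => //.
move=> k /= [_ /negP]; rewrite -leqNgt => /xB ->; exact: mulr0.
Qed.

Lemma ev_lin f : linear (ev f).
Proof.
move=> a x y; have [B xB] := c00_bound x; have [C yC] := c00_bound y.
have max0 z D : (forall k, (D <= k)%N -> z k = 0 :> R) ->
    (D <= maxn B C)%N -> forall k, (maxn B C <= k)%N -> z k = 0.
  by move=> h D1 k h1; apply: h; apply: leq_trans h1.
have x0 := max0 x B xB (leq_maxl _ _); have y0 := max0 y C yC (leq_maxr _ _).
rewrite !(@evE _ _ (maxn B C)) //; last first.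
  by move=> k k1; rewrite c00D c00Z x0 // y0 // mulr0 addr0.
rewrite /GRing.scale /= mulr_sumr -big_split /=; apply: eq_bigr => i _.
rewrite [X in f i * X](_ : _ = a * x i + y i) //; ring.
Qed.

HB.instance Definition _ f :=
  GRing.isLinear.Build R (c00 R) R^o *:%R (ev f) (ev_lin f).

Lemma evD f x y : ev f (x + y) = ev f x + ev f y. Proof. exact: linearD. Qed.
Lemma evB f x y : ev f (x - y) = ev f x - ev f y. Proof. exact: linearB. Qed.
Lemma evN f x : ev f (- x) = - ev f x. Proof. exact: linearN. Qed.
Lemma evZ f a x : ev f (a *: x) = a * ev f x. Proof. exact: linearZ. Qed.
Lemma ev_sum f I (r : seq I) (P : pred I) (F : I -> c00 R) :
  ev f (\sum_(i <- r | P i) F i) = \sum_(i <- r | P i) ev f (F i).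
Proof. exact: linear_sum. Qed.

Lemma evDl f g x : ev (f + g) x = ev f x + ev g x.
Proof.
have [B xB] := c00_bound x; rewrite !(evE _ xB) -big_split /=.
by apply: eq_bigr => i _; rewrite -mulrDl.
Qed.

Lemma evZl (a : R) f x : ev (a *: f) x = a * ev f x.
Proof.
have [B xB] := c00_bound x; rewrite !(evE _ xB) mulr_sumr.
by apply: eq_bigr => i _; rewrite mulrA.
Qed.

Lemma evNl f x : ev (- f) x = - ev f x.
Proof. by rewrite -scaleN1r evZl mulN1r. Qed.

Lemma ev0l x : ev 0 x = 0.
Proof. by rewrite -(scale0r (0 : nat -> R)) evZl mul0r. Qed.

Lemma ev_suml I (r : seq I) (P : pred I) (F : I -> nat -> R) x :
  ev (\sum_(i <- r | P i) F i) x = \sum_(i <- r | P i) ev (F i) x.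
Proof.
by apply: (big_morph (fun f => ev f x)) => [f g|]; rewrite ?evDl ?ev0l.
Qed.

Lemma ev_eq f g x y : (forall k, f k * x k = g k * y k) -> ev f x = ev g y.
Proof. by move=> fg; apply: eq_fsbigr => k _; apply: fg. Qed.

Lemma ev_eq0 f x : (forall k, f k * x k = 0) -> ev f x = 0.
Proof.
by move=> fx; rewrite -(ev0l x); apply: ev_eq => k; rewrite fx mul0r.
Qed.

Lemma ev_bounded x : exists2 L, 0 <= L &
  forall f (c : R), (forall k, `|f k| <= c) -> `|ev f x| <= c * L.
Proof.
have [B xB] := c00_bound x; exists (\sum_(k < B) `|x k|).
  exact: sumr_ge0.
move=> f c fc; rewrite (evE _ xB) mulr_sumr.
apply: le_trans (ler_norm_sum _ _ _) _; apply: ler_sum => i _.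
by rewrite normrM ler_wpM2r.
Qed.

Definition mkc f : c00 R := insubd 0 f.

Lemma mkcE f : finitely_supported f -> mkc f = f :> (nat -> R).
Proof. by move=> ff; rewrite /mkc -[LHS]/(val _) insubdK //; apply/asboolP. Qed.

Lemma finsupp_sub f x : (forall k, f k != 0 -> x k != 0) ->
  finitely_supported f.
Proof.
move=> fx; case: (c00_finsupp x) => xfin x0; split.
  by apply: sub_finite_set xfin => k; apply: fx.
by apply/eqP; apply: contraT => /fx; rewrite x0 eqxx.
Qed.

Lemma basis_finsupp k : (1 <= k)%N -> finitely_supported (basis_vec R k).
Proof.
move=> k1; split; last by rewrite /basis_vec; case: k k1.
apply: (@sub_finite_set _ _ [set k]); last exact: finite_set1.
by move=> i; rewrite /supp /basis_vec /=; case: (eqVneq i k) => [-> //|_]; rewrite eqxx.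
Qed.

Definition ebase k : c00 R := mkc (basis_vec R k).

Lemma ebaseE k i : (1 <= k)%N -> ebase k i = (i == k)%:R.
Proof. by move=> k1; rewrite mkcE //; apply: basis_finsupp. Qed.

Lemma ev_ebase f k : (1 <= k)%N -> ev f (ebase k) = f k.
Proof.
move=> k1; rewrite (@evE _ _ k.+1) => [|i ki]; last first.
  by rewrite ebaseE // gtn_eqF.
rewrite big_ord_recr /= big1 ?add0r ?ebaseE ?eqxx ?mulr1 // => i _.
by rewrite ebaseE // ltn_eqF ?mulr0.
Qed.

Lemma ev_basis k x : ev (basis_vec R k) x = x k.
Proof.
have [B xB] := c00_bound x; rewrite (@evE _ _ (maxn B k.+1)); last first.
  by move=> i Bi; apply: xB; apply: leq_trans Bi; apply: leq_maxl.
have kB : (k < maxn B k.+1)%N by exact: leq_maxr.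
rewrite (bigD1 (Ordinal kB)) //= /basis_vec eqxx mul1r big1 ?addr0 // => i.
by move=> /eqP/val_eqP /= /negPf ->; rewrite mul0r.
Qed.

Definition crop E x : c00 R := mkc (restrict_to E x).

Lemma cropE E x k : crop E x k = if k \in E then x k else 0.
Proof.
rewrite mkcE //; apply: (@finsupp_sub _ x) => i; rewrite /restrict_to.
by case: ifP => //; rewrite eqxx.
Qed.

Lemma ev_crop E f x : ev f (crop E x) = ev (restrict_to E f) x.
Proof.
apply: ev_eq => k; rewrite cropE /restrict_to.
by case: ifP; rewrite ?mulr0 ?mul0r.
Qed.

Definition supp_in lo hi f := forall k, f k != 0 -> (lo <= k < hi)%N.

Lemma supp_in_out lo hi f k : supp_in lo hi f -> ~~ (lo <= k < hi)%N -> f k = 0.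
Proof. by move=> wf; apply: contraNeq => /wf. Qed.

Lemma supp_inW lo hi lo' hi' f : supp_in lo hi f -> (lo' <= lo)%N ->
  (hi <= hi')%N -> supp_in lo' hi' f.
Proof. by move=> wf l h k /wf; lia. Qed.

Lemma supp_inD lo hi f g : supp_in lo hi f -> supp_in lo hi g ->
  supp_in lo hi (f + g).
Proof.
move=> wf wg k; apply: contraR => h; apply/eqP.
by rewrite /GRing.add /= (supp_in_out wf) // (supp_in_out wg) // addr0.
Qed.

Lemma supp_inZ lo hi (a : R) f : supp_in lo hi f -> supp_in lo hi (a *: f).
Proof.
move=> wf k; apply: contraR => h; apply/eqP.
by rewrite fscale (supp_in_out wf) // mulr0.
Qed.

Lemma supp_in0 lo hi : supp_in lo hi 0.
Proof. by move=> k; rewrite eqxx. Qed.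

Lemma supp_in_sum lo hi I (r : seq I) (P : pred I) (F : I -> nat -> R) :
  (forall i, P i -> supp_in lo hi (F i)) ->
  supp_in lo hi (\sum_(i <- r | P i) F i).
Proof.
move=> wF; elim/big_ind : _ => //; [exact: supp_in0|exact: supp_inD].
Qed.

Lemma c00_sumE I (r : seq I) (P : pred I) (F : I -> c00 R) :
  (\sum_(i <- r | P i) F i : c00 R) = \sum_(i <- r | P i) (F i : nat -> R)
    :> (nat -> R).
Proof. by apply/funext => k; rewrite c00sum fsum. Qed.

Lemma supp_in_csum lo hi I (r : seq I) (P : pred I) (F : I -> c00 R) :
  (forall i, P i -> supp_in lo hi (F i)) ->
  supp_in lo hi (\sum_(i <- r | P i) F i : c00 R).
Proof. by move=> wF; rewrite c00_sumE; apply: supp_in_sum. Qed.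

Lemma ev_supp_in lo hi lo' hi' f x : supp_in lo hi f -> supp_in lo' hi' x ->
  (hi <= lo')%N || (hi' <= lo)%N -> ev f x = 0.
Proof.
move=> wf wx h; apply: ev_eq0 => k; apply/eqP; rewrite mulf_eq0.
apply: contraT; rewrite negb_or => /andP[/wf ? /wx ?]; lia.
Qed.

Lemma supp_in_bound x : exists hi, supp_in 1 hi x.
Proof.
have [B xB] := c00_bound x; exists B => k; apply: contraNT.
case: k => [|k]; first by rewrite c00_0.
by rewrite andTb -leqNgt => /xB ->.
Qed.

Lemma supp_in_finsupp lo hi f : (1 <= lo)%N -> supp_in lo hi f ->
  finitely_supported f.
Proof.
move=> l1 wf; split; last first.
  by apply: (supp_in_out wf); rewrite leqn0; case: lo l1 {wf}.
apply: (@sub_finite_set _ _ `I_hi); last exact: finite_II.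
by move=> k /wf /andP[].
Qed.

End Pairing.

(** * Rational coordinates and coded sequences *)
Section Rationals.
Variable R : realType.
Implicit Types (a b : R) (f : nat -> R).

Definition is_rat a := exists q : rat, a = ratr q.

Lemma is_ratD a b : is_rat a -> is_rat b -> is_rat (a + b).
Proof. by move=> [p ->] [q ->]; exists (p + q); rewrite rmorphD. Qed.
Lemma is_ratM a b : is_rat a -> is_rat b -> is_rat (a * b).
Proof. by move=> [p ->] [q ->]; exists (p * q); rewrite rmorphM. Qed.
Lemma is_ratN a : is_rat a -> is_rat (- a).
Proof. by move=> [p ->]; exists (- p); rewrite rmorphN. Qed.
Lemma is_ratV a : is_rat a -> is_rat a^-1.
Proof. by move=> [p ->]; exists p^-1; rewrite fmorphV. Qed.
Lemma is_rat_nat k : is_rat k%:R.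
Proof. by exists k%:R; rewrite ratr_nat. Qed.
Lemma is_rat0 : is_rat 0. Proof. exact: (is_rat_nat 0). Qed.
Lemma is_rat_sign (e : bool) : is_rat ((-1) ^+ e).
Proof.
case: e; first by rewrite expr1; apply/is_ratN/(is_rat_nat 1).
exact: (is_rat_nat 1).
Qed.
Lemma is_rat_sum I (r : seq I) (P : pred I) (F : I -> R) :
  (forall i, P i -> is_rat (F i)) -> is_rat (\sum_(i <- r | P i) F i).
Proof. by move=> h; elim/big_ind : _ => //; [exact: is_rat0|exact: is_ratD]. Qed.

Definition rat_valued f := forall k, is_rat (f k).

Lemma rat_valued_ev f (x : c00 R) : rat_valued f -> rat_valued x -> is_rat (ev f x).
Proof.
move=> rf rx; have [B xB] := c00_bound x; rewrite (evE _ xB).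
by apply: is_rat_sum => i _; apply: is_ratM.
Qed.

End Rationals.

Section SeqLemmas.
Variable R : realType.
Implicit Types (f g : nat -> R) (phi : pseq R).

(** At most one term is nonzero. *)
Lemma sum_disjoint_le (I : finType) (g : I -> R) (c : R) : 0 <= c ->
  (forall i, `|g i| <= c) -> (forall i j, i != j -> g i = 0 \/ g j = 0) ->
  `|\sum_i g i| <= c.
Proof.
move=> c0 gc dis; have [[i gi]|h] := pselect (exists i, g i != 0).
  rewrite (bigD1 i) //= big1 ?addr0 // => j ji.
  by case: (dis _ _ ji) => // gi0; rewrite gi0 eqxx in gi.
rewrite big1 ?normr0 // => i _; apply/eqP; apply: contraT => gi.
by case: h; exists i.
Qed.

Lemma supp_rng f k : f k != 0 -> rng f k.
Proof. by move=> fk; exists k, k; split=> //; rewrite leqnn. Qed.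

Lemma Qs_take phi l : Qs phi -> (0 < l <= size phi)%N -> Qs (take l phi).
Proof.
move=> [h1 h2 h3] /andP[l0 l1]; have sz : size (take l phi) = l.
  by rewrite size_takel.
have nt i : (0 < i <= l)%N -> nth (0, 0) (take l phi) i.-1 = nth (0, 0) phi i.-1.
  by move=> hi; rewrite nth_take //; case: i hi.
split; first by rewrite sz.
  by move=> i; rewrite sz /xs /fs => hi; rewrite nt //; apply: h2; lia.
move=> i; rewrite sz => hi; rewrite /rng_pair /xs /fs !nt; try lia.
by apply: h3; lia.
Qed.

Lemma xs_take phi l i : (0 < i <= l)%N -> xs (take l phi) i = xs phi i.
Proof. by move=> hi; rewrite /xs nth_take //; case: i hi. Qed.

Lemma fs_take phi l i : (0 < i <= l)%N -> fs (take l phi) i = fs phi i.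
Proof. by move=> hi; rewrite /fs nth_take //; case: i hi. Qed.

Lemma Qs_xs phi i : Qs phi -> (0 < i <= size phi)%N -> Qset (xs phi i).
Proof. by case=> _ h _ /h[]. Qed.

Lemma Qs_fs phi i : Qs phi -> (0 < i <= size phi)%N -> Qset (fs phi i).
Proof. by case=> _ h _ /h[]. Qed.

(** The supports are nonempty, so that the relation between consecutive ranges
    is transitive. *)
Lemma Qs_lt phi i j : Qs phi -> (0 < i < j)%N -> (j <= size phi)%N ->
  set_lt (rng_pair phi i) (rng_pair phi j).
Proof.
move=> qphi; elim: j => [|j IH] hij hj; first by lia.
case: (qphi) => _ h2 h3.
have [ij|ij] := eqVneq i j; first by rewrite ij; apply: h3; lia.
have [[_ [c xc] _ _] _] : Qset (xs phi j) /\ Qset (fs phi j) by apply: h2; lia.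
move=> a b ha hb; have hc : rng_pair phi j c by left; apply: supp_rng.
apply: (@ltn_trans c); first by apply: IH => //; lia.
by apply: (h3 j) => //; lia.
Qed.

Definition subsupp f g := forall k, f k != 0 -> g k != 0.

Lemma restrict_subsupp E f : subsupp (restrict_to E f) f.
Proof. by move=> k; rewrite /restrict_to; case: ifP => //; rewrite eqxx. Qed.

Lemma scale_subsupp (a : R) f : subsupp (a *: f) f.
Proof.
by move=> k; apply: contraNN => /eqP fk; rewrite fscale fk mulr0.
Qed.

Lemma set_lt_sub (f f' g g' : nat -> R) : subsupp f f' -> subsupp g g' ->
  set_lt (supp f') (supp g') -> set_lt (supp f) (supp g).
Proof. by move=> hf hg h a b /hf ha /hg hb; apply: h. Qed.

Lemma restrict_sum E I (r : seq I) (P : pred I) (F : I -> nat -> R) :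
  restrict_to E (\sum_(i <- r | P i) F i) = \sum_(i <- r | P i) restrict_to E (F i).
Proof.
apply/funext => k; rewrite /restrict_to !fsum; case: ifP => kE.
  by apply: eq_bigr.
by rewrite big1.
Qed.

Lemma restrictZ E (a : R) f : restrict_to E (a *: f) = a *: restrict_to E f.
Proof.
apply/funext => k; rewrite /restrict_to /GRing.scale /=.
by case: ifP => //; rewrite /GRing.scale /= mulr0.
Qed.

Lemma restrictT f : restrict_to [set: nat] f = f.
Proof. by apply/funext => k; rewrite /restrict_to in_setT. Qed.

Lemma pairing_mkc f (x : nat -> R) : finitely_supported x ->
  pairing f x = ev f (mkc x).
Proof. by move=> fx; rewrite /ev mkcE. Qed.

Lemma mkcZ (a : R) (x : nat -> R) : finitely_supported x ->
  mkc (a *: x) = a *: mkc x.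
Proof.
move=> fx; apply: c00_eqP => k; rewrite c00Z !mkcE //.
apply: (@finsupp_sub _ _ (mkc x)); rewrite mkcE //; exact: scale_subsupp.
Qed.

Lemma finsuppZ (a : R) (x : nat -> R) : finitely_supported x ->
  finitely_supported (a *: x).
Proof.
by move=> fx; apply: (@finsupp_sub _ _ (mkc x)); rewrite mkcE //; exact: scale_subsupp.
Qed.

Lemma pairingZ f (a : R) (x : nat -> R) : finitely_supported x ->
  pairing f (a *: x) = a * pairing f x.
Proof.
by move=> fx; rewrite !pairing_mkc ?mkcZ ?evZ //; apply: finsuppZ.
Qed.

End SeqLemmas.

(** * Levels and weights in the norming set *)
Section NormingSetFacts.
Variables (R : realType) (m n s : nat -> nat) (sigma : pseq R -> nat).
Hypothesis hpar : ius_parameters m n s.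
Hypothesis hsigma : coding_function m sigma.
Local Notation KL := (K_level m n sigma).
Local Notation K := (norming_set m n sigma).
Implicit Types (f g : nat -> R) (phi : pseq R).

Lemma K_level_succ r w f : KL r w f -> KL r.+1 w f.
Proof. by case: r w => [|r] [|[|w]] //= h; left. Qed.

Lemma K_level_mono r r' w f : (r <= r')%N -> KL r w f -> KL r' w f.
Proof.
elim: r' => [|r' IH]; first by case: r.
rewrite leq_eqVlt => /orP[/eqP->//|rr'] h; exact/K_level_succ/IH.
Qed.

Lemma K_levelE r w f : (2 <= w)%N -> KL r.+1 w f <->
  KL r w f \/ if odd w then odd_step m n sigma w (KL r) f
              else even_step m n w (\bigcup_i KL r i) f.
Proof.
case: w => [|[|w]] // _; rewrite [KL r.+1 _]/=; split.
  by move=> [h|h]; [left|right; move: h => /=; case: ifP].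
by move=> [h|h]; [left|right; move: h => /=; case: ifP].
Qed.

Lemma K_level_ind (P : nat -> (nat -> R) -> Prop) :
  (forall f, K_init f -> P 0%N f) ->
  (forall w r f, (2 <= w)%N -> ~~ odd w ->
     (forall w' g, KL r w' g -> P w' g) ->
     even_step m n w (\bigcup_i KL r i) f -> P w f) ->
  (forall w r f, (2 <= w)%N -> odd w ->
     (forall w' g, KL r w' g -> P w' g) ->
     odd_step m n sigma w (KL r) f -> P w f) ->
  forall r w f, KL r w f -> P w f.
Proof.
move=> h0 h1 h2; elim=> [|r IH] [|[|w]] // f; try exact: h0.
move=> /K_levelE -/(_ isT)[]; first exact: IH.
by case: ifPn => ow; [apply: h2|apply: h1].
Qed.

(** The functionals of weight w, of any level; weight 0 collects the initial
    functionals. *)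
Definition wclass w : set (nat -> R) := \bigcup_r KL r w.

Lemma wclass_K w f : wclass w f -> K f.
Proof. by move=> [r _ h]; exists r => //; exists w. Qed.

Lemma K_wclass f : K f -> exists w, wclass w f.
Proof. by move=> [r _ [w _ h]]; exists w, r. Qed.

Lemma wclass_cases w f : wclass w f ->
  (w = 0%N /\ K_init f) \/ (2 <= w)%N.
Proof. by case: w => [|[|w]] [[|r] _ h] //; try (by left); right. Qed.

Lemma wclass_inv w f : (2 <= w)%N -> wclass w f -> exists r,
  if odd w then odd_step m n sigma w (KL r) f
  else even_step m n w (\bigcup_i KL r i) f.
Proof.
move=> w2 [r _]; elim: r => [|r IH]; first by case: w w2 => [|[|]].
by move=> /K_levelE -/(_ w2)[//|]; exists r.
Qed.

Lemma special_basic k phi i : special m n sigma k phi -> (0 < i <= k)%N ->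
  exists p, [/\ (2 <= p)%N, ~~ odd p &
    basic_pair m n p (xs phi (2 * i).-1) (fs phi (2 * i).-1)].
Proof.
move=> [[q sz] [j [j1 _ b1]] _ h3] hi; have [i1|i1] := eqVneq i 1%N.
  by exists (2 * j)%N; rewrite i1; split=> //; lia.
have h : Qs (take (2 * i.-1) phi) by apply: Qs_take => //; lia.
have [l l1 e] := sigma_even hsigma h.
exists (sigma (take (2 * i.-1) phi)); split; try (rewrite e; lia).
have := h3 i.-1; have -> : (2 * i.-1).+1 = (2 * i).-1 by lia.
by apply; lia.
Qed.

(** Zero summands are discarded: restriction to an interval can turn members
    of the norming set into 0, which need not be in the same class. *)
Lemma even_step_seq w (Kp : set (nat -> R)) (l : seq (nat -> R)) :
  (size l <= n w)%N -> (forall g, List.In g l -> Kp g \/ g = 0) ->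
  pairwise (fun f g => `[<set_lt (supp f) (supp g)>]) l ->
  let S := \sum_(g <- l) g in S = 0 \/ even_step m n w Kp ((m w)%:R^-1 *: S).
Proof.
move=> szl Kl pl S; pose l' := [seq g <- l | `[<g <> 0>]].
have Sl' : S = \sum_(g <- l') g.
  rewrite big_filter [RHS]big_mkcond /=; apply: eq_bigr => g _.
  by case: asboolP => // /contrapT.
have [l'0|l'0] := eqVneq (size l') 0%N.
  by left; rewrite Sl' (size0nil l'0) big_nil.
right; exists (size l'), (fun i => nth 0 l' i); split.
- rewrite lt0n l'0; apply: leq_trans szl; rewrite size_filter; exact: count_size.
- move=> i; have : List.In (nth 0 l' i) l'.
    elim: (l') i => [[[]]//|a t IH [[|i] hi]] /=; first by left.
    by right; apply: (IH (Ordinal (hi : i < size t)%N)).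
  have H (t : seq (nat -> R)) g : List.In g [seq g <- t | `[<g <> 0>]] -> List.In g t /\ g <> 0.
    elim: t => //= a t IH; case: asboolP => h //=; last by move=> /IH[]; auto.
    by move=> [<-|/IH[]]; auto.
  by move=> /H[/Kl[]].
- move=> i j ij; have := pairwise_filter (fun g => `[<g <> 0>]) pl.
  move=> /(pairwiseP 0)/(_ i j (ltn_ord i) (ltn_ord j) ij); exact: asboolW.
- by rewrite Sl' (big_nth 0) big_mkord.
Qed.

(** Sorting the indices makes the basis functionals successive. *)
Lemma basic_pair_level p x f : (2 <= p)%N -> ~~ odd p ->
  basic_pair m n p x f -> KL 1 p f.
Proof.
move=> p2 op [A [uA sA A1 _ ->]]; apply/K_levelE => //; right.
rewrite (negPf op); have pA : perm_eq (sort leq A) A by rewrite perm_sort.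
rewrite -(perm_big _ pA) /=; set B := sort leq A in pA *.
have uB : uniq B by rewrite (perm_uniq pA).
have sB : sorted ltn B by rewrite ltn_sorted_uniq_leq uB sort_sorted //; exact: leq_total.
exists (n p), (fun i => basis_vec R (nth 0%N B i)); split.
- by rewrite leqnn (n_gt0 hpar) //; lia.
- move=> i; exists 0%N => //; exists (nth 0%N B i); last by left.
  by apply: A1; rewrite -(perm_mem pA) mem_nth // (perm_size pA) sA.
- have nz (a b : nat) : supp (basis_vec R a) b -> b = a.
    by rewrite /supp /basis_vec /=; case: (eqVneq b a) => // _; rewrite eqxx.
  move=> i j ij a b /nz -> /nz ->.
  apply: (sorted_ltn_nth ltn_trans 0%N sB) => //; rewrite inE (perm_size pA) sA //.
- by rewrite (big_nth 0%N) (perm_size pA) sA big_mkord.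
Qed.

Lemma basic_pair_f_le p x f k : (2 <= p)%N -> basic_pair m n p x f ->
  `|f k| <= (m p)%:R^-1.
Proof.
move=> p2 [A [uA sA A1 _ ->]]; rewrite fscale normrM ger0_norm ?invr_ge0 // ler_piMr ?invr_ge0 // fsum.
rewrite /basis_vec -natr_sum normr_nat lern1.
have -> : (\sum_(a <- A) (k == a) = count_mem k A)%N.
  by rewrite -sum1_count [RHS]big_mkcond /=; apply: eq_bigr => a _; rewrite eq_sym; case: eqP.
by rewrite count_uniq_mem //; case: (k \in A).
Qed.

(** The conditions of an odd step that concern the pairs one by one, separated
    from the interval and the sign. *)
Definition odd_data w r phi k (f' : nat -> nat -> R) (lam : nat -> R) :=
  forall i, (0 < i <= k)%N ->
  let sg := sigma (take (2 * i).-1 phi) in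
  [/\ KL r sg (f' i), supp (f' i) = supp (fs phi (2 * i)),
      forall g, KL r sg g -> `|pairing g (xs phi (2 * i))| <= (m sg)%:R^-1,
      pairing (f' i) (xs phi (2 * i)) != 0 ->
        lam i = pairing (f' i) ((m sg)%:R *: xs phi (2 * i))
    & pairing (f' i) (xs phi (2 * i)) = 0 ->
        lam i = ((n w) ^ 2)%:R^-1 \/ lam i = - ((n w) ^ 2)%:R^-1].

Lemma odd_step_inv w r h : odd_step m n sigma w (KL r) h ->
  exists phi k (eps : bool) E (f' : nat -> nat -> R) lam,
    [/\ n w = (2 * k)%N, special m n sigma k phi, is_nat_interval E,
        odd_data w r phi k f' lam
      & h = ((-1) ^+ eps / (m w)%:R) *: restrict_to E
         (\sum_(i < k) (lam i.+1 *: fs phi (2 * i.+1).-1 + f' i.+1))].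
Proof.
move=> [phi [k [nk sp _ [eps [E [f' [lam [iE h1 ->]]]]]]]].
have k2 : (n w)./2 = k by rewrite nk mul2n doubleK.
rewrite k2 in h1 *; exists phi, k, eps, E, f', lam; split => //.
by rewrite big_add1 /= big_mkord.
Qed.

(** A coefficient is either tiny or m_p times a value that is at most 1 / m_p. *)
Lemma odd_data_lam w r phi k (f' : nat -> nat -> R) lam i : (2 <= w)%N -> special m n sigma k phi ->
  odd_data w r phi k f' lam -> (0 < i <= k)%N -> `|lam i| <= 1.
Proof.
move=> w2 [[q sz] _ _ _] od hi; have [k1 _ k3 k4 k5] := od i hi.
have [fx|fx] := eqVneq (pairing (f' i) (xs phi (2 * i))) 0.
  have h : 1 <= ((n w) ^ 2)%:R :> R by rewrite ler1n expn_gt0 (n_gt0 hpar) //; lia.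
  case: (k5 fx) => ->; rewrite ?normrN ger0_norm ?invr_ge0 //;
    by rewrite invf_le1 // (lt_le_trans _ h).
rewrite k4 // pairingZ; last by case: (@Qs_xs _ phi (2 * i) q) => //; lia.
have [|l l1 e] := sigma_even hsigma (_ : Qs (take (2 * i).-1 phi)).
  by apply: Qs_take => //; lia.
have m0 : 0 < (m (sigma (take (2 * i).-1 phi)))%:R :> R.
  by rewrite ltr0n (m_gt0 hpar) // e; lia.
by rewrite normrM ger0_norm ?ler0n // -ler_pdivlMl // mulr1; apply: k3.
Qed.

Lemma odd_pair_supp phi i (f' : nat -> R) (a : R) k :
  supp f' = supp (fs phi (2 * i)) ->
  (a *: fs phi (2 * i).-1 + f') k != 0 ->
  rng_pair phi (2 * i).-1 k \/ rng_pair phi (2 * i) k.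
Proof.
move=> sf; have -> : (a *: fs phi (2 * i).-1 + f') k = a * fs phi (2 * i).-1 k + f' k by [].
have [f0|f0] := eqVneq (f' k) 0; last first.
  move=> _; right; right; apply: supp_rng; have : supp f' k by []; by rewrite sf.
rewrite f0 addr0; have [f1|f1] := eqVneq (fs phi (2 * i).-1 k) 0.
  by rewrite f1 mulr0 eqxx.
by move=> _; left; right; apply: supp_rng.
Qed.

Lemma odd_pair_lt phi i j (f' g' : nat -> R) (a b : R) : Qs phi ->
  (0 < i < j)%N -> (2 * j <= size phi)%N ->
  supp f' = supp (fs phi (2 * i)) -> supp g' = supp (fs phi (2 * j)) ->
  set_lt (supp (a *: fs phi (2 * i).-1 + f')) (supp (b *: fs phi (2 * j).-1 + g')).
Proof.
move=> q ij jk sf sg x y /(odd_pair_supp sf) hx /(odd_pair_supp sg) hy.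
by case: hx => hx; case: hy => hy; apply: (Qs_lt q _ _ hx hy); lia.
Qed.

Lemma odd_pair_le phi i (f' : nat -> R) (a c : R) k : Qs phi -> (0 < i)%N ->
  (2 * i <= size phi)%N -> supp f' = supp (fs phi (2 * i)) ->
  `|a| <= 1 -> `|fs phi (2 * i).-1 k| <= c -> `|f' k| <= c ->
  `|(a *: fs phi (2 * i).-1 + f') k| <= c.
Proof.
move=> q i0 isz sf a1 fc f'c.
have -> : (a *: fs phi (2 * i).-1 + f') k = a * fs phi (2 * i).-1 k + f' k by [].
have [f0|f0] := eqVneq (f' k) 0.
  by rewrite f0 addr0 normrM (le_trans _ fc) // ler_piMl.
have [f1|f1] := eqVneq (fs phi (2 * i).-1 k) 0.
  by rewrite f1 mulr0 add0r.
have s2 : supp (fs phi (2 * i)) k by rewrite -sf.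
have l : set_lt (rng_pair phi (2 * i).-1) (rng_pair phi (2 * i)).
  by apply: Qs_lt => //; lia.
have := l k k (or_intror (supp_rng f1)) (or_intror (supp_rng s2)).
by rewrite ltnn.
Qed.

(** The properties depend on each other at odd weights: lam_i is rational
    because f'_i and x_{2i} are, and the bound on the coordinates uses that the
    supports are disjoint and |lam_i| <= 1. *)
Lemma K_level_props r w f : KL r w f ->
  [/\ finitely_supported f, rat_valued f &
      forall k, `|f k| <= if (2 <= w)%N then (m w)%:R^-1 else 1].
Proof.
move: r w f; apply: K_level_ind => [f|w r f w2 ow IH|w r f w2 ow IH].
- move=> [k k1 [->|->]]; split.
  + exact: basis_finsupp.
  + by move=> i; apply: is_rat_nat.
  + by move=> i; rewrite /basis_vec normr_nat lern1 leq_b1.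
  + rewrite -scaleN1r; exact/finsuppZ/basis_finsupp.
  + by move=> i; apply/is_ratN/is_rat_nat.
  + by move=> i; rewrite normrN /basis_vec normr_nat lern1 leq_b1.
- move=> [d [g [dn Kg gs ->]]]; rewrite w2.
  have Pg i : [/\ finitely_supported (g i), rat_valued (g i) & forall k, `|g i k| <= 1].
    have [w' _ /IH [h1 h2 h3]] := Kg i; split=> // k.
    apply: le_trans (h3 k) _; case: ifP => // w2'.
    by rewrite invf_le1 ?ltr0n ?ler1n (m_gt0 hpar) //; lia.
  split.
  + apply: finsuppZ; rewrite (_ : \sum_i g i = \sum_i (mkc (g i) : c00 R) :> (nat -> R)).
      exact: c00_finsupp.
    rewrite c00_sumE; apply: eq_bigr => i _; rewrite mkcE //; by case: (Pg i).
  + move=> k; apply: is_ratM; first exact/is_ratV/is_rat_nat.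
    by rewrite fsum; apply: is_rat_sum => i _; case: (Pg i).
  + move=> k; rewrite fscale normrM ger0_norm ?invr_ge0 // ler_piMr ?invr_ge0 // fsum.
    apply: sum_disjoint_le => // [i|i j ij]; first by case: (Pg i).
    have H (a b : 'I_d) : (a < b)%N -> g a k = 0 \/ g b k = 0.
      move=> ab; have [|ga] := eqVneq (g a k) 0; first by left.
      have [|gb] := eqVneq (g b k) 0; first by right.
      by have := gs a b ab k k ga gb; rewrite ltnn.
    move: ij; rewrite -val_eqE neq_ltn => /orP[]/H; tauto.
- move=> /odd_step_inv[phi [k [eps [E [f' [lam [nk sp iE od ->]]]]]]]; rewrite w2.
  have [[q sz] _ _ _] := sp.
  set G := fun i : 'I_k => lam i.+1 *: fs phi (2 * i.+1).-1 + f' i.+1.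
  have hi (i : 'I_k) : (0 < i.+1 <= k)%N by rewrite ltnS ltn_ord.
  have bi (i : 'I_k) := special_basic sp (hi i).
  have Pf (i : 'I_k) : [/\ finitely_supported (f' i.+1), rat_valued (f' i.+1)
      & forall k, `|f' i.+1 k| <= 1].
    have [/IH[h1 h2 h3] _ _ _ _] := od i.+1 (hi i); split => // l.
    apply: le_trans (h3 l) _; case: ifP => // w2'.
    by rewrite invf_le1 ?ltr0n ?ler1n (m_gt0 hpar) //; lia.
  have Pl (i : 'I_k) : is_rat (lam i.+1).
    have [_ _ _ k4 k5] := od i.+1 (hi i).
    have [fx|fx] := eqVneq (pairing (f' i.+1) (xs phi (2 * i.+1))) 0.
      by case: (k5 fx) => ->; try apply: is_ratN; exact/is_ratV/is_rat_nat.
    have [fxs _ rx _] : Qset (xs phi (2 * i.+1)).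
      by apply: Qs_xs => //; have := ltn_ord i; lia.
    rewrite k4 // pairingZ //; apply: is_ratM; first exact: is_rat_nat.
    rewrite pairing_mkc //; apply: rat_valued_ev; first by case: (Pf i).
    by move=> l; rewrite mkcE //; apply: rx.
  have Pfs (i : 'I_k) : Qset (fs phi (2 * i.+1).-1).
    by apply: Qs_fs => //; have := ltn_ord i; lia.
  have PG i : [/\ finitely_supported (G i), rat_valued (G i) & forall k, `|G i k| <= 1].
    have [h1 h2 h3] := Pf i; have [fxs _ rx fle] := Pfs i; split.
    + rewrite (_ : G i = lam i.+1 *: mkc (fs phi (2 * i.+1).-1) + mkc (f' i.+1) :> (nat -> R)).
        exact: c00_finsupp.
      by apply/funext => l; rewrite c00D c00Z !mkcE.
    + by move=> l; apply: is_ratD => //; apply: is_ratM.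
    + move=> l; apply: odd_pair_le => //; first by have := ltn_ord i; lia.
        by have [] := od _ (hi i).
      exact: odd_data_lam od (hi i).
  split.
  + apply: finsuppZ; rewrite (_ : restrict_to E _ =
      crop E (\sum_i (mkc (G i) : c00 R)) :> (nat -> R)).
      exact: c00_finsupp.
    apply/funext => l; rewrite cropE /restrict_to; case: ifP => // _.
    rewrite c00_sumE !fsum; apply: eq_bigr => i _; rewrite mkcE //; by case: (PG i).
  + move=> l; apply: is_ratM.
      apply: is_ratM; [exact: is_rat_sign|exact/is_ratV/is_rat_nat].
    rewrite /restrict_to; case: ifP => _; last exact: is_rat0.
    by rewrite fsum; apply: is_rat_sum => i _; have [_ h _] := PG i; exact: (h l).
  + move=> l; set F := restrict_to _ _.
    rewrite fscale 2!normrM normr_sign mul1r ger0_norm ?invr_ge0 // ler_piMr ?invr_ge0 //.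
    rewrite /F /restrict_to; case: ifP => _; last by rewrite normr0.
    rewrite fsum; apply: sum_disjoint_le => // [i|i j ij].
      by have [_ _ h] := PG i; exact: (h l).
    have H (a b : 'I_k) : (a < b)%N -> G a l = 0 \/ G b l = 0.
      move=> ab; have [|ga] := eqVneq (G a l) 0; first by left.
      have [|gb] := eqVneq (G b l) 0; first by right.
      have [_ sa _ _ _] := od _ (hi a); have [_ sb _ _ _] := od _ (hi b).
      have := @odd_pair_lt phi a.+1 b.+1 _ _ (lam a.+1) (lam b.+1) q _ _ sa sb l l ga gb.
      rewrite ltnn; have := ltn_ord b; rewrite sz => ? h.
      by have : false by apply: h; lia.
    move: ij; rewrite -val_eqE neq_ltn => /orP[]/H; tauto.
Qed.

End NormingSetFacts.

(** * The unit ball seen through the norming set *)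
Section DualBall.
Variables (R : realType) (m n s : nat -> nat) (sigma : pseq R -> nat).
Hypothesis hpar : ius_parameters m n s.
Hypothesis hsigma : coding_function m sigma.
Local Notation KL := (K_level m n sigma).
Local Notation K := (norming_set m n sigma).
Local Notation Kw := (wclass m n sigma).
Implicit Types (f g : nat -> R) (phi : pseq R) (x : c00 R).

Lemma wclass_rational w f : Kw w f -> rat_valued f.
Proof. by move=> [r _ /(K_level_props hpar hsigma)[]]. Qed.

Lemma wclass_le w f k : (2 <= w)%N -> Kw w f -> `|f k| <= (m w)%:R^-1.
Proof.
by move=> w2 [r _ /(K_level_props hpar hsigma)[_ _ /(_ k)]]; rewrite w2.
Qed.

Lemma K_le1 f k : K f -> `|f k| <= 1.
Proof.
move=> /K_wclass[w [r _ /(K_level_props hpar hsigma)[_ _ /(_ k) h]]].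
apply: le_trans h _; case: ifP => // w2.
by rewrite invf_le1 ?ltr0n ?ler1n (m_gt0 hpar) //; lia.
Qed.

Lemma K_level_opp r w f : KL r w f -> KL r w (- f).
Proof.
suff H : forall r w, (forall w' g, KL r w' g -> KL r w' (- g)) ->
    (2 <= w)%N -> forall f, KL r.+1 w f -> KL r.+1 w (- f).
  elim: r w f => [|r IH] [|[|w]] // f; last exact: H.
    1,2: by move=> [k k1 [->|->]]; exists k => //; rewrite ?opprK; [right|left].
move=> {}r {}w IH w2 {}f /(K_levelE _ _ _ _ _ w2)[h|].
  by apply/K_levelE => //; left; apply: IH.
move=> h; apply/K_levelE => //; right; move: h; case: ifP => ow.
  move=> [phi [k [nk sp Kf [eps [E [f' [lam [iE h1 ->]]]]]]]].
  exists phi, k; split=> //; exists (~~ eps), E, f', lam; split=> //.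
  by rewrite signrN mulNr scaleNr.
move=> [d [g [dn Kg gs ->]]]; exists d, (fun i => - g i); split=> //.
- by move=> i; have [w' _ h] := Kg i; exists w' => //; apply: IH.
- by move=> i j ij a b; rewrite /supp /= !oppr_eq0; apply: gs.
- by rewrite sumrN scalerN.
Qed.

Lemma restrict_basis E (k : nat) :
  restrict_to E (basis_vec R k) = if k \in E then basis_vec R k else 0.
Proof.
apply/funext => i; rewrite /restrict_to /basis_vec; have [->|ik] := eqVneq i k.
  by case: ifP => // _; rewrite eqxx.
by case: ifP => _; case: ifP => _ //; rewrite (negPf ik).
Qed.

Lemma restrictN E f : restrict_to E (- f) = - restrict_to E f.
Proof.
by rewrite -scaleN1r restrictZ scaleN1r.
Qed.

Lemma In_map (A B : Type) (h : A -> B) l b : List.In b [seq h i | i <- l] -> exists a, b = h a.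
Proof. by elim: l => //= a l IH [<-|/IH//]; exists a. Qed.

(** An odd step absorbs the interval into its own; an even step loses the
    summands that vanish. *)
Lemma K_level_restrict r w f E : is_nat_interval E -> KL r w f ->
  KL r w (restrict_to E f) \/ restrict_to E f = 0.
Proof.
move=> iE; suff H : forall r w,
    (forall w' g, KL r w' g -> KL r w' (restrict_to E g) \/ restrict_to E g = 0) ->
    (2 <= w)%N -> forall f, KL r.+1 w f ->
    KL r.+1 w (restrict_to E f) \/ restrict_to E f = 0.
  elim: r w f => [|r IH] [|[|w]] // f; last exact: H.
    1,2: move=> [k k1 [->|->]]; rewrite ?restrictN restrict_basis.
    1-4: case: ifP => _; [left; exists k => //; tauto|right; by rewrite ?oppr0].
move=> {}r {}w IH w2 {}f /(K_levelE _ _ _ _ _ w2)[h|].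
  case: (IH _ _ h) => [h'|]; last by right.
  by left; apply/K_levelE => //; left.
case ow: (odd w).
  move=> [phi [k [nk sp Kf [eps [E' [f' [lam [iE' h1 ->]]]]]]]].
  left; apply/K_levelE => //; right; rewrite ow.
  exists phi, k; split=> //; exists eps, (E `&` E'), f', lam; split=> //.
    by move=> a b l [Ea E'a] [Eb E'b] h; split; [apply: iE h|apply: iE' h].
  rewrite restrictZ; congr (_ *: _); apply/funext => i.
  rewrite /restrict_to; case: (boolP (i \in E)) => h.
    by case: (boolP (i \in E')) => h'; rewrite in_setI h ?h' ?(negPf h').
  by rewrite in_setI (negPf h).
move=> [d [g [dn Kg gs ->]]]; rewrite restrictZ restrict_sum.
pose l := [seq restrict_to E (g i) | i <- enum 'I_d].
have -> : \sum_i restrict_to E (g i) = \sum_(h <- l) h by rewrite big_map enumT.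
have [|||->|h] := @even_step_seq R m n w (\bigcup_i KL r i) l.
- by rewrite size_map size_enum_ord; case/andP: dn.
- move=> h hl; have [i ->] := In_map hl; have [w' _ hw'] := Kg i.
  by case: (IH _ _ hw') => ?; [left; exists w'|right].
- rewrite pairwise_map; apply: (@sub_in_pairwise _ predT (fun i j : 'I_d => (i < j)%N)).
  + move=> i j _ _ ij /=; apply/asboolP; apply: set_lt_sub (gs i j ij);
      exact: restrict_subsupp.
  + exact: all_predT.
  + rewrite -(pairwise_map (@nat_of_ord d) ltn) val_enum_ord -sorted_pairwise; last exact: ltn_trans.
    exact: iota_ltn_sorted.
- by right; rewrite scaler0.
- by left; apply/K_levelE => //; right; rewrite ow.
Qed.

(** The dual form of a norm bound, which does not refer to a completion. *)
Definition nbd x (c : R) := forall f, K f -> `|ev f x| <= c.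

Lemma K_basis k : (1 <= k)%N -> K (basis_vec R k).
Proof. by move=> k1; exists 0%N => //; exists 0%N => //; exists k => //; left. Qed.

Lemma nbd_coord x c k : 0 <= c -> nbd x c -> `|x k| <= c.
Proof.
move=> c0 h; case: k => [|k]; first by rewrite c00_0 normr0.
by rewrite -(ev_basis k.+1 x); apply/h/K_basis.
Qed.

Lemma nbd_ge0 x c : nbd x c -> 0 <= c.
Proof. by move=> /(_ _ (K_basis (leqnn 1))); exact: le_trans. Qed.

Lemma nbdW x c c' : c <= c' -> nbd x c -> nbd x c'.
Proof. by move=> cc' h f /h h'; apply: le_trans cc'. Qed.

Lemma nbd_crop E x c : is_nat_interval E -> nbd x c -> nbd (crop E x) c.
Proof.
move=> iE h f Kf; rewrite ev_crop; have [w [r _ hw]] := K_wclass Kf.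
case: (K_level_restrict iE hw) => [h'|->]; last by rewrite ev0l normr0 (nbd_ge0 h).
by apply: h; exists r => //; exists w.
Qed.

Lemma nbdD x y c d : nbd x c -> nbd y d -> nbd (x + y) (c + d).
Proof.
move=> hx hy f Kf; rewrite evD; apply: le_trans (ler_normD _ _) _.
by apply: lerD; [apply: hx|apply: hy].
Qed.

Lemma nbdZ (a : R) x c : nbd x c -> nbd (a *: x) (`|a| * c).
Proof. by move=> hx f Kf; rewrite evZ normrM ler_wpM2l //; apply: hx. Qed.

Lemma nbdN x c : nbd x c -> nbd (- x) c.
Proof. by move=> hx f Kf; rewrite evN normrN; apply: hx. Qed.

Lemma nbd_sum I (r : seq I) (P : pred I) (F : I -> c00 R) (c : I -> R) :
  (forall i, P i -> nbd (F i) (c i)) ->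
  nbd (\sum_(i <- r | P i) F i) (\sum_(i <- r | P i) c i).
Proof.
move=> h; elim/big_ind2 : _ => //; last by move=> *; apply: nbdD.
by move=> f _; rewrite (linear0 (ev f)) normr0.
Qed.

Lemma basic_pair_wclass p (x f : nat -> R) : (2 <= p)%N -> ~~ odd p ->
  basic_pair m n p x f -> Kw p f.
Proof. by move=> p2 op /(basic_pair_level sigma hpar p2 op) h; exists 1%N. Qed.

(** For odd weights, each summand is a restriction of lam_i f_{2i-1} + f'_{2i},
    the sum of two functionals from the unit ball: hence the factor 2. *)
Lemma wclass_decomp w f : (2 <= w)%N -> Kw w f ->
  exists d (G : nat -> nat -> R), [/\ (d <= n w)%N,
    forall i j, (i < j < d)%N -> set_lt (supp (G i)) (supp (G j)),
    forall i x c, (i < d)%N -> nbd x c -> `|ev (G i) x| <= 2 * c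
    & f = (m w)%:R^-1 *: \sum_(i < d) G i].
Proof.
move=> w2 /(wclass_inv w2)[r]; case: ifPn => ow; last first.
  move=> [d [g [/andP[d0 dn] Kg gs ->]]].
  exists d, (fun i => if insub i is Some i' then g i' else 0); split=> //.
  - move=> i j /andP[ij jd]; have id : (i < d)%N by apply: ltn_trans jd.
    by rewrite (insubT (fun i => i < d)%N id) (insubT (fun i => i < d)%N jd); apply: gs.
  - move=> i x c id h; rewrite (insubT (fun i => i < d)%N id).
    have [w' _ hw'] := Kg (Sub i id); have c0 := nbd_ge0 h.
    have : `|ev (g (Sub i id)) x| <= c by apply: h; exists r => //; exists w'.
    lra.
  - by congr (_ *: _); apply: eq_bigr => i _; rewrite valK.
move=> /(odd_step_inv)[phi [k [eps [E [f' [lam [nk sp iE od ->]]]]]]].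
have [[q sz] _ _ _] := sp.
exists k, (fun i => (-1) ^+ eps *: restrict_to E (lam i.+1 *: fs phi (2 * i.+1).-1 + f' i.+1)); split=> //.
- by rewrite nk; lia.
- move=> i j /andP[ij jk].
  have hi : (0 < i.+1 <= k)%N by lia. have hj : (0 < j.+1 <= k)%N by lia.
  have [_ si _ _ _] := od _ hi; have [_ sj _ _ _] := od _ hj.
  have h := @odd_pair_lt R phi i.+1 j.+1 (f' i.+1) (f' j.+1) (lam i.+1) (lam j.+1) q _ _ si sj.
  apply: set_lt_sub (h _ _); try lia;
    by move=> a /scale_subsupp/restrict_subsupp.
- move=> i x c ik h; have hi : (0 < i.+1 <= k)%N by lia.
  have [p [p2 op bp]] := special_basic hsigma sp hi.
  rewrite evZl normrM normr_sign mul1r -ev_crop evDl evZl.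
  have l1 := odd_data_lam hpar hsigma w2 sp od hi.
  have hc := nbd_crop iE h; have c0 := nbd_ge0 h.
  have [K' _ _ _ _] := od _ hi.
  have h1 : `|ev (fs phi (2 * i.+1).-1) (crop E x)| <= c.
    by apply: hc; apply: wclass_K (basic_pair_wclass p2 op bp).
  have h2 : `|ev (f' i.+1) (crop E x)| <= c.
    by apply: hc; exists r => //; eexists; last exact: K'.
  apply: le_trans (ler_normD _ _) _; rewrite normrM.
  have : `|lam i.+1| * `|ev (fs phi (2 * i.+1).-1) (crop E x)| <= 1 * c.
    by apply: ler_pM.
  lra.
- rewrite -scaler_sumr scalerA [in RHS]mulrC; congr (_ *: _).
  by rewrite restrict_sum.
Qed.

End DualBall.

(** * Functionals on sums of blocks *)
Section Tree.
Variables (R : realType) (m n s : nat -> nat) (sigma : pseq R -> nat).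
Hypothesis hpar : ius_parameters m n s.
Hypothesis hsigma : coding_function m sigma.
Local Notation Kw := (wclass m n sigma).
Local Notation nbd := (nbd m n sigma).
Implicit Types (f g : nat -> R) (x : c00 R) (v : nat -> c00 R) (c : nat -> nat).

Definition blocks c v :=
  forall l, (c l <= c l.+1)%N /\ supp_in (c l) (c l.+1) (v l).

Lemma blocks_mono c v i j : blocks c v -> (i <= j)%N -> (c i <= c j)%N.
Proof. by move=> h; apply: cut_mono => l; case: (h l). Qed.

Lemma blocks_disjoint c v i j k : blocks c v -> i != j ->
  v i k = 0 \/ v j k = 0.
Proof.
move=> h ij; have [|vi] := eqVneq (v i k) 0; first by left.
have [|vj] := eqVneq (v j k) 0; first by right.
have [_ /(_ k vi) hi] := h i; have [_ /(_ k vj) hj] := h j.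
move: ij; rewrite neq_ltn => /orP[] /(blocks_mono h); nlia.
Qed.

(** Successive functionals see consecutive intervals [A i, B i) of blocks, and
    neighbours share at most one block; this accounts for the summand d in the
    total length. Induction on d: the last functional takes the blocks that
    reach beyond the start of its support, the others what remains and one
    block more. *)
Lemma splitting d (G : nat -> nat -> R) c v a b :
  (forall i j, (i < j < d)%N -> set_lt (supp (G i)) (supp (G j))) ->
  blocks c v -> (a <= b)%N -> exists A B : nat -> nat,
  [/\ forall i, (i < d)%N -> (a <= A i <= B i)%N && (B i <= b)%N,
      forall i l, (i < d)%N -> (a <= l < b)%N -> ~~ (A i <= l < B i)%N ->
        ev (G i) (v l) = 0
    & (\sum_(i < d) (B i - A i) <= (b - a) + d)%N].
Proof.
elim: d b => [|d IH] b Glt bv ab.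
  by exists (fun=> 0%N), (fun=> 0%N); split=> //; rewrite big_ord0.
have Glt' i j : (i < j < d)%N -> set_lt (supp (G i)) (supp (G j)).
  by move=> ij; apply: Glt; nlia.
pose P l := (a <= l < b)%N && `[<exists k, G d k != 0 /\ (k < c l.+1)%N>].
have [hP|hP] := pselect (exists l, P l); last first.
  have [A [B [h1 h2 h3]]] := IH b Glt' bv ab.
  exists (fun i => if (i < d)%N then A i else b),
    (fun i => if (i < d)%N then B i else b); split.
  - by move=> i; rewrite ltnS => id; case: ltnP => [/h1|] //; rewrite ab leqnn.
  - move=> i l; rewrite ltnS => id lab; case: ltnP => [/h2 h|di _]; first exact: h.
    have -> : i = d by nlia.
    apply: ev_eq0 => k; apply/eqP; rewrite mulf_eq0; apply: contraT.
    rewrite negb_or => /andP[Gk vk]; case: hP; exists l; rewrite /P lab.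
    by apply/asboolP; exists k; split=> //; have [_ /(_ k vk)] := bv l; nlia.
  - rewrite big_ord_recr /= ltnn subnn addn0.
    rewrite (eq_bigr (fun i : 'I_d => B i - A i)%N) => [|i _].
      by apply: leq_trans h3 _; nlia.
    by rewrite ltn_ord.
case: (ex_minnP hP) => l0 /andP[l0ab /asboolP[k0 [Gk0 k0c]]] minl0.
have al0 : (a <= l0.+1)%N by nlia.
have [A [B [h1 h2 h3]]] := IH l0.+1 Glt' bv al0.
exists (fun i => if (i < d)%N then A i else l0),
    (fun i => if (i < d)%N then B i else b); split.
- by move=> i; rewrite ltnS => id; case: ltnP => [/h1|] //; nlia.
- move=> i l; rewrite ltnS => id lab; case: ltnP => [idd|di] nl.
    have [ll|ll] := leqP l l0; first by apply: h2 => //; nlia.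
    apply: ev_eq0 => k; apply/eqP; rewrite mulf_eq0; apply: contraT.
    rewrite negb_or => /andP[Gk vk].
    have := Glt i d; rewrite idd ltnSn => /(_ isT _ _ Gk Gk0).
    have [_ /(_ k vk)] := bv l; have := blocks_mono bv ll; nlia.
  have -> : i = d by nlia.
  apply: ev_eq0 => k; apply/eqP; rewrite mulf_eq0; apply: contraT.
  rewrite negb_or => /andP[Gk vk]; have /minl0 : P l; last nlia.
  rewrite /P lab; apply/asboolP; exists k; split=> //.
  by have [_ /(_ k vk)] := bv l; nlia.
- rewrite big_ord_recr /= ltnn.
  rewrite (eq_bigr (fun i : 'I_d => B i - A i)%N) => [|i _]; last by rewrite ltn_ord.
  by apply: leq_trans (leq_add h3 (leqnn _)) _; nlia.
Qed.

Lemma sub_big_nat (V : nmodType) (F : nat -> V) a b A B :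
  (a <= A <= B)%N -> (B <= b)%N ->
  (forall l, (a <= l < b)%N -> ~~ (A <= l < B)%N -> F l = 0) ->
  \sum_(a <= l < b) F l = \sum_(A <= l < B) F l.
Proof.
move=> /andP[aA AB] Bb h.
rewrite (big_cat_nat (n := A)) //=; last exact: leq_trans Bb.
rewrite (big_cat_nat (n := B) (m := A)) //=.
rewrite big_nat_cond big1 ?add0r => [|l /andP[hl _]]; last by apply: h; nlia.
rewrite [X in _ + X]big_nat_cond [X in _ + X]big1 ?addr0 // => l /andP[hl _].
by apply: h; nlia.
Qed.

(** The functional is an average of at most n_w successive ones; each of them
    sees an interval of blocks, and the lengths of the intervals are summed by
    [splitting]. *)
Lemma split_bound w f c v a b (al be : R) : (2 <= w)%N -> Kw w f ->
  blocks c v -> (a <= b)%N -> 0 <= al -> 0 <= be ->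
  (forall a' b', (a <= a' <= b')%N -> (b' <= b)%N ->
    nbd (\sum_(a' <= l < b') v l) (al * (b' - a')%:R + be)) ->
  `|ev f (\sum_(a <= l < b) v l)| <=
    2 / (m w)%:R * (al * (b - a + n w)%:R + be * (n w)%:R).
Proof.
move=> w2 Kf bv ab al0 be0 h.
have [d [G [dn Glt Gb ->]]] := wclass_decomp hpar hsigma w2 Kf.
have [A [B [h1 h2 h3]]] := splitting Glt bv ab.
rewrite evZl normrM ger0_norm ?invr_ge0 // ev_suml [2 / _]mulrC -mulrA.
rewrite ler_wpM2l ?invr_ge0 //; apply: le_trans (ler_norm_sum _ _ _) _.
apply: (@le_trans _ _ (\sum_(i < d) 2 * (al * (B i - A i)%:R + be))).
  apply: ler_sum => i _; have /andP[hi1 hi2] := h1 i (ltn_ord i).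
  rewrite ev_sum (sub_big_nat hi1 hi2); last by move=> l; apply: h2.
  by rewrite -ev_sum; apply: Gb => //; apply: h.
rewrite -mulr_sumr ler_wpM2l // big_split /= -mulr_sumr -natr_sum.
rewrite sumr_const card_ord -[be *+ d]mulr_natr.
apply: lerD; apply: ler_wpM2l => //.
  by rewrite ler_nat; apply: leq_trans h3 _; rewrite leq_add2l.
by rewrite ler_nat.
Qed.

Lemma K_init_sum_le f c v a b C : K_init f -> blocks c v -> 0 <= C ->
  (forall l, (a <= l < b)%N -> nbd (v l) C) ->
  `|ev f (\sum_(a <= l < b) v l)| <= C.
Proof.
move=> Kf bv C0 h; have [k k1 fE] := Kf.
have -> : `|ev f (\sum_(a <= l < b) v l)| = `|(\sum_(a <= l < b) v l) k|.
  by case: fE => ->; rewrite ?evNl ?normrN ev_basis.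
rewrite c00sum -{1}[a]add0n big_addn big_mkord.
apply: sum_disjoint_le => // [i|i j ij].
  apply: nbd_coord => //; apply: h; have := ltn_ord i; nlia.
by apply: (blocks_disjoint _ bv); rewrite eqn_add2r.
Qed.

(** Functionals of weight at least Q are controlled by assumption; those of
    smaller weight are unfolded as averages of other functionals, D times. An
    unfolding gains a factor 2 / m_w <= 1 / 4 and costs a factor 3 N in the
    additive error. *)
Section TreeEstimate.
Variables (c : nat -> nat) (v : nat -> c00 R) (L Q N : nat) (C th : R).
Hypotheses (bv : blocks c v) (N1 : (1 <= N)%N).
Hypothesis nN : forall q, (2 <= q < Q)%N -> (n q <= N)%N.
Hypotheses (C0 : 0 <= C) (th0 : 0 <= th) (th1 : th <= 1).
Hypothesis Ha : forall l, (l < L)%N -> nbd (v l) C.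
Hypothesis Hb : forall w f a b, (Q <= w)%N -> (2 <= w)%N -> Kw w f ->
  (a <= b <= L)%N ->
  `|ev f (\sum_(a <= l < b) v l)| <= C * ((b - a)%:R * th + 1).

Lemma tree_step D w f a b :
  (forall a b, (a <= b <= L)%N -> nbd (\sum_(a <= l < b) v l)
    (C * ((b - a)%:R * (th + 4%:R ^- D) + ((3 * N) ^ D)%:R))) ->
  (2 <= w < Q)%N -> Kw w f -> (a <= b <= L)%N ->
  `|ev f (\sum_(a <= l < b) v l)| <=
  2 / (m w)%:R * (C * ((b - a)%:R * (th + 4%:R ^- D) + ((3 * N) ^ D.+1)%:R)).
Proof.
move=> IH wQ Kf /andP[ab bL]; have w2 : (2 <= w)%N by case/andP: wQ.
have p0 : 0 <= 4%:R ^- D :> R by rewrite invr_ge0 exprn_ge0.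
have p1 : 4%:R ^- D <= 1 :> R by rewrite invf_le1 ?exprn_gt0 // exprn_ege1 // ler1n.
apply: le_trans (@split_bound w f c v a b (C * (th + 4%:R ^- D)) (C * ((3 * N) ^ D)%:R) _ _ _ _ _ _ _) _ => //.
- by rewrite mulr_ge0 // addr_ge0.
- by rewrite mulr_ge0.
- move=> a' b' /andP[aa' ab'] bb'; have := IH a' b'; rewrite ab' (leq_trans bb') //.
  by move=> /(_ isT); apply: nbdW; rewrite le_eqVlt; apply/orP; left; apply/eqP; ring.
rewrite ler_wpM2l ?divr_ge0 // -!mulrA -mulrDr ler_wpM2l //.
rewrite natrD mulrDr [_ * (b - a)%:R]mulrC -addrA lerD2l.
have nw : (n w)%:R <= N%:R :> R by rewrite ler_nat; apply: nN.
have X1 : 1 <= ((3 * N) ^ D)%:R :> R by rewrite ler1n expn_gt0 muln_gt0 N1.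
rewrite expnS !natrM.
set X := ((3 * N) ^ D)%:R in X1 *; set e := 4%:R ^- D in p0 p1 *.
have n0 : 0 <= (n w)%:R :> R by [].
have : (th + e) * (n w)%:R <= 2 * N%:R.
  have := th1; have := th0 => ? ?; apply: ler_pM => //; lra.
have : X * (n w)%:R <= X * N%:R by apply: ler_wpM2l => //; lra.
have : N%:R <= X * N%:R by rewrite ler_peMl.
lra.
Qed.

Lemma tree_nbd D a b : (a <= b <= L)%N -> nbd (\sum_(a <= l < b) v l)
    (C * ((b - a)%:R * (th + 4%:R ^- D) + ((3 * N) ^ D)%:R)).
Proof.
elim: D a b => [|D IH] a b abL; have /andP[ab bL] := abL.
  apply: (@nbdW _ _ _ _ _ (\sum_(a <= l < b) C)).
    rewrite sumr_const_nat -[leLHS]mulr_natr ler_wpM2l // expr0 invr1 expn0.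
    have : 0 <= (b - a)%:R * th by rewrite mulr_ge0.
    lra.
  rewrite big_nat_cond [X in nbd _ X]big_nat_cond; apply: nbd_sum => l /andP[hl _].
  by apply: Ha; nlia.
have X1 : 1 <= ((3 * N) ^ D.+1)%:R :> R by rewrite ler1n expn_gt0 muln_gt0 N1.
have p0 : 0 <= 4%:R ^- D.+1 :> R by rewrite invr_ge0 exprn_ge0.
have q0 : 0 <= (b - a)%:R * 4%:R ^- D.+1 :> R by apply: mulr_ge0.
have q1 : 0 <= (b - a)%:R * th by apply: mulr_ge0.
move=> f /K_wclass[w Kf]; case: (wclass_cases Kf) => [[_ Kf0]|w2].
  apply: (@le_trans _ _ C); last by rewrite ler_peMr // mulrDr; lra.
  by apply: (K_init_sum_le Kf0 bv) => // l hl; apply: Ha; nlia.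
have [Qw|wQ] := leqP Q w.
  apply: le_trans (Hb Qw w2 Kf abL) _; rewrite ler_wpM2l // mulrDr; lra.
apply: le_trans (@tree_step D w f a b IH _ Kf abL) _; first by rewrite w2.
rewrite mulrCA ler_wpM2l //.
have q2 : 0 <= (b - a)%:R * 4%:R ^- D :> R by apply: mulr_ge0 => //; rewrite invr_ge0 exprn_ge0.
have m32 : 2 / (m w)%:R <= 4^-1 :> R.
  rewrite ler_pdivrMr ?ltr0n ?(m_gt0 hpar) //; last nlia.
  have : 32%:R <= (m w)%:R :> R by rewrite ler_nat (m_ge32 hpar).
  lra.
apply: (@le_trans _ _ (4^-1 * ((b - a)%:R * (th + 4%:R ^- D) + ((3 * N) ^ D.+1)%:R))).
  by rewrite ler_wpM2r // mulrDr; lra.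
have -> : 4%:R ^- D.+1 = 4^-1 * 4%:R ^- D :> R by rewrite exprS invfM.
rewrite !mulrDr; lra.
Qed.

Hypotheses (Q2 : (2 <= Q)%N) (NQ : N = n Q.-1).

(** D = 5^(Q-1) unfoldings make both errors smaller than m_Q^-2, relative to
    n_Q for the additive one. *)
Lemma tree_m4 : 4%:R ^- (5 ^ Q.-1) <= (m Q)%:R ^- 2 :> R.
Proof.
rewrite lef_pV2 ?posrE ?exprn_gt0 ?ltr0n ?(m_gt0 hpar) //; last nlia.
by rewrite -!natrX ler_nat; exact: (pow4_ge hpar Q2).
Qed.

Lemma tree_nX : ((3 * N) ^ (5 ^ Q.-1).+1)%:R <= (n Q)%:R * (m Q)%:R ^- 2 :> R.
Proof.
rewrite ler_pdivlMr ?exprn_gt0 ?ltr0n ?(m_gt0 hpar) //; last nlia.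
by rewrite -natrX -natrM ler_nat NQ; exact: (n_large hpar Q2).
Qed.

Lemma tree_final : nbd (\sum_(0 <= l < L) v l)
  (C * (L%:R * (th + (m Q)%:R ^- 2) + (n Q)%:R * (m Q)%:R ^- 2)).
Proof.
have := @tree_nbd (5 ^ Q.-1) 0 L; rewrite leqnn subn0 => /(_ isT).
apply: nbdW; rewrite ler_wpM2l //; apply: lerD.
  by rewrite ler_wpM2l // lerD2l; apply: tree_m4.
apply: le_trans tree_nX; rewrite ler_nat leq_exp2l //; nlia.
Qed.

Lemma tree_final_w w f : (2 <= w < Q)%N -> Kw w f ->
  `|ev f (\sum_(0 <= l < L) v l)| <= 2 / (m w)%:R *
  (C * (L%:R * (th + (m Q)%:R ^- 2) + (n Q)%:R * (m Q)%:R ^- 2)).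
Proof.
move=> wQ Kf; apply: le_trans (@tree_step (5 ^ Q.-1) w f 0%N L _ wQ Kf _) _ => //.
  by move=> a b; apply: tree_nbd.
  by rewrite leqnn.
rewrite subn0 ler_wpM2l ?divr_ge0 // ler_wpM2l //; apply: lerD.
  by rewrite ler_wpM2l // lerD2l; apply: tree_m4.
exact: tree_nX.
Qed.

End TreeEstimate.

(** The behaviour of m_p times an average of n_p basis vectors: functionals of
    weight different from p are small on it. *)
Definition exact_vec (C : R) p x := [/\ nbd x C,
  forall w f, (2 <= w < p)%N -> Kw w f -> `|ev f x| <= C / (m w)%:R &
  forall w f, (p < w)%N -> Kw w f -> `|ev f x| <= C / (m p)%:R].

Lemma one_bad_sum_nat (F : nat -> R) (B e : R) (i0 a b : nat) : 0 <= e -> 0 <= B ->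
  (forall i, (a <= i < b)%N -> `|F i| <= B) ->
  (forall i, (a <= i < b)%N -> i != i0 -> `|F i| <= e) ->
  `|\sum_(a <= i < b) F i| <= (b - a)%:R * e + B.
Proof.
move=> e0 B0 FB Fe; apply: le_trans (ler_norm_sum _ _ _) _.
apply: (@le_trans _ _ (\sum_(a <= i < b) (e + (if i == i0 then B else 0)))).
  rewrite big_nat_cond [leRHS]big_nat_cond; apply: ler_sum => i /andP[hi _].
  have [ii|ne] := eqVneq i i0; last by rewrite addr0; apply: Fe.
  by apply: le_trans (FB i hi) _; rewrite lerDr.
rewrite big_split /= sumr_const_nat -[e *+ _]mulr_natl lerD2l.
rewrite -big_mkcond big_nat1_eq; case: ifP => // _.
Qed.

(** For a rapidly increasing sequence, each weight is badly placed with respect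
    to at most one term, so that [tree_final] applies to its sum with the
    threshold weight p and th = 1 / m_p. *)
Lemma exact_of_RIS C p c (y : nat -> c00 R) : (2 <= p)%N -> blocks c y -> 0 <= C ->
  (forall k, nbd (y k) C) ->
  (forall w, (p <= w)%N -> exists k0, forall k f, k != k0 -> Kw w f ->
     `|ev f (y k)| <= C / (m p)%:R) ->
  (forall w, (p < w)%N -> exists k0, forall k f, k != k0 -> Kw w f ->
     `|ev f (y k)| <= C / (m p)%:R ^+ 2) ->
  exact_vec (6 * C) p ((m p)%:R / (n p)%:R *: \sum_(0 <= k < n p) y k).
Proof.
move=> p2 byy C0 yC H1 H2; set S := \sum_(0 <= k < n p) y k.
have mp0 : 0 < (m p)%:R :> R by rewrite ltr0n (m_gt0 hpar) //; nlia.
have np0 : 0 < (n p)%:R :> R by rewrite ltr0n (n_gt0 hpar) //; nlia.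
have mn : (m p)%:R ^+ 2 <= (n p)%:R :> R.
  by rewrite -natrX ler_nat; exact: (n_ge_msqr hpar p2).
have m1 : 1 <= (m p)%:R :> R by rewrite ler1n -(ltr0n R).
have u0 : 0 <= (m p)%:R / (n p)%:R :> R by apply: divr_ge0; exact: ltW.
set M : R := (m p)%:R in H1 H2 mp0 mn m1 u0 *; set N : R := (n p)%:R in np0 mn u0 *.
have Mi0 : 0 < M^-1 by rewrite invr_gt0.
have Mi1 : M^-1 <= 1 by rewrite invf_le1.
have M2 : M ^- 2 <= M^-1 by rewrite -exprVn expr2 ler_piMr // ltW.
have tree_bound : N * (M^-1 + M ^- 2) + N * M ^- 2 <= 3 * (N / M).
  have : N * M ^- 2 <= N * M^-1 by rewrite ler_wpM2l // ltW.
  rewrite mulrDr; lra.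
have nN q : (2 <= q < p)%N -> (n q <= n p.-1)%N.
  by move=> hq; apply: (n_mono hpar); nlia.
have N1 : (1 <= n p.-1)%N by apply: (n_gt0 hpar); nlia.
have Hb w f a b : (p <= w)%N -> (2 <= w)%N -> Kw w f -> (a <= b <= n p)%N ->
    `|ev f (\sum_(a <= l < b) y l)| <= C * ((b - a)%:R * M^-1 + 1).
  move=> pw _ Kf _; have [k0 hk0] := H1 w pw.
  have -> : C * ((b - a)%:R * M^-1 + 1) = (b - a)%:R * (C / M) + C by ring.
  rewrite ev_sum; apply: (@one_bad_sum_nat _ _ _ k0) => //.
  - by apply: divr_ge0 => //; exact: ltW.
  - by move=> i _; apply: yC; exact: wclass_K Kf.
  - by move=> i _ ne; apply: hk0.
have t1 := @tree_final c y (n p) p (n p.-1) C M^-1 byy N1 nN C0 (ltW Mi0) Mi1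
  (fun l _ => yC l) Hb p2 erefl.
have t2 := fun w f => @tree_final_w c y (n p) p (n p.-1) C M^-1 byy N1 nN C0 (ltW Mi0) Mi1
  (fun l _ => yC l) Hb p2 erefl w f.
have eqn (a : R) : M / N * (a * (C * (3 * (N / M)))) = a * (3 * C).
  by field; rewrite !gt_eqF.
split.
- have h := nbdZ (M / N) t1; apply: nbdW h; rewrite ger0_norm //.
  apply: (@le_trans _ _ (M / N * (C * (3 * (N / M))))).
    by rewrite ler_wpM2l // ler_wpM2l.
  have := eqn 1; rewrite !mul1r => ->; lra.
- move=> w f wp Kf; rewrite evZ normrM ger0_norm //.
  apply: (@le_trans _ _ (M / N * (2 / (m w)%:R * (C * (3 * (N / M)))))).
    rewrite ler_wpM2l //; apply: le_trans (t2 w f wp Kf) _.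
    by rewrite ler_wpM2l ?divr_ge0 // ler_wpM2l.
  by rewrite eqn le_eqVlt; apply/orP; left; apply/eqP; ring.
- move=> w f pw Kf; rewrite evZ normrM ger0_norm //.
  have [k0 hk0] := H2 w pw.
  apply: (@le_trans _ _ (M / N * (N * (C / M ^+ 2) + C))).
    rewrite ler_wpM2l // /S ev_sum -[X in X * (C / _)]/((n p)%:R) -{2}[n p]subn0.
    apply: (@one_bad_sum_nat _ _ _ k0) => //.
    + by apply: divr_ge0 => //; apply: exprn_ge0; exact: ltW.
    + by move=> i _; apply: yC; exact: wclass_K Kf.
    + by move=> i _ ne; apply: hk0.
  have -> : M / N * (N * (C / M ^+ 2) + C) = C / M + C * (M / N).
    by field; rewrite !gt_eqF.
  have : C * (M / N) <= C / M.
    by rewrite ler_wpM2l // ler_pdivrMr // ler_pdivlMl // -expr2.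
  have : 0 <= C / M by apply: divr_ge0 => //; exact: ltW.
  have -> : 6 * C / M = 6 * (C / M) by rewrite mulrA.
  lra.
Qed.

End Tree.

(** * Weights along a special sequence *)
Section SpecialEstimate.
Variables (R : realType) (m n s : nat -> nat) (sigma : pseq R -> nat).
Hypothesis hpar : ius_parameters m n s.
Hypothesis hsigma : coding_function m sigma.
Local Notation K := (norming_set m n sigma).
Local Notation KL := (K_level m n sigma).
Local Notation Kw := (wclass m n sigma).
Implicit Types (f g : nat -> R) (x : c00 R) (phi psi : pseq R).

(** The first pair is not coded by a predecessor; its weight is the parameter
    p1. *)
Definition weight_at p1 phi l := if (l <= 1)%N then p1 else sigma (take l.-1 phi).

(** There are only n_p - 1 positive integers below n_p. *)
Lemma basic_pair_supp p (x f : nat -> R) : (2 <= p)%N -> basic_pair m n p x f ->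
  exists a, (n p <= a)%N /\ f a != 0.
Proof.
move=> p2 [A [uA sA A1 _ ->]].
have [a aA na] : exists2 a, a \in A & (n p <= a)%N.
  apply: contrapT => h; have np := @n_gt0 _ _ _ hpar p (ltnW p2).
  have : (size A <= size (iota 1 (n p).-1))%N.
    apply: uniq_leq_size => // a aA; rewrite mem_iota A1 //=.
    have : ~~ (n p <= a)%N by apply/negP => na; apply: h; exists a.
    nlia.
  by rewrite size_iota sA; nlia.
exists a; split=> //.
rewrite fscale mulf_neq0 ?invr_eq0 ?pnatr_eq0 -?lt0n ?(m_gt0 hpar) //; first by nlia.
rewrite fsum (big_rem a) //= {1}/basis_vec eqxx.
by rewrite gt_eqF // ltr_pwDl // sumr_ge0 // => i _; rewrite /basis_vec ler0n.
Qed.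

Lemma basic_pair_ev p (x f : nat -> R) : (2 <= p)%N -> basic_pair m n p x f ->
  finitely_supported x -> ev f ((m p)%:R *: mkc x) = 1.
Proof.
move=> p2 [A [uA sA A1 xE ->]] xfin; rewrite evZ evZl.
have mp0 : (m p)%:R != 0 :> R by rewrite pnatr_eq0 -lt0n (m_gt0 hpar) //; nlia.
have np0 : (n p)%:R != 0 :> R by rewrite pnatr_eq0 -lt0n (n_gt0 hpar) //; nlia.
rewrite mulrA mulfV // mul1r ev_suml.
rewrite (eq_big_seq (fun=> (n p)%:R^-1)) => [|a aA].
  by rewrite big_const_seq count_predT sA iter_addr_0 -[LHS]mulr_natr mulVf.
rewrite ev_basis mkcE // xE.
rewrite fscale fsum (bigD1_seq a) //= {1}/basis_vec eqxx big1 ?addr0 ?mulr1 // => i ia.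
by rewrite /basis_vec eq_sym (negPf ia).
Qed.

(** What the estimates use of the weights of a special sequence. *)
Record weighted_special k p1 phi : Prop := WeightedSpecial {
  ws_special : special m n sigma k phi ;
  ws_weight : forall l, (1 <= l <= 2 * k)%N ->
    [/\ (2 <= weight_at p1 phi l)%N, ~~ odd (weight_at p1 phi l)
      & ((2 * k) ^ 2 < m (weight_at p1 phi l))%N] ;
  ws_incr : forall l l', (1 <= l < l')%N -> (l' <= 2 * k)%N ->
    (weight_at p1 phi l < weight_at p1 phi l')%N ;
  ws_basic : forall i, (1 <= i <= k)%N ->
    basic_pair m n (weight_at p1 phi (2 * i).-1)
      (xs phi (2 * i).-1) (fs phi (2 * i).-1) }.

(** From the second position on, the weights increase because the coding does.
    The first step is different: the support of f_1 reaches n_{p1} >= m_{p1}^2,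
    while by the choice of the coding it is bounded by the square root of the m
    of the second weight. *)
Lemma special_weights_at k phi j : special m n sigma k phi -> (1 <= k)%N ->
  (1 <= j)%N -> (2 * k)%:R < Num.sqrt (m (2 * j))%:R :> R ->
  basic_pair m n (2 * j) (xs phi 1) (fs phi 1) -> weighted_special k (2 * j) phi.
Proof.
move=> sp k1 j1 kj b1; have [[q sz] _ _ h3] := sp.
pose p := weight_at (2 * j) phi.
have szt l : (l <= 2 * k)%N -> size (take l phi) = l by move=> h; rewrite size_takel // sz.
have Qt l : (1 <= l <= 2 * k)%N -> Qs (take l phi) by move=> h; apply: Qs_take; rewrite ?sz.
have pE l : (1 <= l)%N -> p l.+1 = sigma (take l phi).
  by rewrite /p /weight_at ltnS; case: l.
have ps : forall l, (1 <= l < 2 * k)%N -> (p l < p l.+1)%N.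
  move=> [|[|l]] // hl; last first.
    rewrite !pE //; have h := sigma_lt hsigma (Qt l.+2 _).
    rewrite szt in h; last by nlia.
    have -> : take l.+1 phi = take l.+1 (take l.+2 phi) by rewrite take_takel.
    by apply: h; nlia.
  rewrite (pE 1%N) // /p /weight_at /=.
  have h := sigma_max hsigma (Qt 1%N _); rewrite szt in h; last by nlia.
  have [|a [na fa]] := @basic_pair_supp (2 * j) (xs phi 1) (fs phi 1) _ b1; first by nlia.
  have := h _ a; rewrite /rng_pair xs_take // fs_take //.
  have k2 : (1 <= 1 <= 2 * k)%N by nlia.
  move=> /(_ k2 (or_intror (supp_rng fa))) ha.
  have [l l1 e] := sigma_even hsigma (Qt 1%N k2).
  rewrite ltnNge; apply/negP => le.
  have m1 : (m (sigma (take 1 phi)) <= m (2 * j))%N by apply: (m_mono hpar) => //; rewrite e; nlia.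
  have m2 : (m (2 * j) ^ 2 <= n (2 * j))%N by apply: (n_ge_msqr hpar); nlia.
  have m3 : (32 <= m (2 * j))%N by apply: (m_ge32 hpar); nlia.
  have : (a ^ 2)%:R <= (m (sigma (take 1 phi)))%:R :> R.
    rewrite natrX -(@sqr_sqrtr _ (m (sigma (take 1 phi)))%:R) //.
    by rewrite lerXn2r // nnegrE.
  rewrite ler_nat; nia.
have pm : forall l l', (1 <= l < l')%N -> (l' <= 2 * k)%N -> (p l < p l')%N.
  move=> l; elim=> [|l' IH] ll' hl'; first by nlia.
  have [<-|ne] := eqVneq l l'; first by apply: ps; nlia.
  by apply: (@ltn_trans (p l')); [apply: IH; nlia|apply: ps; nlia].
have mk : ((2 * k) ^ 2 < m (2 * j))%N.
  rewrite -(ltr_nat R) natrX -(@sqr_sqrtr _ (m (2 * j))%:R) //.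
  by rewrite ltr_pXn2r // nnegrE.
split => //.
  move=> l hl; have : (2 * j <= p l)%N.
    have [->|l1] := eqVneq l 1%N; first by [].
    by apply: ltnW; apply: (pm 1%N); nlia.
  move=> jl; rewrite -/(p l); split; first by nlia.
    move: hl; case: l {jl} => [|[|l]] // hl; first by rewrite /p /weight_at /=; nlia.
    by rewrite pE //; have [|i _ ->] := sigma_even hsigma (Qt l.+1 _); nlia.
  by apply: leq_trans mk _; apply: (m_mono hpar) => //; nlia.
move=> [|[|i]] // hi; rewrite /p /weight_at.
have -> : ((2 * i.+2).-1 <= 1)%N = false by nlia.
have e : (2 * i.+2).-1 = (2 * i.+1).+1 by nlia.
by rewrite e /=; apply: h3; nlia.
Qed.

Lemma special_weights k phi : special m n sigma k phi -> (1 <= k)%N ->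
  exists p1, weighted_special k p1 phi.
Proof.
move=> sp k1; have [_ [j [j1 kj b1]] _ _] := sp.
by exists (2 * j)%N; apply: special_weights_at.
Qed.

(** The odd functional of the sequence itself: no cut, sign +, and each f'_{2i}
    equal to f_{2i}. *)
Lemma lower_functional q k phi : (3 <= q)%N -> odd q -> n q = (2 * k)%N ->
  special m n sigma k phi ->
  (forall i, (1 <= i <= k)%N -> Kw (sigma (take (2 * i).-1 phi)) (fs phi (2 * i))) ->
  (forall i g, (1 <= i <= k)%N -> Kw (sigma (take (2 * i).-1 phi)) g ->
    `|pairing g (xs phi (2 * i))| <= (m (sigma (take (2 * i).-1 phi)))%:R^-1) ->
  let lam i := if pairing (fs phi (2 * i)) (xs phi (2 * i)) == 0
    then ((n q) ^ 2)%:R^-1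
    else pairing (fs phi (2 * i)) ((m (sigma (take (2 * i).-1 phi)))%:R *: xs phi (2 * i)) in
  K ((m q)%:R^-1 *: \sum_(i < k) (lam i.+1 *: fs phi (2 * i.+1).-1 + fs phi (2 * i.+1))).
Proof.
move=> q3 oq nq sp Kf Kx lam.
have [r Kr] : exists r, forall i, (1 <= i <= k)%N ->
    KL r (sigma (take (2 * i).-1 phi)) (fs phi (2 * i)).
  elim: (k) Kf => [|k' IH] Kf; first by exists 0%N => i; nlia.
  have [|r hr] := IH; first by move=> i hi; apply: Kf; nlia.
  have [|r' _ hr'] := Kf k'.+1; first by nlia.
  exists (maxn r r') => i hi; have [ik|ik] := leqP i k'.
    by apply: (@K_level_mono _ _ _ _ r); [exact: leq_maxl|apply: hr; nlia].
  have -> : i = k'.+1 by nlia.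
  by apply: K_level_mono hr'; exact: leq_maxr.
exists r.+1 => //; exists q => //; apply/K_levelE; first exact: ltnW.
right; rewrite oq; exists phi, k; split=> //.
exists false, setT, (fun i => fs phi (2 * i)), lam.
have k2 : (n q)./2 = k by rewrite nq mul2n doubleK.
rewrite k2; split=> //.
  move=> i hi; split=> //; first exact: Kr.
  - by move=> g Kg; apply: Kx => //; exists r.
  - by rewrite /lam => /negPf ->.
  - by rewrite /lam => ->; rewrite eqxx; left.
by rewrite restrictT expr0 div1r big_add1 /= big_mkord.
Qed.

Lemma card_bad (P : pred nat) k : (forall a b c, (a < b < c)%N -> ~~ [&& P a, P b & P c]) ->
  (\sum_(0 <= i < k) P i <= 2)%N.
Proof.
move=> h; set t := [seq i <- iota 0 k | P i].
have -> : (\sum_(0 <= i < k) P i = size t)%N.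
  by rewrite size_filter -sum1_count /index_iota subn0 [RHS]big_mkcond; apply: eq_bigr => i _; case: (P i).
have st : sorted ltn t by apply: sorted_filter; [exact: ltn_trans|exact: iota_ltn_sorted].
rewrite leqNgt; apply/negP => t2.
have Pt i : (i < size t)%N -> P (nth 0%N t i).
  by move=> it; have := mem_nth 0%N it; rewrite mem_filter => /andP[].
have lt i j : (i < j)%N -> (j < size t)%N -> (nth 0%N t i < nth 0%N t j)%N.
  by move=> ij jt; apply: (sorted_ltn_nth ltn_trans 0%N st) => //; rewrite inE //; apply: ltn_trans jt.
have := h (nth 0%N t 0) (nth 0%N t 1) (nth 0%N t 2).
by rewrite !lt ?Pt //; try nlia; move=> /(_ isT).
Qed.

End SpecialEstimate.

(** * Comparison of two special sequences *)
Section ExactSpecial.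
Variables (R : realType) (m n s : nat -> nat) (sigma : pseq R -> nat).
Hypothesis hpar : ius_parameters m n s.
Hypothesis hsigma : coding_function m sigma.
Local Notation Kw := (wclass m n sigma).
Local Notation nbd := (nbd m n sigma).
Implicit Types (f g : nat -> R) (x : c00 R) (phi psi : pseq R).

(** The weights are distinct, so that w occurs at most once. *)
Lemma incr_hits (p : nat -> nat) k w :
  (forall l l', (1 <= l < l')%N -> (l' <= 2 * k)%N -> (p l < p l')%N) ->
  exists i0, forall i, (i < k)%N -> i != i0 -> p (2 * i).+1 != w /\ p (2 * i).+2 != w.
Proof.
move=> pm; have inj l l' : (1 <= l <= 2 * k)%N -> (1 <= l' <= 2 * k)%N -> p l = p l' -> l = l'.
  move=> hl hl' e; apply/eqP; apply: contraT; rewrite neq_ltn => /orP[] h.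
    by have := pm l l'; nlia.
  by have := pm l' l; nlia.
have [[l [hl pl]]|h] := pselect (exists l, (1 <= l <= 2 * k)%N /\ p l = w).
  exists l.-1./2 => i ik ne.
  have h1 : (1 <= (2 * i).+1 <= 2 * k)%N by nlia.
  have h2 : (1 <= (2 * i).+2 <= 2 * k)%N by nlia.
  split; apply: contra_neq ne; rewrite -pl.
    by move=> /(inj _ _ h1 hl) <-; nlia.
  by move=> /(inj _ _ h2 hl) <-; nlia.
exists 0%N => i ik _; split; apply/eqP => e; apply: h; eexists; (split; last exact: e); nlia.
Qed.

Definition spec_vec p1 phi l : c00 R :=
  (m (weight_at sigma p1 phi l))%:R *: mkc (xs phi l).

(** The value a = 1 serves for differences of odd and even vectors, a = 0 for
    the even vectors alone. *)
Definition pair_vec p1 phi (a : R) k i : c00 R :=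
  if (i < k)%N then a *: spec_vec p1 phi (2 * i).+1 - spec_vec p1 phi (2 * i).+2 else 0.

(** By [es_a], the i-th pair of functionals of any sequence with the same
    beginning cancels on the i-th pair of vectors: for a = 1 the coefficient
    lam_i is the value at the even vector, for a = 0 that value is 0. *)
Record exact_special q k p1 phi (c : nat -> nat) (C a : R) : Prop := ExactSpecial {
  es_q : [/\ (3 <= q)%N, odd q & n q = (2 * k)%N] ;
  es_weighted : weighted_special m n sigma k p1 phi ;
  es_mono : forall l, (c l <= c l.+1)%N ;
  es_xs : forall l, (1 <= l <= 2 * k)%N -> supp_in (c l) (c l.+1) (xs phi l) ;
  es_fs : forall l, (1 <= l <= 2 * k)%N -> supp_in (c l) (c l.+1) (fs phi l) ;
  es_C : 1 <= C ;
  es_exact : forall l, (1 <= l <= 2 * k)%N ->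
    exact_vec m n sigma C (weight_at sigma p1 phi l) (spec_vec p1 phi l) ;
  es_a : a = 1 \/ a = 0 /\ forall i g, (1 <= i <= k)%N ->
    Kw (weight_at sigma p1 phi (2 * i)) g ->
    supp g = supp (fs phi (2 * i)) -> pairing g (xs phi (2 * i)) = 0 }.

Section Estimate.
Variables (q k p1 : nat) (phi : pseq R) (c : nat -> nat) (C a : R).
Hypothesis es : exact_special q k p1 phi c C a.
Local Notation p := (weight_at sigma p1 phi).
Local Notation v := (spec_vec p1 phi).
Local Notation V := (pair_vec p1 phi a k).

Lemma es_k_gt0 : (1 <= k)%N.
Proof. by have [q3 _ nq] := es_q es; have := @n_gt0 _ _ _ hpar q (ltnW (ltnW q3)); nlia. Qed.

Lemma es_C0 : 0 <= C. Proof. exact: le_trans (es_C es). Qed.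

Lemma es_a_le1 : `|a| <= 1.
Proof. by case: (es_a es) => [->|[-> _]]; rewrite ?normr1 ?normr0. Qed.

Local Notation kk := (((2 * k) ^ 2)%:R : R).

Lemma kk_gt0 : 0 < kk.
Proof. by rewrite ltr0n expn_gt0 muln_gt0 es_k_gt0. Qed.

Lemma Ckk_ge0 : 0 <= C / kk.
Proof. by rewrite divr_ge0 // ?es_C0 // ltW // kk_gt0. Qed.

Lemma finsupp_xs l : (1 <= l <= 2 * k)%N -> finitely_supported (xs phi l).
Proof.
have [[[Q sz] _ _ _] _ _ _] := es_weighted es; move=> hl.
by case: (@Qs_xs _ phi l Q) => //; rewrite sz.
Qed.

Lemma v_val l : (1 <= l <= 2 * k)%N -> v l = (m (p l))%:R *: xs phi l :> (nat -> R).
Proof.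
by move=> hl; apply/funext => i; rewrite c00Z mkcE //; exact: finsupp_xs.
Qed.

Lemma v_supp l : (1 <= l <= 2 * k)%N -> supp_in (c l) (c l.+1) (v l).
Proof. by move=> hl; rewrite v_val //; apply/supp_inZ/(es_xs es). Qed.

Lemma c_mono i j : (i <= j)%N -> (c i <= c j)%N.
Proof. exact: cut_mono (es_mono es) i j. Qed.

Definition pair_cut i := c (minn (2 * i).+1 (2 * k).+1).

Lemma V_blocks : blocks pair_cut V.
Proof.
move=> i; split; first by apply: c_mono; nlia.
rewrite /pair_vec /pair_cut; case: ltnP => ik; last exact: supp_in0.
have -> : minn (2 * i).+1 (2 * k).+1 = (2 * i).+1 by nlia.
have -> : minn (2 * i.+1).+1 (2 * k).+1 = (2 * i).+3 by nlia.
have -> : (a *: v (2 * i).+1 - v (2 * i).+2 : c00 R) =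
   a *: (v (2 * i).+1 : nat -> R) + (-1) *: (v (2 * i).+2 : nat -> R) :> (nat -> R).
  by rewrite scaleN1r.
have h1 : (1 <= (2 * i).+1 <= 2 * k)%N by nlia.
have h2 : (1 <= (2 * i).+2 <= 2 * k)%N by nlia.
apply: supp_inD; apply: supp_inZ.
  by apply: supp_inW (v_supp h1) _ _ => //; apply: c_mono; nlia.
by apply: supp_inW (v_supp h2) _ _ => //; apply: c_mono; nlia.
Qed.

Lemma V_nbd i : nbd (V i) (2 * C).
Proof.
have C0 := es_C0; rewrite /pair_vec; case: ltnP => ik; last first.
  by move=> f _; rewrite (linear0 (ev f)) normr0 mulr_ge0.
have h1 : (1 <= (2 * i).+1 <= 2 * k)%N by nlia.
have h2 : (1 <= (2 * i).+2 <= 2 * k)%N by nlia.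
have [e1 _ _] := es_exact es h1; have [e2 _ _] := es_exact es h2.
apply: nbdW (nbdD (nbdZ a e1) (nbdN e2)).
have : `|a| * C <= C by rewrite ler_piMl // es_a_le1.
lra.
Qed.

Lemma ev_v_diff (D : R) w g l : (2 <= w)%N -> 0 < D -> D <= (m w)%:R -> D <= kk ->
  Kw w g -> (1 <= l <= 2 * k)%N -> p l != w -> `|ev g (v l)| <= C / D.
Proof.
move=> w2 D0 wD kD Kg hl; have [_ e1 e2] := es_exact es hl.
have [p2 _ pk] := ws_weight (es_weighted es) hl.
have le M : D <= M -> C / M <= C / D.
  by move=> h; rewrite ler_wpM2l ?es_C0 // lef_pV2 // posrE // (lt_le_trans D0).
rewrite neq_ltn => /orP[pw'|wp].
  apply: le_trans (e2 w g _ Kg) (le _ _) => //; apply: le_trans kD _.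
  by rewrite ler_nat ltnW.
by apply: le_trans (e1 w g _ Kg) (le _ wD); rewrite w2.
Qed.

Lemma ev_v_kk w g l : (2 <= w)%N -> ((2 * k) ^ 2 < m w)%N -> Kw w g ->
  (1 <= l <= 2 * k)%N -> p l != w -> `|ev g (v l)| <= C / kk.
Proof.
move=> w2 wk; apply: ev_v_diff => //; first exact: kk_gt0.
by rewrite ler_nat ltnW.
Qed.

Lemma kC_le : k%:R * (2 * (C / kk)) <= C.
Proof.
rewrite mulrA mulrCA ler_piMr // ?es_C0 //.
rewrite ler_pdivrMr ?kk_gt0 // mul1r -natrM ler_nat.
have := es_k_gt0; nia.
Qed.

Lemma row_v w g : (2 <= w)%N -> ((2 * k) ^ 2 < m w)%N -> Kw w g ->
  \sum_(0 <= i < k) (`|ev g (v (2 * i).+1)| + `|ev g (v (2 * i).+2)|) <= 3 * C.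
Proof.
move=> w2 wk Kg; have C0 := es_C0.
have nn i : 0 <= `|ev g (v (2 * i).+1)| + `|ev g (v (2 * i).+2)| by rewrite addr_ge0.
apply: le_trans (ler_norm _) _.
have [i0 hi0] := incr_hits w (ws_incr (es_weighted es)).
have e0 : 0 <= 2 * (C / kk) by rewrite mulr_ge0 // Ckk_ge0.
apply: le_trans (@one_bad_sum_nat R _ (2 * C) (2 * (C / kk)) i0 0 k e0 _ _ _) _.
- by rewrite mulr_ge0.
- move=> i /andP[_ ik]; rewrite ger0_norm //.
  have h1 : (1 <= (2 * i).+1 <= 2 * k)%N by nlia.
  have h2 : (1 <= (2 * i).+2 <= 2 * k)%N by nlia.
  have [/(_ g (wclass_K Kg)) e1 _ _] := es_exact es h1.
  have [/(_ g (wclass_K Kg)) e2 _ _] := es_exact es h2; lra.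
- move=> i /andP[_ ik] ne; rewrite ger0_norm //; have [ne1 ne2] := hi0 i ik ne.
  have h1 : (1 <= (2 * i).+1 <= 2 * k)%N by nlia.
  have h2 : (1 <= (2 * i).+2 <= 2 * k)%N by nlia.
  have := ev_v_kk w2 wk Kg h1 ne1; have := ev_v_kk w2 wk Kg h2 ne2; lra.
- by rewrite subn0; have := kC_le; lra.
Qed.

(** The table T i' i contains the values of the pairs of functionals from an
    odd functional over psi at the pairs of vectors from phi. *)
Section Compare.
Variables (psi : pseq R) (w1 r : nat) (f' : nat -> nat -> R) (lam : nat -> R).
Local Notation w := (weight_at sigma w1 psi).
Hypothesis ws' : weighted_special m n sigma k w1 psi.
Hypothesis od : odd_data m n sigma q r psi k f' lam.

Local Notation gl i := (fs psi (2 * i).+1).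
Local Notation gr i := (f' i.+1).
Local Notation G i := (lam i.+1 *: gl i + gr i).

Lemma gl_K i : (i < k)%N -> Kw (w (2 * i).+1) (gl i).
Proof.
move=> ik; have h : (1 <= i.+1 <= k)%N by nlia.
have e : (2 * i.+1).-1 = (2 * i).+1 by nlia.
have h1 : (1 <= (2 * i).+1 <= 2 * k)%N by nlia.
have [p2 op _] := ws_weight ws' h1.
have := ws_basic ws' h; rewrite e; exact: (basic_pair_wclass _ hpar).
Qed.

Lemma gr_K i : (i < k)%N -> Kw (w (2 * i).+2) (gr i).
Proof.
move=> ik; have h : (1 <= i.+1 <= k)%N by nlia.
have e : (2 * i.+1).-1 = (2 * i).+1 by nlia.
have [h1 _ _ _ _] := od h; exists r => //.
by move: h1; rewrite e.
Qed.

Lemma lam_le i : (i < k)%N -> `|lam i.+1| <= 1.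
Proof.
have [q3 _ _] := es_q es; move=> ik.
apply: (odd_data_lam hpar hsigma _ (ws_special ws') od); first exact: ltnW.
by rewrite ltnS.
Qed.

Local Notation T i' i := (`|ev (G i') (V i)|).

Lemma T_le i' i : (i' < k)%N -> (i < k)%N -> T i' i <=
  (`|ev (gl i') (v (2 * i).+1)| + `|ev (gl i') (v (2 * i).+2)|) +
  (`|ev (gr i') (v (2 * i).+1)| + `|ev (gr i') (v (2 * i).+2)|).
Proof.
move=> ik' ik; rewrite /pair_vec ik evB evZ 2!evDl 2!evZl.
set X := ev (gl i') _; set X' := ev (gl i') _; set Y := ev (gr i') _; set Y' := ev (gr i') _.
have l1 := lam_le ik'; have a1 := es_a_le1.
have h (b z : R) : `|b| <= 1 -> `|b * z| <= `|z| by move=> b1; rewrite normrM ler_piMl.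
have h1 : `|a * (lam i'.+1 * X)| <= `|X| by apply: le_trans (h _ _ a1) (h _ _ l1).
have h2 : `|lam i'.+1 * X'| <= `|X'| by apply: h.
have h3 : `|a * Y| <= `|Y| by apply: h.
have -> : a * (lam i'.+1 * X + Y) - (lam i'.+1 * X' + Y') =
  (a * (lam i'.+1 * X) - lam i'.+1 * X') + (a * Y - Y') by ring.
apply: le_trans (ler_normD _ _) _; apply: lerD.
  by apply: le_trans (ler_normB _ _) _; apply: lerD.
by apply: le_trans (ler_normB _ _) _; apply: lerD.
Qed.

Lemma row_T i' : (i' < k)%N -> \sum_(0 <= i < k) T i' i <= 6 * C.
Proof.
move=> ik'.
apply: (@le_trans _ _ (\sum_(0 <= i < k) (`|ev (gl i') (v (2 * i).+1)| + `|ev (gl i') (v (2 * i).+2)|)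
  + \sum_(0 <= i < k) (`|ev (gr i') (v (2 * i).+1)| + `|ev (gr i') (v (2 * i).+2)|))).
  rewrite -big_split /= big_nat_cond [leRHS]big_nat_cond; apply: ler_sum => i /andP[hi _].
  by apply: T_le.
have h1 : (1 <= (2 * i').+1 <= 2 * k)%N by nlia.
have h2 : (1 <= (2 * i').+2 <= 2 * k)%N by nlia.
have [p2 _ pk] := ws_weight ws' h1; have [p2' _ pk'] := ws_weight ws' h2.
have := row_v p2 pk (gl_K ik'); have := row_v p2' pk' (gr_K ik'); lra.
Qed.

Lemma col_v l : (1 <= l <= 2 * k)%N ->
  \sum_(0 <= i < k) (`|ev (gl i) (v l)| + `|ev (gr i) (v l)|) <= 3 * C.
Proof.
move=> hl; have [e1 _ _] := es_exact es hl; have C0 := es_C0.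
have nn i : 0 <= `|ev (gl i) (v l)| + `|ev (gr i) (v l)| by rewrite addr_ge0.
apply: le_trans (ler_norm _) _.
have [i0 hi0] := incr_hits (p l) (ws_incr ws').
have e0 : 0 <= 2 * (C / kk) by rewrite mulr_ge0 // Ckk_ge0.
apply: le_trans (@one_bad_sum_nat R _ (2 * C) (2 * (C / kk)) i0 0 k e0 _ _ _) _.
- by rewrite mulr_ge0.
- move=> i /andP[_ ik]; rewrite ger0_norm //.
  have := e1 _ (wclass_K (gl_K ik)); have := e1 _ (wclass_K (gr_K ik)); lra.
- move=> i /andP[_ ik] ne; rewrite ger0_norm //; have [ne1 ne2] := hi0 i ik ne.
  have h1 : (1 <= (2 * i).+1 <= 2 * k)%N by nlia.
  have h2 : (1 <= (2 * i).+2 <= 2 * k)%N by nlia.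
  have [p2 _ pk] := ws_weight ws' h1; have [p2' _ pk'] := ws_weight ws' h2.
  rewrite eq_sym in ne1; rewrite eq_sym in ne2.
  have := ev_v_kk p2 pk (gl_K ik) hl ne1.
  have := ev_v_kk p2' pk' (gr_K ik) hl ne2; lra.
- by rewrite subn0; have := kC_le; lra.
Qed.

Lemma col_T : \sum_(0 <= i' < k) T i' 0 <= 6 * C.
Proof.
have k0 := es_k_gt0.
apply: (@le_trans _ _ (\sum_(0 <= i < k) (`|ev (gl i) (v 1)| + `|ev (gr i) (v 1)|)
  + \sum_(0 <= i < k) (`|ev (gl i) (v 2)| + `|ev (gr i) (v 2)|))).
  rewrite -big_split /= big_nat_cond [leRHS]big_nat_cond; apply: ler_sum => i /andP[hi _].
  apply: le_trans (T_le _ _) _ => //; rewrite muln0; lra.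
have h1 : (1 <= 1 <= 2 * k)%N by nlia.
have h2 : (1 <= 2 <= 2 * k)%N by nlia.
have := col_v h1; have := col_v h2; lra.
Qed.

(** Where the sequences agree, the functional at the odd vector gives lam_i,
    and the functional at the even vector gives the same value; only the
    coefficient of modulus 1 / n_q^2, chosen when that value is 0, is left
    over. *)
Lemma matched_T i : (i < k)%N -> take (2 * i.+1) psi = take (2 * i.+1) phi ->
  T i i <= kk^-1.
Proof.
move=> ik e; have [_ _ nq] := es_q es.
have h1 : (1 <= (2 * i).+1 <= 2 * k)%N by nlia.
have h2 : (1 <= (2 * i).+2 <= 2 * k)%N by nlia.
have hi : (1 <= i.+1 <= k)%N by nlia.
have xe l : (1 <= l <= 2 * i.+1)%N -> xs psi l = xs phi l.
  by move=> hl; rewrite -(xs_take psi hl) e xs_take.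
have fe l : (1 <= l <= 2 * i.+1)%N -> fs psi l = fs phi l.
  by move=> hl; rewrite -(fs_take psi hl) e fs_take.
have e2 : (2 * i.+1)%N = (2 * i).+2 by nlia.
have e3 : (2 * i.+1).-1 = (2 * i).+1 by nlia.
have sge : sigma (take (2 * i.+1).-1 psi) = p (2 * i).+2.
  have h : ((2 * i.+1).-1 <= 2 * i.+1)%N by nlia.
  by rewrite -(take_takel psi h) e take_takel // e3.
have := od hi; rewrite /= sge e2 xe ?fe; try nlia.
move=> [u1 u2 u3 u4 u5].
have fl := es_fs es h1; have fr : supp_in (c (2 * i).+2) (c (2 * i).+3) (gr i).
  move=> l hl; apply: (es_fs es h2); have : supp (gr i) l by [].
  by rewrite u2.
rewrite /pair_vec ik evB evZ 2!evDl 2!evZl.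
have -> : ev (fs phi (2 * i).+1) (v (2 * i).+1) = 1.
  have := ws_basic (es_weighted es) hi; rewrite e3 => b.
  have [p2 _ _] := ws_weight (es_weighted es) h1.
  by apply: (basic_pair_ev hpar) p2 b _; exact: finsupp_xs.
have -> : ev (fs phi (2 * i).+1) (v (2 * i).+2) = 0.
  by apply: ev_supp_in fl (v_supp h2) _; rewrite leqnn.
have -> : ev (gr i) (v (2 * i).+1) = 0.
  by apply: ev_supp_in fr (v_supp h1) _; rewrite leqnn orbT.
have fx := finsupp_xs h2.
have -> : ev (gr i) (v (2 * i).+2) = pairing (f' i.+1) ((m (p (2 * i).+2))%:R *: xs phi (2 * i).+2).
  by rewrite pairing_mkc ?mkcZ //; exact: finsuppZ.
have kki : 0 <= kk^-1 by rewrite invr_ge0.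
have [x0|x0] := eqVneq (pairing (f' i.+1) (xs phi (2 * i).+2)) 0.
  rewrite pairingZ // x0 !(mulr0, mulr1, addr0, add0r, subr0) normrM.
  apply: (@le_trans _ _ (1 * `|lam i.+1|)); first by rewrite ler_wpM2r // es_a_le1.
  by rewrite mul1r; case: (u5 x0) => ->; rewrite ?normrN ger0_norm ?invr_ge0 ?ler0n // nq.
have a1 : a = 1.
  case: (es_a es) => // -[_ h]; have := h i.+1 (f' i.+1) hi; rewrite e2 => hh.
  by rewrite hh ?eqxx // in x0; exists r.
by rewrite u4 // a1 !(mulr0, mulr1, addr0, add0r, mul1r, subr0) subrr normr0.
Qed.

(** Equal weights would give equal initial segments, as the coding is
    injective. *)
Lemma weights_differ l' l : (2 <= l' <= 2 * k)%N -> (2 <= l <= 2 * k)%N ->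
  (l' = l -> take l.-1 psi <> take l.-1 phi) -> p l != w l'.
Proof.
have [[[Q sz] _ _ _] _ _ _] := es_weighted es; have [[[Q' sz'] _ _ _] _ _ _] := ws'.
move=> hl' hl ne; apply/eqP; rewrite /weight_at !ifN; try nlia.
move=> /(sigma_inj hsigma) => e.
have {}e : take l.-1 phi = take l'.-1 psi by apply: e; apply: Qs_take => //; nlia.
have ll : l'.-1 = l.-1.
  by have := congr1 size e; rewrite !size_takel ?sz ?sz'; nlia.
by apply: ne; [nlia|rewrite e ll].
Qed.

Lemma unmatched_T i' i : (0 < i' < k)%N -> (0 < i < k)%N ->
  (i' = i -> take (2 * i) psi <> take (2 * i) phi) ->
  T i' i <= 4 * (C / kk).
Proof.
move=> hi' hi ne.
have dif l' l : (3 <= l' <= 2 * k)%N -> (3 <= l <= 2 * k)%N ->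
    l'.-1./2 = i' -> l.-1./2 = i -> p l != w l'.
  move=> hl' hl el' el; apply: weights_differ; try nlia.
  move=> ll e; apply: ne; first by rewrite -el' -el ll.
  have il : (2 * i <= l.-1)%N by nlia.
  by rewrite -(take_takel psi il) e take_takel.
have i'k : (i' < k)%N by nlia. have ik : (i < k)%N by nlia.
apply: le_trans (T_le i'k ik) _.
have h1' : (1 <= (2 * i').+1 <= 2 * k)%N by nlia.
have h2' : (1 <= (2 * i').+2 <= 2 * k)%N by nlia.
have h1 : (1 <= (2 * i).+1 <= 2 * k)%N by nlia.
have h2 : (1 <= (2 * i).+2 <= 2 * k)%N by nlia.
have [p2 _ pk] := ws_weight ws' h1'; have [p2' _ pk'] := ws_weight ws' h2'.
have d11 : p (2 * i).+1 != w (2 * i').+1 by apply: dif; nlia.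
have d12 : p (2 * i).+2 != w (2 * i').+1 by apply: dif; nlia.
have d21 : p (2 * i).+1 != w (2 * i').+2 by apply: dif; nlia.
have d22 : p (2 * i).+2 != w (2 * i').+2 by apply: dif; nlia.
have := ev_v_kk p2 pk (gl_K i'k) h1 d11.
have := ev_v_kk p2 pk (gl_K i'k) h2 d12.
have := ev_v_kk p2' pk' (gr_K i'k) h1 d21.
have := ev_v_kk p2' pk' (gr_K i'k) h2 d22.
lra.
Qed.

(** Let the sequences agree up to the pair with index d - 1. The exceptional
    entries of the table are those in rows 0 and d and in column 0, where the
    weights may coincide by accident; each of these three lines has sum at most
    6 C. Every other entry is at most 5 C / (2 k)^2. *)
Lemma sum_T : \sum_(0 <= i < k) \sum_(0 <= i' < k) T i' i <= 20 * C.
Proof.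
have k0 := es_k_gt0; have C0 := es_C0.
pose P t := (t <= k)%N && `[<take (2 * t) psi = take (2 * t) phi>].
have P0 : exists t, P t by exists 0%N; rewrite /P leq0n; apply/asboolP; rewrite !take0.
have Pk t : P t -> (t <= k)%N by case/andP.
case: (ex_maxnP P0 Pk) => d /andP[dk /asboolP Pd] dmax.
have Pdown t : (t <= d)%N -> take (2 * t) psi = take (2 * t) phi.
  move=> td; have h : (2 * t <= 2 * d)%N by nlia.
  by rewrite -(take_takel psi h) Pd take_takel.
pose e := 5 * (C / kk).
have Ck0 := Ckk_ge0.
have Ckk : kk^-1 <= C / kk by rewrite ler_peMl ?invr_ge0 // (es_C es).
have e0 : 0 <= e by rewrite mulr_ge0.
have T0 i' i : 0 <= T i' i by [].
have main i' i : (i' < k)%N -> (i < k)%N ->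
    T i' i <= e + (if i' == 0%N then T i' i else 0) +
     (if i' == d then T i' i else 0) + (if i == 0%N then T i' i else 0).
  move=> ik' ik; have nn (b : bool) : 0 <= (if b then T i' i else 0) by case: b.
  have n1 := nn (i' == 0%N); have n2 := nn (i' == d); have n3 := nn (i == 0%N).
  have [ii|i'0] := eqVneq i' 0%N; first by move: n2 n3; rewrite ii; lra.
  have [ii|i'd] := eqVneq i' d; first by move: n3; rewrite ii; lra.
  have [ii|i0] := eqVneq i 0%N; first by rewrite ii; lra.
  rewrite !addr0.
  have [[ii id]|h] := pselect (i' = i /\ (i < d)%N).
    rewrite ii; apply: le_trans (matched_T ik (Pdown i.+1 id)) _.
    by rewrite /e; lra.
  apply: le_trans (@unmatched_T i' i _ _ _) _; try nlia.
    move=> ii et; apply: h; split=> //.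
    have : (i <= d)%N by apply: dmax; rewrite /P (ltnW ik); apply/asboolP.
    by move: i'd; rewrite ii; nlia.
  by rewrite /e; lra.
have nat0 (F : nat -> R) j : \sum_(0 <= i < k) (if i == j then F i else 0) = if (j < k)%N then F j else 0.
  by rewrite -big_mkcond big_nat1_eq.
apply: (@le_trans _ _ (\sum_(0 <= i < k) \sum_(0 <= i' < k) (e + (if i' == 0%N then T i' i else 0) +
     (if i' == d then T i' i else 0) + (if i == 0%N then T i' i else 0)))).
  rewrite big_nat_cond [leRHS]big_nat_cond; apply: ler_sum => i /andP[/andP[_ hi] _].
  rewrite big_nat_cond [leRHS]big_nat_cond; apply: ler_sum => i' /andP[/andP[_ hi'] _].
  exact: main.
have r1 := row_T k0.
have r2 : \sum_(0 <= i < k) (if (d < k)%N then T d i else 0) <= 6 * C.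
  by case: ltnP => dk'; [exact: row_T|rewrite big1 // mulr_ge0].
have r3 : \sum_(0 <= i < k) \sum_(0 <= i' < k) (if i == 0%N then T i' i else 0) <= 6 * C.
  rewrite (eq_bigr (fun i => if i == 0%N then \sum_(0 <= i' < k) T i' i else 0)); last first.
    by move=> i _; case: eqP => // _; rewrite big1.
  by rewrite nat0 k0; exact: col_T.
have r4 : e *+ k *+ k <= 2 * C.
  rewrite -mulrnA -[e *+ _]mulr_natr natrM /e.
  have -> : 5 * (C / kk) * (k%:R * k%:R) = 5 / 4 * C.
    rewrite natrX natrM; field.
    by rewrite pnatr_eq0 -lt0n.
  lra.
rewrite (eq_bigr (fun i => e *+ k + T 0%N i + (if (d < k)%N then T d i else 0) +
   \sum_(0 <= i' < k) (if i == 0%N then T i' i else 0))); last first.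
  move=> i _; rewrite !big_split /= sumr_const_nat subn0 (nat0 (fun i' => T i' i)) k0.
  by rewrite (nat0 (fun i' => T i' i)).
rewrite !big_split /= sumr_const_nat subn0.
lra.
Qed.

End Compare.
End Estimate.
End ExactSpecial.

(** * The upper estimate for special sums *)
Section SpecialSum.
Variables (R : realType) (m n s : nat -> nat) (sigma : pseq R -> nat).
Hypothesis hpar : ius_parameters m n s.
Hypothesis hsigma : coding_function m sigma.
Local Notation Kw := (wclass m n sigma).
Local Notation nbd := (nbd m n sigma).
Implicit Types (f g : nat -> R) (x : c00 R) (phi psi : pseq R).

Variables (q k p1 : nat) (phi : pseq R) (c : nat -> nat) (C a : R).
Hypothesis es : exact_special m n sigma q k p1 phi c C a.
Local Notation p := (weight_at sigma p1 phi).
Local Notation v := (spec_vec m sigma p1 phi).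
Local Notation V := (pair_vec m sigma p1 phi a k).
Local Notation cV := (pair_cut k c).
Local Notation kk := (((2 * k) ^ 2)%:R : R).
Local Notation M := ((m q)%:R : R).

Let C0 := es_C0 es.
Let k0 := es_k_gt0 hpar es.
Let Vb := V_blocks es.
Let Vn := V_nbd es.

(** The interval E of the functional cuts at most two blocks without containing
    them, and these contribute at most 2 C each. On the others E acts as the
    identity or as 0, and [sum_T] applies. *)
Lemma special_fun_le f b b' : Kw q f -> (b <= b' <= k)%N ->
  `|ev f (\sum_(b <= i < b') V i)| <= 24 * C.
Proof.
have C0' := C0; move=> Kf /andP[bb' b'k]; have [q3 oq nq] := es_q es.
have q2 : (2 <= q)%N by exact: ltnW.
have [r] := wclass_inv q2 Kf; rewrite oq => /odd_step_inv[psi [k' [eps [E [f' [lam [nk sp' iE od fE]]]]]]].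
have kk' : k' = k by nlia.
rewrite {k'}kk' in nk sp' od fE.
have [w1 ws'] := special_weights hpar hsigma sp' k0.
have M1 : 1 <= M by rewrite ler1n (m_gt0 hpar) // ltnW.
pose G i := lam i.+1 *: fs psi (2 * i).+1 + f' i.+1.
have sT := sum_T hpar hsigma es ws' od.
pose bd i := `[<exists x y : nat, [/\ E x, ~ E y, (cV i <= x < cV i.+1)%N & (cV i <= y < cV i.+1)%N]>].
have Vin i := (Vb i).2.
have step i : `|ev f (V i)| <= (2 * C) * (bd i)%:R + \sum_(0 <= i' < k) `|ev (G i') (V i)|.
  have S0 : 0 <= \sum_(0 <= i' < k) `|ev (G i') (V i)| by apply: sumr_ge0.
  case bdi: (bd i).
    rewrite mulr1; apply: (@le_trans _ _ (2 * C)); last by rewrite lerDl.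
    by apply: Vn; exact: wclass_K Kf.
  rewrite mulr0 add0r fE evZl -ev_crop.
  have FE : \sum_(i0 < k) (lam i0.+1 *: fs psi (2 * i0.+1).-1 + f' i0.+1) =
     \sum_(0 <= i0 < k) G i0.
    rewrite big_mkord; apply: eq_bigr => i0 _; rewrite /G.
    by have -> : (2 * i0.+1).-1 = (2 * i0).+1 by nlia.
  rewrite FE normrM normrM normr_sign mul1r.
  have Mi : `|M^-1| <= 1 by rewrite ger0_norm ?invr_ge0 // ?invf_le1 // (lt_le_trans _ M1).
  have [h|h] := pselect (exists2 x, E x & V i x != 0).
    have [x Ex Vx] := h.
    have -> : crop E (V i) = V i.
      apply: c00_eqP => y; rewrite cropE; case: ifPn => // yE.
      have [->//|Vy] := eqVneq (V i y) 0.
      have : bd i.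
        apply/asboolP; exists x, y; split=> //; try exact: Vin.
        by move=> Ey; move/negP: yE; apply; rewrite inE.
      by rewrite bdi.
    rewrite ev_suml; apply: (@le_trans _ _ (1 * `|\sum_(0 <= i0 < k) ev (G i0) (V i)|)).
      by apply: ler_pM.
    by rewrite mul1r; apply: ler_norm_sum.
  have -> : crop E (V i) = 0.
    apply: c00_eqP => y; rewrite cropE; case: ifPn => // yE.
    by apply/eqP; apply: contrapT => Vy; apply: h; exists y; [rewrite inE in yE|exact/negP].
  by rewrite (linear0 (ev _)) normr0 mulr0.
rewrite ev_sum; apply: le_trans (ler_norm_sum _ _ _) _.
apply: (@le_trans _ _ (\sum_(0 <= i < k) `|ev f (V i)|)).
  rewrite [leRHS](big_cat_nat (n := b)) //=; last exact: leq_trans b'k.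
  rewrite [X in _ <= _ + X](big_cat_nat (n := b')) //=.
  have h0 B B' : 0 <= \sum_(B <= i < B') `|ev f (V i)| by apply: sumr_ge0.
  have := h0 0%N b; have := h0 b' k; lra.
apply: le_trans (ler_sum _ (fun i _ => step i)) _.
rewrite big_split /= -mulr_sumr -natr_sum.
have bd2 : (\sum_(0 <= i < k) bd i <= 2)%N.
  apply: card_bad => i j l ijl; apply/negP => /and3P[/asboolP[x1 [y1 [Ex1 _ cx1 _]]]
    /asboolP[x2 [y2 [_ nEy2 _ cy2]]] /asboolP[x3 [y3 [Ex3 _ cx3 _]]]].
  apply: nEy2; apply: (iE x1 x3) => //.
  have ij : (i < j)%N by case/andP: ijl. have jl : (j < l)%N by case/andP: ijl.
  have := blocks_mono Vb ij; have := blocks_mono Vb jl; nlia.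
have : 2 * C * (\sum_(0 <= i < k) bd i)%:R <= 2 * C * 2%:R.
  by rewrite ler_wpM2l ?mulr_ge0 // ler_nat.
rewrite /G; lra.
Qed.

Lemma large_weight_le w f b b' : (q < w)%N -> Kw w f -> (b <= b' <= k)%N ->
  `|ev f (\sum_(b <= l < b') V l)| <= (b' - b)%:R * (2 * (C / M ^+ 2)) + 2 * C.
Proof.
have C0' := C0; move=> qw Kf bbk; have [q3 oq nq] := es_q es.
have q2 : (2 <= q)%N by exact: ltnW.
have w2 : (2 <= w)%N by exact: ltn_trans qw.
have mq1 : (1 <= m q)%N by apply: (m_gt0 hpar); exact: ltnW.
have M2 : 0 < M ^+ 2 by rewrite exprn_gt0 // ltr0n.
have Mw : M ^+ 2 <= (m w)%:R.
  rewrite -natrX ler_nat; apply: leq_trans (m_ltX hpar _ qw); last exact: ltnW.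
  exact: leq_pexp2l.
have kkM : M ^+ 2 <= kk.
  rewrite -nq -natrX ler_nat leq_exp2r //.
  by apply: leq_trans (n_ge_msqr hpar q2); rewrite leq_pmulr.
have ev_le l : (1 <= l <= 2 * k)%N -> p l != w -> `|ev f (v l)| <= C / M ^+ 2.
  exact: (ev_v_diff es).
have [i0 hi0] := incr_hits w (ws_incr (es_weighted es)).
have CM0 : 0 <= C / M ^+ 2 by rewrite divr_ge0 // ltW.
rewrite ev_sum; apply: (one_bad_sum_nat (i0 := i0)).
- by rewrite mulr_ge0.
- by rewrite mulr_ge0.
- by move=> i _; apply: Vn; exact: wclass_K Kf.
- move=> i hi ne; have ik : (i < k)%N by nlia.
  have [ne1 ne2] := hi0 i ik ne; rewrite /pair_vec ik evB evZ.
  have h1 : (1 <= (2 * i).+1 <= 2 * k)%N by nlia.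
  have h2 : (1 <= (2 * i).+2 <= 2 * k)%N by nlia.
  have e1 := ev_le _ h1 ne1; have e2 := ev_le _ h2 ne2.
  apply: le_trans (ler_normB _ _) _; rewrite normrM.
  have : `|a| * `|ev f (v (2 * i).+1)| <= `|ev f (v (2 * i).+1)|.
    by rewrite ler_piMl // (es_a_le1 es).
  lra.
Qed.

(** The tree estimate with threshold weight q and th = m_q^-2: weight q itself
    is [special_fun_le], larger weights are [large_weight_le]. *)
Lemma special_sum_nbd : nbd (\sum_(0 <= i < k) V i) (160 * C * (k%:R / M ^+ 2)).
Proof.
have C0' := C0; have [q3 oq nq] := es_q es.
have q2 : (2 <= q)%N by exact: ltnW.
have M1 : 1 <= M by rewrite ler1n (m_gt0 hpar) // ltnW.
have Mp : 0 < M by exact: lt_le_trans M1.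
have M2 : 0 < M ^+ 2 by rewrite exprn_gt0.
have th1 : M ^- 2 <= 1 by rewrite invf_le1 // exprn_ege1.
have th0 : 0 <= M ^- 2 by rewrite invr_ge0 ltW.
have nN l : (2 <= l < q)%N -> (n l <= n q.-1)%N.
  by move=> hl; apply: (n_mono hpar); nlia.
have N1 : (1 <= n q.-1)%N by apply: (n_gt0 hpar); nlia.
have CC : 0 <= 40 * C by rewrite mulr_ge0.
have Ha l : (l < k)%N -> nbd (V l) (40 * C).
  by move=> _; apply: nbdW (Vn l); lra.
have Hb w f b b' : (q <= w)%N -> (2 <= w)%N -> Kw w f -> (b <= b' <= k)%N ->
    `|ev f (\sum_(b <= l < b') V l)| <= 40 * C * ((b' - b)%:R * M ^- 2 + 1).
  move=> qw w2 Kf bbk; have nn : 0 <= C * ((b' - b)%:R * M ^- 2).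
    by rewrite mulr_ge0 // mulr_ge0.
  move: qw; rewrite leq_eqVlt => /orP[/eqP qw|qw].
    by rewrite -qw in Kf; apply: le_trans (special_fun_le Kf bbk) _; lra.
  apply: le_trans (large_weight_le qw Kf bbk) _.
  have -> : (b' - b)%:R * (2 * (C / M ^+ 2)) = 2 * (C * ((b' - b)%:R * M ^- 2)) by ring.
  lra.
have := tree_final hpar hsigma Vb N1 nN CC th0 th1 Ha Hb q2 erefl.
apply: nbdW; rewrite nq natrM le_eqVlt; apply/orP; left; apply/eqP; field.
by rewrite gt_eqF.
Qed.

End SpecialSum.

(** * Construction of special sequences *)

(** Dependent choice along the half line. *)
Lemma block_choice (T : Type) (P : nat -> T -> nat -> Prop) :
  (forall lo, (1 <= lo)%N -> exists a hi, (lo <= hi)%N /\ P lo a hi) ->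
  forall lo, (1 <= lo)%N -> exists (c : nat -> nat) (a : nat -> T),
    [/\ c 0%N = lo, forall l, (c l <= c l.+1)%N & forall l, P (c l) (a l) (c l.+1)].
Proof.
move=> h lo lo1.
have h' (l : nat) : exists ah : T * nat, (l.+1 <= ah.2)%N /\ P l.+1 ah.1 ah.2.
  by have [a [hi H]] := h l.+1 isT; exists (a, hi).
have [F HF] := choice h'.
pose c := fix c l := if l is l'.+1 then (F (c l').-1).2 else lo.
have c1 l : (1 <= c l)%N.
  by elim: l => //= l IH; have [+ _] := HF (c l).-1; rewrite prednK //; exact: leq_trans.
exists c, (fun l => (F (c l).-1).1); split=> // l.
  by have [+ _] := HF (c l).-1; rewrite prednK.
by have [_ +] := HF (c l).-1; rewrite prednK.
Qed.

Section Construction.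
Variables (R : realType) (m n s : nat -> nat) (sigma : pseq R -> nat).
Hypothesis hpar : ius_parameters m n s.
Hypothesis hsigma : coding_function m sigma.
Local Notation K := (norming_set m n sigma).
Local Notation KL := (K_level m n sigma).
Local Notation Kw := (wclass m n sigma).
Local Notation exact_vec := (exact_vec m n sigma).
Implicit Types (f g : nat -> R) (phi psi : pseq R).

Lemma Qset_intro lo hi f : (1 <= lo)%N -> supp_in lo hi f -> rat_valued f ->
  (exists k, f k != 0) -> (forall k, `|f k| <= 1) -> Qset f.
Proof. by move=> l1 sf rf f0 f1; split=> //; exact: supp_in_finsupp sf. Qed.

Lemma rng_supp_in lo hi f k : supp_in lo hi f -> rng f k -> (lo <= k < hi)%N.
Proof. by move=> sf [a [b [/sf ha /sf hb hk]]]; nlia. Qed.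

Lemma Qs_of_cut phi (c : nat -> nat) : (0 < size phi)%N ->
  (forall l, (1 <= l <= size phi)%N -> [/\ Qset (xs phi l), Qset (fs phi l),
     supp_in (c l) (c l.+1) (xs phi l) & supp_in (c l) (c l.+1) (fs phi l)]) ->
  Qs phi.
Proof.
move=> sz h; split=> //.
  by move=> i /h[].
move=> i hi x y.
have [_ _ h1 h2] := h i (ltac:(nlia)); have [_ _ h3 h4] := h i.+1 (ltac:(nlia)).
by move=> [/(rng_supp_in h1)|/(rng_supp_in h2)] hx [/(rng_supp_in h3)|/(rng_supp_in h4)] hy; nlia.
Qed.

Lemma exact_vecW (C C' : R) p x : C <= C' -> exact_vec C p x -> exact_vec C' p x.
Proof.
move=> CC [h1 h2 h3]; split; first exact: nbdW h1.
  by move=> w f wp Kf; apply: le_trans (h2 w f wp Kf) _; rewrite ler_wpM2r ?invr_ge0.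
by move=> w f wp Kf; apply: le_trans (h3 w f wp Kf) _; rewrite ler_wpM2r ?invr_ge0.
Qed.

Lemma exact_vecZ (C a : R) p x : exact_vec C p x -> exact_vec (`|a| * C) p (a *: x).
Proof.
move=> [h1 h2 h3]; split; first exact: nbdZ.
  by move=> w f wp Kf; rewrite evZ normrM -mulrA ler_wpM2l //; apply: h2.
by move=> w f wp Kf; rewrite evZ normrM -mulrA ler_wpM2l //; exact: (h3 w f wp Kf).
Qed.

(** The predicate L b p lo x f hi says that (x, f) may be used with weight p on
    the interval [lo, hi), at an odd position if b is true and at an even one
    otherwise. *)
Section Build.
Variable L : bool -> nat -> nat -> (nat -> R) -> (nat -> R) -> nat -> Prop.
Hypothesis Lex : forall b p lo, (2 <= p)%N -> ~~ odd p -> (1 <= lo)%N ->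
  exists x f hi, L b p lo x f hi.
Hypothesis LQ : forall b p lo x f hi, (1 <= lo)%N -> L b p lo x f hi ->
  [/\ (lo <= hi)%N, supp_in lo hi x, supp_in lo hi f, Qset x & Qset f].
Hypothesis Lodd : forall p lo x f hi, (2 <= p)%N -> L true p lo x f hi ->
  basic_pair m n p x f /\ exact_vec 6 p ((m p)%:R *: mkc x).
Hypothesis Leven : forall p lo x f hi, (2 <= p)%N -> L false p lo x f hi ->
  Kw p f /\ exact_vec 1 p ((m p)%:R *: mkc x).

(** The weight of the next pair is known from the pairs already chosen. *)
Lemma build_pairs p1 len : (2 <= p1)%N -> ~~ odd p1 -> exists phi (c : nat -> nat),
  [/\ size phi = len, (forall l, (c l <= c l.+1)%N), (forall l, (1 <= c l)%N) &
   forall l, (1 <= l <= len)%N ->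
     L (odd l) (weight_at sigma p1 phi l) (c l) (xs phi l) (fs phi l) (c l.+1)].
Proof.
move=> p2 op; elim: len => [|len [phi [c [sz cm c1 h]]]].
  by exists [::], (fun=> 1%N); split=> // l; nlia.
pose p := weight_at sigma p1 phi len.+1.
have [p2' op'] : (2 <= p)%N /\ ~~ odd p.
  rewrite /p /weight_at; case: (ltnP 1 len.+1) => [l1|//].
  have q : Qs phi.
    apply: (@Qs_of_cut phi c); first by rewrite sz.
    by rewrite sz => l hl; have [? ? ? ? ?] := LQ (c1 l) (h l hl).
  by rewrite /= -sz take_size; have [i i1 ->] := sigma_even hsigma q; split; nlia.
have [x [f [hi hL]]] := Lex (odd len.+1) p2' op' (c1 len.+1).
have [lohi _ _ _ _] := LQ (c1 _) hL.
exists (rcons phi (x, f)), (fun l => if (l <= len.+1)%N then c l else hi).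
have wE l : (l <= len.+1)%N -> weight_at sigma p1 (rcons phi (x, f)) l = weight_at sigma p1 phi l.
  move=> hl; rewrite /weight_at; case: ifP => // _; congr sigma.
  by rewrite -cats1 takel_cat // sz; nlia.
split; first by rewrite size_rcons sz.
- move=> l; case: (ltnP l len.+1) => h1; first by rewrite (ltnW h1) cm.
  case: (leqP l len.+1) => h2 //; have -> : l = len.+1 by nlia.
  exact: lohi.
- by move=> l; case: ifP => // _; apply: leq_trans (c1 len.+1) lohi.
move=> l hl; have -> : (l <= len.+1)%N by nlia.
rewrite wE; last by nlia.
have [ll|ll] := eqVneq l len.+1.
  rewrite ll ltnn /xs /fs !nth_rcons sz /= ltnn eqxx.
  exact: hL.
have h' : (1 <= l <= len)%N by nlia.
have -> : (l.+1 <= len.+1)%N by nlia.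
have := h l h'; rewrite /xs /fs !nth_rcons sz.
by have -> : (l.-1 < len)%N by nlia.
Qed.

(** The weight of the first pair is taken so large that the condition on the
    length holds. One and the same sequence serves for both values of a. *)
Lemma special_exists q k : (3 <= q)%N -> odd q -> n q = (2 * k)%N ->
  exists p1 phi (c : nat -> nat) (lam : nat -> R),
  [/\ forall l, (1 <= l <= 2 * k)%N ->
        L (odd l) (weight_at sigma p1 phi l) (c l) (xs phi l) (fs phi l) (c l.+1),
      forall a : R, a = 1 \/ a = 0 /\ (forall i g, (1 <= i <= k)%N ->
        Kw (weight_at sigma p1 phi (2 * i)) g ->
        supp g = supp (fs phi (2 * i)) -> pairing g (xs phi (2 * i)) = 0) ->
      exact_special m n sigma q k p1 phi c 6 a,
      forall i, (1 <= i <= k)%N ->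
        let t := ev (fs phi (2 * i)) (spec_vec m sigma p1 phi (2 * i)) in
        t != 0 -> lam i = t
    & K ((m q)%:R^-1 *: \sum_(i < k) (lam i.+1 *: fs phi (2 * i.+1).-1 + fs phi (2 * i.+1)))].
Proof.
move=> q3 oq nq; have k1 : (1 <= k)%N by have := @n_gt0 _ _ _ hpar q (ltac:(nlia)); nlia.
pose j := ((2 * k) ^ 2).+1.
have j1 : (1 <= j)%N by [].
have kj : (2 * k)%:R < Num.sqrt (m (2 * j))%:R :> R.
  rewrite -(@ltr_pXn2r _ 2) // ?nnegrE // ?sqrtr_ge0 // sqr_sqrtr // -natrX ltr_nat.
  have := @m_gtid _ _ _ hpar (2 * j) (ltac:(nlia)); rewrite /j; nlia.
have [phi [c [sz cm c1 h]]] := @build_pairs (2 * j) (2 * k) (ltac:(nlia)) (ltac:(nlia)).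
set p1 := (2 * j)%N in h.
have hQ l (hl : (1 <= l <= 2 * k)%N) := LQ (c1 l) (h l hl).
have qphi : Qs phi.
  apply: (@Qs_of_cut phi c); first by rewrite sz; nlia.
  by rewrite sz => l /hQ[].
have wE l : (2 <= l)%N -> weight_at sigma p1 phi l = sigma (take l.-1 phi).
  by move=> l2; rewrite /weight_at ifN //; nlia.
have w2 l : (1 <= l <= 2 * k)%N -> (2 <= weight_at sigma p1 phi l)%N.
  move=> hl; have [l2|l2] := leqP 2 l; last by rewrite /weight_at ifT; nlia.
  have qt : Qs (take l.-1 phi) by apply: Qs_take => //; nlia.
  by rewrite wE //; have [i i1 ->] := sigma_even hsigma qt; nlia.
have ho i : (1 <= i <= k)%N -> L true (weight_at sigma p1 phi (2 * i).-1) (c (2 * i).-1)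
    (xs phi (2 * i).-1) (fs phi (2 * i).-1) (c (2 * i).-1.+1).
  by move=> hi; have := h (2 * i).-1 (ltac:(nlia)); have -> : odd (2 * i).-1 = true by nlia.
have he i : (1 <= i <= k)%N -> L false (weight_at sigma p1 phi (2 * i)) (c (2 * i))
    (xs phi (2 * i)) (fs phi (2 * i)) (c (2 * i).+1).
  by move=> hi; have := h (2 * i)%N (ltac:(nlia)); have -> : odd (2 * i) = false by nlia.
have Kx i g : (1 <= i <= k)%N -> Kw (sigma (take (2 * i).-1 phi)) g ->
    `|pairing g (xs phi (2 * i))| <= (m (sigma (take (2 * i).-1 phi)))%:R^-1.
  move=> hi Kg; have hl : (1 <= 2 * i <= 2 * k)%N by nlia.
  have [_ [e _ _]] := Leven (w2 _ hl) (he i hi).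
  have := e g (wclass_K Kg); have [_ _ _ [fx _ _ _] _] := hQ _ hl.
  rewrite evZ -pairing_mkc // wE; last by nlia.
  have mp : 0 < (m (sigma (take (2 * i).-1 phi)))%:R :> R.
    by rewrite ltr0n (m_gt0 hpar) // -wE ?(ltnW (w2 _ hl)) //; nlia.
  by rewrite normrM ger0_norm ?(ltW mp) // -ler_pdivlMl // mulr1.
have Kf i : (1 <= i <= k)%N -> Kw (sigma (take (2 * i).-1 phi)) (fs phi (2 * i)).
  move=> hi; have hl : (1 <= 2 * i <= 2 * k)%N by nlia.
  by have [] := Leven (w2 _ hl) (he i hi); rewrite wE //; nlia.
have sp : special m n sigma k phi.
  split=> //.
  - exists j; split=> //.
    by have [] := Lodd (w2 1%N (ltac:(nlia))) (ho 1%N (ltac:(nlia))).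
  - move=> i hi /=; split; last by apply: Kx => //; exact: Kf.
    have hl : (1 <= 2 * i <= 2 * k)%N by nlia.
    apply: ge_sup; first by exists `|fs phi (2 * i) 0%N|; exists 0%N.
    move=> _ [t _ <-]; apply: (wclass_le hpar hsigma _ _ (Kf i hi)).
    by rewrite -wE ?w2 //; nlia.
  - move=> i hi; have hi' : (1 <= i.+1 <= k)%N by nlia.
    have e : (2 * i.+1).-1 = (2 * i).+1 by nlia.
    have := ho i.+1 hi'; rewrite e => hh.
    have w3 : (1 <= (2 * i).+1 <= 2 * k)%N by nlia.
    have [] := Lodd (w2 _ w3) hh.
    by rewrite wE //; nlia.
have ws := special_weights_at hpar hsigma sp k1 j1 kj
  (proj1 (Lodd (w2 1%N (ltac:(nlia))) (ho 1%N (ltac:(nlia))))).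
have := lower_functional q3 oq nq sp Kf Kx.
set lam := (fun i => if _ then _ else _) => KF.
exists p1, phi, c, lam; split=> //.
- move=> a ha; split=> //.
  + by move=> l /hQ[].
  + by move=> l /hQ[].
  + by rewrite ler1n.
  + move=> l hl; have := h l hl; case ol: (odd l) => hL.
      by have [] := Lodd (w2 l hl) hL.
    have [_ e] := Leven (w2 l hl) hL; apply: exact_vecW e; lra.
- move=> i hi; have hl : (1 <= 2 * i <= 2 * k)%N by nlia.
  have [_ _ _ [fx _ _ _] _] := hQ _ hl.
  rewrite /= /lam /spec_vec evZ -pairing_mkc // -wE; last by nlia.
  rewrite mulf_eq0 negb_or => /andP[_ /negPf ->].
  by rewrite pairingZ.
Qed.

End Build.

(** Even steps before normalisation; the members may have different weights. *)
Definition succ_sum d lo hi (H : nat -> R) := exists l : seq (nat -> R),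
  [/\ (size l <= d)%N, forall g, List.In g l -> K g /\ supp_in lo hi g,
      pairwise (fun f g => `[<set_lt (supp f) (supp g)>]) l & H = \sum_(g <- l) g].

Lemma succ_sum_cat d1 d2 lo mid hi H1 H2 : (lo <= mid <= hi)%N ->
  succ_sum d1 lo mid H1 -> succ_sum d2 mid hi H2 -> succ_sum (d1 + d2) lo hi (H1 + H2).
Proof.
move=> /andP[lm mh] [l1 [s1 k1 p1 ->]] [l2 [s2 k2 p2 ->]]; exists (l1 ++ l2); split.
- by rewrite size_cat leq_add.
- move=> g hg; have [h|h] := @List.in_app_or _ _ _ _ hg.
    by have [Kg sg] := k1 g h; split=> //; apply: supp_inW sg _ _.
  by have [Kg sg] := k2 g h; split=> //; apply: supp_inW sg _ _.
- rewrite pairwise_cat p1 p2 !andbT.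
  have H f g : List.In f l1 -> List.In g l2 -> set_lt (supp f) (supp g).
    move=> hf hg; have [_ sf] := k1 f hf; have [_ sg] := k2 g hg.
    by move=> a b /sf ha /sg hb; nlia.
  elim: (l1) H => //= f t IH H; rewrite allrel_consl IH ?andbT; last by move=> *; apply: H => //; right.
  have : forall g, List.In g l2 -> set_lt (supp f) (supp g) by move=> g; apply: H; left.
  by elim: (l2) => //= g t' IH' h; rewrite asboolT /= ?IH' //; [move=> *; apply: h; right|apply: h; left].
- by rewrite big_cat.
Qed.

Lemma succ_sum_nat d N (H : nat -> nat -> R) (c : nat -> nat) : (forall l, (c l <= c l.+1)%N) ->
  (forall l, (l < N)%N -> succ_sum d (c l) (c l.+1) (H l)) ->
  succ_sum (N * d) (c 0%N) (c N) (\sum_(0 <= l < N) H l).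
Proof.
move=> cm; elim: N => [|N IH] h.
  by exists [::]; split=> //; rewrite big_geq // big_nil.
rewrite big_nat_recr //= mulSnr; apply: (@succ_sum_cat _ _ _ (c N)).
- rewrite cm andbT; elim: (N) => // N' IH'; exact: leq_trans IH' (cm _).
- by apply: IH => l lN; apply: h; apply: ltnW.
- exact: h.
Qed.

Lemma succ_sum1 lo hi f : K f -> supp_in lo hi f -> succ_sum 1 lo hi f.
Proof.
move=> Kf sf; exists [:: f]; split=> //; last by rewrite big_seq1.
by move=> g [<-|].
Qed.

Lemma succ_sum_K p d lo hi H : (2 <= p)%N -> ~~ odd p -> (d <= n p)%N ->
  succ_sum d lo hi H -> H = 0 \/ Kw p ((m p)%:R^-1 *: H).
Proof.
move=> p2 op dn [l [sl kl pl HE]].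
have [r Kr] : exists r, forall g, List.In g l -> exists w, KL r w g.
  elim: (l) kl => [|f t IH] kl; first by exists 0%N.
  have [|r hr] := IH; first by move=> g hg; apply: kl; right.
  have [[r' _ [w' _ hr']] _] := kl f (or_introl erefl).
  exists (maxn r r') => g [<-|hg].
    by exists w'; apply: K_level_mono hr'; exact: leq_maxr.
  have [w hw] := hr g hg; exists w.
  by apply: (@K_level_mono _ _ _ _ r); [exact: leq_maxl|].
have [||//|e|e] := @even_step_seq R m n p (\bigcup_i KL r i) l.
- exact: leq_trans dn.
- by move=> g /Kr[w hw]; left; exists w.
- by left; rewrite HE.
- by right; exists r.+1 => //; apply/K_levelE => //; right; rewrite (negPf op) HE.
Qed.

Lemma avg_K p (h : nat -> nat -> R) (c : nat -> nat) : (2 <= p)%N -> ~~ odd p ->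
  (forall l, (c l <= c l.+1)%N) ->
  (forall l, K (h l) /\ supp_in (c l) (c l.+1) (h l)) ->
  let S := \sum_(0 <= l < n p) h l in S = 0 \/ Kw p ((m p)%:R^-1 *: S).
Proof.
move=> p2 op cm hh S; apply: (@succ_sum_K p (n p * 1) (c 0%N) (c (n p))) => //.
  by rewrite muln1.
by apply: succ_sum_nat => // l _; have [Kh sh] := hh l; apply: succ_sum1.
Qed.

Section BasisAverage.
Variables (p : nat) (idx c : nat -> nat).
Hypotheses (p2 : (2 <= p)%N) (c01 : (1 <= c 0%N)%N).
Hypothesis cidx : forall l, (c l <= idx l < c l.+1)%N.

Let cmono i j : (i <= j)%N -> (c i <= c j)%N.
Proof. by apply: cut_mono => l; have := cidx l; nlia. Qed.

Let idx1 l : (1 <= idx l)%N.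
Proof. by have := cidx l; have := @cmono 0 l isT; nlia. Qed.

Definition basis_avg : nat -> R := (n p)%:R^-1 *: \sum_(0 <= l < n p) basis_vec R (idx l).

Lemma basis_avg_pair : basic_pair m n p basis_avg ((m p)%:R^-1 *: \sum_(0 <= l < n p) basis_vec R (idx l)).
Proof.
exists [seq idx l | l <- iota 0 (n p)]; split.
- rewrite map_inj_uniq ?iota_uniq // => i j e; apply/eqP; apply: contraT.
  rewrite neq_ltn => /orP[] /cmono; have := cidx i; have := cidx j; lia.
- by rewrite size_map size_iota.
- by move=> a /mapP[l _ ->].
- by rewrite big_map /basis_avg /index_iota subn0.
- by rewrite big_map /basis_avg /index_iota subn0.
Qed.

Lemma basis_supp_in l : supp_in (c l) (c l.+1) (basis_vec R (idx l)).
Proof.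
move=> k; rewrite /basis_vec; have [->|] := eqVneq k (idx l); first by rewrite cidx.
by rewrite eqxx.
Qed.

Lemma basis_sum_supp_in (a : R) : supp_in (c 0%N) (c (n p)) (a *: \sum_(0 <= l < n p) basis_vec R (idx l)).
Proof.
apply: supp_inZ; rewrite big_nat_cond; apply: supp_in_sum => l /andP[hl _].
by apply: supp_inW (@basis_supp_in l) _ _; apply: cmono; nlia.
Qed.

Lemma mkc_basis_avg : mkc basis_avg = (n p)%:R^-1 *: \sum_(0 <= l < n p) ebase R (idx l).
Proof.
apply: c00_eqP => k; rewrite mkcE; last exact: supp_in_finsupp c01 (@basis_sum_supp_in _).
rewrite /basis_avg fscale c00Z c00sum fsum; congr (_ * _).
apply: eq_bigr => l _; rewrite /ebase mkcE //; exact: basis_finsupp.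
Qed.

(** Basis vectors are rapidly increasing, since the coordinates of functionals
    of weight w are at most 1 / m_w. *)
Lemma basis_avg_exact : exact_vec 6 p ((m p)%:R *: mkc basis_avg).
Proof.
rewrite mkc_basis_avg scalerA -[X in exact_vec X]mulr1.
have le1 (w : nat) : (1 <= w)%N -> 0 < (m w)%:R :> R by move=> w1; rewrite ltr0n (m_gt0 hpar).
apply: (exact_of_RIS hpar hsigma (c := c)) => //.
- move=> l; split; first by apply: cmono.
  rewrite /ebase mkcE; [exact: basis_supp_in|exact: basis_finsupp].
- by move=> l f Kf; rewrite ev_ebase //; exact: (K_le1 hpar hsigma).
- move=> w pw; exists 0%N => l f _ Kf; rewrite ev_ebase // div1r.
  apply: le_trans (wclass_le hpar hsigma _ _ Kf) _; first exact: leq_trans pw.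
  by rewrite lef_pV2 ?posrE ?le1 ?ler_nat ?(m_mono hpar) //; nlia.
- move=> w pw; exists 0%N => l f _ Kf; rewrite ev_ebase // div1r.
  apply: le_trans (wclass_le hpar hsigma _ _ Kf) _; first exact: (leq_trans p2 (ltnW pw)).
  rewrite lef_pV2 ?posrE ?exprn_gt0 ?le1 //; try nlia.
  rewrite -natrX ler_nat; apply: leq_trans (m_ltX hpar _ pw); last by nlia.
  by apply: leq_pexp2l => //; apply: (m_gt0 hpar); nlia.
Qed.

Lemma basis_avg_Qset (a : R) : is_rat a -> 0 < a -> a <= 1 ->
  Qset (a *: \sum_(0 <= l < n p) basis_vec R (idx l)).
Proof.
move=> ra a0 a1; apply: Qset_intro c01 (@basis_sum_supp_in a) _ _ _.
- move=> k; rewrite fscale; apply: is_ratM => //; rewrite fsum; apply: is_rat_sum => i _.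
  exact: is_rat_nat.
- have [t [_ ft]] := basic_pair_supp hpar p2 basis_avg_pair; exists t.
  by move: ft; rewrite !fscale !mulf_eq0 !negb_or (gt_eqF a0) => /andP[].
- move=> k; rewrite fscale normrM gtr0_norm //; apply: mulr_ile1 => //; first exact: ltW.
  have := basic_pair_f_le k p2 basis_avg_pair.
  by rewrite fscale normrM ger0_norm ?invr_ge0 // ger_pMr // invr_gt0 ltr0n (m_gt0 hpar) //; nlia.
Qed.

End BasisAverage.

End Construction.

(** * The norm of the completion *)
Section NormLink.
Variables (R : realType) (m n s : nat -> nat) (sigma : pseq R -> nat).
Hypothesis hpar : ius_parameters m n s.
Hypothesis hsigma : coding_function m sigma.
Local Notation K := (norming_set m n sigma).
Local Notation Kw := (wclass m n sigma).
Local Notation nbd := (nbd m n sigma).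
Local Notation exact_vec := (exact_vec m n sigma).
Variables (X : completeNormedModType R) (J : {linear c00 R -> X}).
Hypothesis hX : is_completion (ius_norm m n sigma) J.
Implicit Types (f g : nat -> R) (x : c00 R).

Lemma K_opp f : K f -> K (- f).
Proof. by move=> [r _ [w _ h]]; exists r => //; exists w => //; apply: K_level_opp. Qed.

Lemma ev_le_norm f x : K f -> `|ev f x| <= `|J x|.
Proof.
have [L L0 hL] := ev_bounded x; move=> Kf.
have ub : has_ubound [set pairing f x | f in K].
  exists L => _ [g Kg <-]; apply: le_trans (ler_norm _) _.
  by rewrite -[L]mul1r; apply: hL => k; exact: (K_le1 hpar hsigma).
have h g : K g -> ev g x <= `|J x|.
  by move=> Kg; rewrite hX.1; apply: ub_le_sup => //; exists g.
by rewrite ler_norml h // andbT lerNl -evNl h //; exact: K_opp.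
Qed.

Lemma norm_le x c : nbd x c -> `|J x| <= c.
Proof.
move=> h; rewrite hX.1; apply: ge_sup.
  by exists (pairing (basis_vec R 1) x); exists (basis_vec R 1) => //; exact: K_basis.
by move=> _ [g Kg <-]; apply: le_trans (ler_norm _) (h g Kg).
Qed.

Lemma nbd_norm x : nbd x `|J x|.
Proof. by move=> f; exact: ev_le_norm. Qed.

Lemma coord_le_norm x k : `|x k| <= `|J x|.
Proof. by apply: nbd_coord (nbd_norm x). Qed.

Lemma norm_le_sum x B : (forall k, (B <= k)%N -> x k = 0) ->
  `|J x| <= \sum_(k < B) `|x k|.
Proof.
move=> xB; apply: norm_le => f Kf; rewrite (evE _ xB).
apply: le_trans (ler_norm_sum _ _ _) _; apply: ler_sum => i _.
by rewrite normrM ler_piMl //; exact: (K_le1 hpar hsigma).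
Qed.

Lemma norm_ebase k : (1 <= k)%N -> `|J (ebase R k)| = 1.
Proof.
move=> k1; apply/eqP; rewrite eq_le; apply/andP; split.
  by apply: norm_le => f Kf; rewrite ev_ebase //; exact: (K_le1 hpar hsigma).
by have := coord_le_norm (ebase R k) k; rewrite ebaseE // eqxx normr1.
Qed.

Lemma dense_eps (y : X) (e : R) : 0 < e -> exists x, `|y - J x| < e.
Proof.
move=> e0; have [_ d] := hX.
have [||z [h [x _ xz]]] := d (ball y e).
- by exists y; exact: ballxx.
- exact: ball_open.
- by exists x; move: h; rewrite -ball_normE xz.
Qed.

Definition seg lo hi : set nat := [set k | (lo <= k < hi)%N].

Lemma seg_interval lo hi : is_nat_interval (seg lo hi).
Proof. by move=> a b k; rewrite /seg /=; nlia. Qed.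

Lemma in_seg lo hi k : (k \in seg lo hi) = (lo <= k < hi)%N.
Proof. by apply/idP/idP; rewrite inE. Qed.

Lemma crop_seg_supp lo hi x : supp_in lo hi (crop (seg lo hi) x).
Proof. by move=> k; rewrite cropE in_seg; case: ifP => //; rewrite eqxx. Qed.

Lemma crop_seg_id lo hi x : supp_in lo hi x -> crop (seg lo hi) x = x.
Proof.
move=> sx; apply: c00_eqP => k; rewrite cropE in_seg; case: ifPn => // h.
by rewrite (supp_in_out sx).
Qed.

(** Restricting a functional to [lo, hi) does not change its value at x, and it
    stays in the norming set because that value is not 0. *)
Lemma norming_functional lo hi x (d : R) : supp_in lo hi x -> 0 <= d -> d < `|J x| ->
  exists h, [/\ K h, supp_in lo hi h & d < ev h x].
Proof.
move=> sx d0 dx.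
have [g Kg gx] : exists2 g, K g & d < ev g x.
  apply: contrapT => h; have : `|J x| <= d.
    apply: norm_le => g Kg; rewrite ler_norml lerNl -evNl; apply/andP; split.
      rewrite leNgt; apply/negP => h'; apply: h; exists (- g) => //; exact: K_opp.
    by rewrite leNgt; apply/negP => h'; apply: h; exists g.
  by rewrite leNgt dx.
exists (restrict_to (seg lo hi) g).
have gE : ev (restrict_to (seg lo hi) g) x = ev g x by rewrite -ev_crop crop_seg_id.
rewrite gE; split=> //.
- have [w [r _ hw]] := K_wclass Kg.
  case: (K_level_restrict (@seg_interval lo hi) hw) => [h|h0]; first by exists r => //; exists w.
  by move: gE gx; rewrite h0 ev0l => <-; rewrite ltNge d0.
- by move=> k; rewrite /restrict_to in_seg; case: ifP => //; rewrite eqxx.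
Qed.

(** What is required of (x, f) at an odd position (b true) or at an even one. *)
Definition good_pair (b : bool) p lo (x f : nat -> R) hi :=
  [/\ [/\ (lo <= hi)%N, supp_in lo hi x, supp_in lo hi f, Qset x & Qset f],
      b = true -> basic_pair m n p x f /\ exact_vec 6 p ((m p)%:R *: mkc x)
    & b = false -> Kw p f /\ exact_vec 1 p ((m p)%:R *: mkc x)].

(** The rational factor al brings the constant of exactness down to 1, which
    even positions require. *)
Lemma good_pair_avg p (y : nat -> c00 R) (h : nat -> nat -> R) (c : nat -> nat) (al : R) :
  (2 <= p)%N -> ~~ odd p -> (1 <= c 0%N)%N -> (forall l, (c l <= c l.+1)%N) ->
  (forall l, supp_in (c l) (c l.+1) (y l)) -> (forall l, rat_valued (y l)) ->
  (forall l, K (h l) /\ supp_in (c l) (c l.+1) (h l)) -> is_rat al ->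
  let x := (al / (n p)%:R) *: \sum_(0 <= l < n p) (y l : nat -> R) in
  let f := (m p)%:R^-1 *: \sum_(0 <= l < n p) h l in
  let v := (al * ((m p)%:R / (n p)%:R)) *: \sum_(0 <= l < n p) y l in
  exact_vec 1 p v -> v != 0 -> f <> 0 ->
  (m p)%:R *: mkc x = v /\ good_pair false p (c 0%N) x f (c (n p)).
Proof.
move=> p2 op c01 cm sy ry Kh ral x f v ev1 v0 f0.
have cmono := cut_mono cm.
have sall (F : nat -> nat -> R) : (forall l, supp_in (c l) (c l.+1) (F l)) ->
    supp_in (c 0%N) (c (n p)) (\sum_(0 <= l < n p) F l).
  move=> sF; rewrite big_nat_cond; apply: supp_in_sum => l /andP[hl _].
  by apply: supp_inW (sF l) _ _; apply: cmono; nlia.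
have sx : supp_in (c 0%N) (c (n p)) x by apply/supp_inZ/sall.
have sf : supp_in (c 0%N) (c (n p)) f by apply/supp_inZ/sall => l; case: (Kh l).
have mp0 : (m p)%:R != 0 :> R by rewrite pnatr_eq0 -lt0n (m_gt0 hpar) //; nlia.
have vE : (m p)%:R *: mkc x = v.
  apply: c00_eqP => k; rewrite c00Z mkcE; last exact: supp_in_finsupp c01 sx.
  rewrite /v c00Z c00sum /x.
  by rewrite fscale fsum; ring.
have Kf : Kw p f.
  have [h0|//] := avg_K p2 op cm Kh.
  by case: f0; rewrite /f h0 scaler0.
have xv k : x k = (m p)%:R^-1 * v k.
  rewrite -vE c00Z mkcE; last exact: supp_in_finsupp c01 sx.
  by rewrite mulKf.
split=> //; split=> //; split=> //.
- by apply: leq_trans (cmono 0%N (n p) isT) _.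
- apply: Qset_intro c01 sx _ _ _.
  + move=> k; apply: is_ratM; first by apply: is_ratM => //; exact/is_ratV/is_rat_nat.
    by rewrite fsum; apply: is_rat_sum => i _; apply: ry.
  + apply: contrapT => h'; case/eqP: v0; apply: c00_eqP => k.
    have [x0|x0] := eqVneq (x k) 0; last by case: h'; exists k.
    by move: x0; rewrite xv => /eqP; rewrite mulf_eq0 invr_eq0 (negPf mp0) => /eqP.
  + move=> k; rewrite xv normrM ger0_norm ?invr_ge0 //; have [e1 _ _] := ev1.
    apply: mulr_ile1 => //; last exact: nbd_coord e1.
    by rewrite invf_le1 ?ltr0n ?ler1n (m_gt0 hpar) //; nlia.
- apply: Qset_intro c01 sf _ _ _.
  + exact: (wclass_rational hpar hsigma Kf).
  + by apply: contrapT => h'; apply: f0; apply/funext => k; apply: contrapT => fk; apply: h'; exists k; apply/eqP.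
  + by move=> k; apply: (K_le1 hpar hsigma); exact: wclass_K Kf.
- by rewrite vE.
Qed.

Lemma ev_odd_sum k (fl fr : nat -> nat -> R) (y : nat -> c00 R) (c : nat -> nat) :
  (forall l, (c l <= c l.+1)%N) ->
  (forall i, (i < k)%N -> [/\ supp_in (c (2 * i)%N) (c (2 * i).+2) (fl i),
     supp_in (c (2 * i)%N) (c (2 * i).+2) (fr i) & supp_in (c (2 * i)%N) (c (2 * i).+2) (y i)]) ->
  ev (\sum_(i < k) (fl i + fr i)) (\sum_(i < k) y i) =
  \sum_(i < k) (ev (fl i) (y i) + ev (fr i) (y i)).
Proof.
move=> cm h; have cmono := cut_mono cm.
rewrite ev_suml; apply: eq_bigr => i _; rewrite ev_sum (bigD1 i) //= evDl.
rewrite big1 ?addr0 // => j ji; rewrite evDl.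
have [s1 s2 _] := h i (ltn_ord i); have [_ _ s3] := h j (ltn_ord j).
have hij : (c (2 * i).+2 <= c (2 * j))%N || (c (2 * j).+2 <= c (2 * i))%N.
  move: ji; rewrite -val_eqE /= neq_ltn => /orP[] h'; apply/orP; [right|left]; apply: cmono; nlia.
by rewrite (ev_supp_in s1 s3 hij) (ev_supp_in s2 s3 hij) addr0.
Qed.

End NormLink.

(** * Approximate eigenvalues on the basis *)
Section Eigen.
Variables (R : realType) (m n s : nat -> nat) (sigma : pseq R -> nat).
Hypothesis hpar : ius_parameters m n s.
Hypothesis hsigma : coding_function m sigma.
Local Notation K := (norming_set m n sigma).
Local Notation Kw := (wclass m n sigma).
Local Notation exact_vec := (exact_vec m n sigma).
Local Notation good_pair := (good_pair m n sigma).
Variables (X : completeNormedModType R) (J : {linear c00 R -> X}).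
Hypothesis hX : is_completion (ius_norm m n sigma) J.
Implicit Types (f g : nat -> R).

Lemma cell_uniq (c : nat -> nat) k l l' : (forall i, (c i <= c i.+1)%N) ->
  (c l <= k < c l.+1)%N -> (c l' <= k < c l'.+1)%N -> l = l'.
Proof.
move=> cm /andP[h1 h2] /andP[h3 h4].
have cmono := cut_mono cm.
apply/eqP; rewrite eqn_leq; apply/andP; split; rewrite leqNgt; apply/negP => /cmono h.
  by have := leq_ltn_trans h1 (leq_trans h4 h); rewrite ltnn.
by have := leq_ltn_trans h3 (leq_trans h2 h); rewrite ltnn.
Qed.

Lemma odd_pair_exists (P : nat -> Prop) p lo :
  (forall N, exists i, (N <= i)%N /\ P i) -> (2 <= p)%N -> ~~ odd p -> (1 <= lo)%N ->
  exists x f hi idx, [/\ good_pair true p lo x f hi, forall l, P (idx l),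
    forall l, (lo <= idx l)%N & mkc x = (n p)%:R^-1 *: \sum_(0 <= l < n p) ebase R (idx l)].
Proof.
move=> HP p2 op lo1.
have [|c [idx [c0 cm cidx]]] := @block_choice nat (fun lo i hi => (lo <= i < hi)%N /\ P i) _ lo lo1.
  move=> l l1; have [i [li Pi]] := HP l; exists i, i.+1; split; first exact: leqW.
  by rewrite li ltnSn.
have ci l : (c l <= idx l < c l.+1)%N by case: (cidx l).
have c01 : (1 <= c 0%N)%N by rewrite c0.
have np1 : (1 <= n p)%N by apply: (n_gt0 hpar); nlia.
have mp1 : (1 <= m p)%N by apply: (m_gt0 hpar); nlia.
have cmono := cut_mono cm.
exists (basis_avg R n p idx), ((m p)%:R^-1 *: \sum_(0 <= l < n p) basis_vec R (idx l)), (c (n p)), idx.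
split; last exact: (mkc_basis_avg R n p2 c01 ci).
- split=> //; last first.
    move=> _; split; first exact: (basis_avg_pair R m n p2 c01 ci).
    exact: (basis_avg_exact hpar hsigma p2 c01 ci).
  rewrite -{1 2 3}c0; split.
  + exact: cmono.
  + exact: (@basis_sum_supp_in R n p idx c p2 c01 ci).
  + exact: (@basis_sum_supp_in R n p idx c p2 c01 ci).
  + apply: (basis_avg_Qset hpar p2 c01 ci); first exact/is_ratV/is_rat_nat.
      by rewrite invr_gt0 ltr0n.
    by rewrite invf_le1 ?ltr0n ?ler1n.
  + apply: (basis_avg_Qset hpar p2 c01 ci); first exact/is_ratV/is_rat_nat.
      by rewrite invr_gt0 ltr0n.
    by rewrite invf_le1 ?ltr0n ?ler1n.
- by move=> l; case: (cidx l).
- by move=> l; have := ci l; have := cmono 0%N l isT; nlia.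
Qed.

Lemma bound_nat (x : R) : exists N, forall M, (N <= M)%N -> x <= M%:R.
Proof.
exists (Num.bound `|x|) => M NM; apply: le_trans (ler_norm x) _.
have := archi_boundP (normr_ge0 x) => h; apply: le_trans (ltW h) _; by rewrite ler_nat.
Qed.

Lemma large_odd_weight (C : R) :
  exists q k, [/\ (3 <= q)%N, odd q, n q = (2 * k)%N, (0 < k)%N & C <= (m q)%:R].
Proof.
have [N hN] := bound_nat C; pose q := (2 * N).+3; exists q, (n q)./2.
have q2 : (2 <= q)%N by rewrite /q.
have nq := n_even hpar q2; have n0 := @n_gt0 _ _ _ hpar q (ltnW q2).
have mq := @m_gtid _ _ _ hpar q (ltnW q2).
split; [by []|by rewrite /q; nlia|nlia|nlia|].
by apply: hN; rewrite /q in mq *; nlia.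
Qed.

(** The extra requirement E on the pairs is what distinguishes the two uses of
    special sequences below. *)
Lemma special_exists_good (E : bool -> nat -> nat -> (nat -> R) -> (nat -> R) -> nat -> Prop) q k :
  (forall b p lo, (2 <= p)%N -> ~~ odd p -> (1 <= lo)%N ->
     exists x f hi, good_pair b p lo x f hi /\ E b p lo x f hi) ->
  (3 <= q)%N -> odd q -> n q = (2 * k)%N ->
  exists p1 phi (c : nat -> nat) (lam : nat -> R),
  [/\ forall l, (1 <= l <= 2 * k)%N ->
        let p := weight_at sigma p1 phi l in
        good_pair (odd l) p (c l) (xs phi l) (fs phi l) (c l.+1) /\
        E (odd l) p (c l) (xs phi l) (fs phi l) (c l.+1),
      forall a : R, a = 1 \/ a = 0 /\ (forall i g, (1 <= i <= k)%N ->
        Kw (weight_at sigma p1 phi (2 * i)) g ->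
        supp g = supp (fs phi (2 * i)) -> pairing g (xs phi (2 * i)) = 0) ->
      exact_special m n sigma q k p1 phi c 6 a,
      forall i, (1 <= i <= k)%N ->
        let t := ev (fs phi (2 * i)) (spec_vec m sigma p1 phi (2 * i)) in
        t != 0 -> lam i = t
    & K ((m q)%:R^-1 *: \sum_(i < k) (lam i.+1 *: fs phi (2 * i.+1).-1 + fs phi (2 * i.+1)))].
Proof.
pose L b p lo (x f : nat -> R) hi := good_pair b p lo x f hi /\ E b p lo x f hi.
move=> Lex; apply: (@special_exists _ _ _ _ _ hpar hsigma L Lex).
- by move=> b p lo x f hi _ [[]].
- by move=> p lo x f hi _ [[_ /(_ erefl)]].
- by move=> p lo x f hi _ [[_ _ /(_ erefl)]].
Qed.

Section Operator.
Variables (T : {linear X -> X}) (B : R).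
Hypothesis B0 : 0 <= B.
Hypothesis TB : forall x, `|T x| <= B * `|x|.

Lemma op_sum (a b : nat -> c00 R) (r eta : R) N :
  (forall l, `|T (J (a l)) - J (b l)| <= eta) ->
  `|T (J (r *: \sum_(0 <= l < N) a l)) - J (r *: \sum_(0 <= l < N) b l)| <= `|r| * (N%:R * eta).
Proof.
move=> h; have JZ x : J (r *: x) = r *: J x by rewrite linearZ.
have TZ y : T (r *: y) = r *: T y by rewrite linearZ.
rewrite !JZ TZ -scalerBr normrZ ler_wpM2l //.
have -> : T (J (\sum_(0 <= l < N) a l)) - J (\sum_(0 <= l < N) b l) =
    \sum_(0 <= l < N) (T (J (a l)) - J (b l)).
  by rewrite sumrB !linear_sum.
apply: le_trans (ler_norm_sum _ _ _) _.
apply: (@le_trans _ _ (\sum_(0 <= l < N) eta)); first by apply: ler_sum.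
by rewrite sumr_const_nat subn0 mulr_natl.
Qed.

(** Otherwise averages of the basis vectors e_i with |t_i(k)| >= e and constant
    sign would have small norm, and images whose k-th coordinate is about e. *)
Lemma coord_null (t : nat -> c00 R) :
  (forall i, `|T (J (ebase R i)) - J (t i)| <= i.+1%:R^-1) ->
  forall k (e : R), 0 < e -> exists N, forall i, (N <= i)%N -> `|t i k| < e.
Proof.
move=> tT k e e0; apply: contrapT => h.
have h1 N : exists i, (N <= i)%N /\ e <= `|t i k|.
  apply: contrapT => h'; apply: h; exists N => i Ni; rewrite ltNge; apply/negP => ei.
  by apply: h'; exists i.
have [sg [sg1 hsg]] : exists sg : R, `|sg| = 1 /\ forall N, exists i, (N <= i)%N /\ e <= sg * t i k.
  have [H|/existsNP[N0 H]] := pselect (forall N, exists i, (N <= i)%N /\ e <= t i k).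
    by exists 1; rewrite normr1; split=> // N; have [i] := H N; rewrite -[t i k]mul1r; exists i.
  exists (-1); rewrite normrN normr1; split=> // N.
  have [i [Ni ei]] := h1 (maxn N N0); exists i; split; first by nlia.
  rewrite mulN1r; move: ei; rewrite ler_normr => /orP[|//] ei.
  by case: H; exists i; split=> //; nlia.
have [N2 hN2] := bound_nat (4 / e).
have [p0 hp0] := bound_nat (24 * B / e).
pose p := (2 * p0.+1)%N.
have p2 : (2 <= p)%N by rewrite /p; nlia.
have mp0 : 0 < (m p)%:R :> R by rewrite ltr0n (m_gt0 hpar) // /p; nlia.
have hmp : 24 * B / e <= (m p)%:R.
  by apply: hp0; have := @m_gtid _ _ _ hpar p (ltnW p2); rewrite /p; nlia.
have op : ~~ odd p by rewrite /p; nlia.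
have HP N : exists i, (N <= i)%N /\ ((N2 <= i)%N /\ e <= sg * t i k).
  by have [i [Ni ei]] := hsg (maxn N N2); exists i; do !split=> //; nlia.
have [x [f [hi [idx [gp Pi _ xE]]]]] := odd_pair_exists HP p2 op (leqnn 1).
have [_ /(_ erefl) [_ [ex _ _]] _] := gp.
have Jx : `|J (mkc x)| <= 6 / (m p)%:R.
  have := norm_le hX ex; rewrite linearZ /= normrZ (gtr0_norm mp0).
  by rewrite ler_pdivlMr // mulrC.
have np0 : 0 < (n p)%:R :> R by rewrite ltr0n (n_gt0 hpar) // ltnW.
pose W := (n p)%:R^-1 *: \sum_(0 <= l < n p) t (idx l).
have d1 : `|T (J (mkc x)) - J W| <= e / 4.
  rewrite xE; apply: le_trans (op_sum (b := fun l => t (idx l)) (eta := e / 4) _ _ _) _.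
    move=> l; apply: le_trans (tT _) _; have [Nl _] := Pi l.
    have := hN2 (idx l).+1 (leqW Nl); rewrite ler_pdivrMr // => h4.
    rewrite ler_pdivlMr // -ler_pdivlMl ?invr_gt0 ?ltr0n // invrK; exact: h4.
  by rewrite gtr0_norm ?invr_gt0 // mulKf // gt_eqF.
have d2 : e <= `|W k|.
  have -> : `|W k| = `|sg * W k| by rewrite [RHS]normrM sg1 mul1r.
  apply: le_trans (ler_norm _); rewrite c00Z c00sum mulrCA -ler_pdivrMl ?invr_gt0 // invrK.
  rewrite mulr_sumr; apply: (@le_trans _ _ (\sum_(0 <= l < n p) e)).
    by rewrite sumr_const_nat subn0 mulr_natl.
  by apply: ler_sum => l _; case: (Pi l).
have d3 := coord_le_norm hpar hsigma hX W k.
have d4 : `|J W| <= `|T (J (mkc x))| + e / 4.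
  by rewrite -[J W](subKr (T (J (mkc x)))); apply: le_trans (ler_normB _ _) _; rewrite lerD2l.
have d5 : `|T (J (mkc x))| <= e / 4.
  apply: le_trans (TB _) _; apply: (@le_trans _ _ (B * (6 / (m p)%:R))); first by rewrite ler_wpM2l.
  move: hmp; rewrite ler_pdivrMr // => hmp.
  rewrite mulrA ler_pdivrMr //; lra.
lra.
Qed.

(** Removing from T e_i the i-th coordinate and the coordinates below lo, which
    are small by [coord_null], leaves a vector of norm at least 3 d / 4. One of
    its parts on the left and on the right of i has norm above d / 4, and is
    normed by a functional that vanishes at e_i. *)
Lemma far_items (t : nat -> c00 R) (d : R) N (e : R) :
  (forall i, `|T (J (ebase R i)) - J (t i)| <= i.+1%:R^-1) ->
  0 < d -> (forall i a, (N <= i)%N -> d <= `|T (J (ebase R i)) - a *: J (ebase R i)|) ->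
  0 < e -> e <= d / 4 ->
  forall lo, (1 <= lo)%N -> exists ih : (nat * c00 R * (nat -> R)), exists hi,
  (lo <= hi)%N /\ let: (i, z, h) := ih in
  [/\ (lo <= i < hi)%N, supp_in lo hi z, K h /\ supp_in lo hi h, h i = 0 &
      d / 4 <= ev h z /\ `|T (J (ebase R i)) - J z| <= e].
Proof.
move=> tT d0 far e0 ed lo lo1.
have [N1 hN1] : exists N1, forall i, (N1 <= i)%N -> \sum_(k < lo) `|t i k| <= e / 2.
  have cn := coord_null tT.
  have lo0 : 0 < lo%:R :> R by rewrite ltr0n.
  have : forall j, (j <= lo)%N -> exists N1, forall i k, (N1 <= i)%N -> (k < j)%N -> `|t i k| < e / 2 / lo%:R.
    elim=> [|j IH] jlo; first by exists 0%N.
    have [N1 h1] := IH (ltnW jlo).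
    have [|N2 h2] := cn j (e / 2 / lo%:R); first by rewrite !divr_gt0.
    exists (maxn N1 N2) => i k Ni; rewrite ltnS leq_eqVlt => /orP[/eqP->|kj]; first by apply: h2; nlia.
    by apply: h1 => //; nlia.
  move=> /(_ lo (leqnn _))[N1 h1]; exists N1 => i Ni.
  apply: (@le_trans _ _ (\sum_(k < lo) (e / 2 / lo%:R))).
    by apply: ler_sum => k _; apply/ltW/h1.
  by rewrite sumr_const card_ord -[X in X <= _]mulr_natr divfK // gt_eqF.
have [N2 hN2] := bound_nat (2 / e).
pose i := maxn lo (maxn N (maxn N1 N2)).
have [hi0 thi] := supp_in_bound (t i); pose hi := maxn hi0 i.+1.
pose z := crop (seg lo hi) (t i).
have zt : `|J (t i) - J z| <= e / 2.
  rewrite -linearB /=; apply: le_trans (norm_le_sum hpar hsigma hX (B := lo) _) _.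
    move=> k lok; rewrite c00B cropE in_seg lok /=; case: ltnP => kh; first by rewrite subrr.
    by rewrite (supp_in_out thi) ?subrr //; rewrite /hi in kh; nlia.
  apply: le_trans (hN1 i _); last by rewrite /i; nlia.
  apply: ler_sum => k _; rewrite c00B cropE in_seg.
  have -> : (lo <= k)%N = false by apply/negbTE; rewrite -ltnNge.
  by rewrite subr0.
have Tz : `|T (J (ebase R i)) - J z| <= e.
  rewrite -[X in `|X|](subrKA (J (t i))); apply: le_trans (ler_normD _ _) _.
  have : `|T (J (ebase R i)) - J (t i)| <= e / 2.
    apply: le_trans (tT i) _.
    have : 2 / e <= i.+1%:R by apply: hN2; rewrite /i; nlia.
    rewrite ler_pdivrMr // => h4.
    rewrite ler_pdivlMr // -ler_pdivlMl ?invr_gt0 ?ltr0n // invrK; exact: h4.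
  lra.
have i1 : (1 <= i)%N by rewrite /i; nlia.
have lohi : (lo <= i < hi)%N by rewrite /hi /i; nlia.
pose zl := crop (seg lo i) z; pose zr := crop (seg i.+1 hi) z.
have zE : z = zl + z i *: ebase R i + zr.
  apply: c00_eqP => k; rewrite !c00D c00Z ebaseE // /zl /zr !cropE !in_seg.
  have [->|ki] := eqVneq k i; first by rewrite ltnn andbF /= mulr1 add0r addr0.
  rewrite mulr0 addr0; case: (boolP (lo <= k < hi)%N) => h1.
    have [kl|kl] := ltnP k i.
      have -> : (lo <= k)%N by nlia. have -> : (i < k)%N = false by nlia. by rewrite addr0.
    have -> : (lo <= k)%N by nlia. have -> : (i < k)%N by nlia.
    by rewrite /= add0r; have -> : (k < hi)%N by nlia.
  have -> : (lo <= k < i)%N = false by nlia. have -> : (i < k < hi)%N = false by nlia.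
  by rewrite addr0.
have zd : 3 / 4 * d <= `|J zl| + `|J zr|.
  have h1 : d <= `|T (J (ebase R i)) - z i *: J (ebase R i)| by apply: far; rewrite /i; nlia.
  have h2 : T (J (ebase R i)) - z i *: J (ebase R i) = (T (J (ebase R i)) - J z) + (J zl + J zr).
    have Jz : J z = J zl + z i *: J (ebase R i) + J zr by rewrite {1}zE !linearD linearZ.
    have G (u v w y : X) : u - w = (u - (v + w + y)) + (v + y).
      by rewrite [v + w + y]addrAC; move: (v + y) => e'; rewrite opprD addrA addrAC subrK.
    by rewrite Jz -G.
  rewrite h2 in h1; have := ler_normD (T (J (ebase R i)) - J z) (J zl + J zr).
  have := ler_normD (J zl) (J zr); lra.
have fin lo' hi' (y : c00 R) : supp_in lo' hi' y -> (forall k, ~~ (lo' <= k < hi')%N -> True) ->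
   (lo <= lo')%N -> (hi' <= hi)%N -> ~~ (lo' <= i < hi')%N -> y = crop (seg lo' hi') z ->
   d / 4 < `|J y| ->
   exists ih : (nat * c00 R * (nat -> R)), exists hi,
  (lo <= hi)%N /\ let: (i, z, h) := ih in
  [/\ (lo <= i < hi)%N, supp_in lo hi z, K h /\ supp_in lo hi h, h i = 0 &
      d / 4 <= ev h z /\ `|T (J (ebase R i)) - J z| <= e].
  move=> sy _ l1 l2 nin yE dy.
  have [|h [Kh sh hy]] := norming_functional hX sy _ dy; first by rewrite divr_ge0 // ltW.
  exists (i, z, h), hi; split; first by nlia.
  split=> //.
  - exact: crop_seg_supp.
  - by split=> //; apply: supp_inW sh _ _.
  - by rewrite (supp_in_out sh).
  - split=> //; apply: le_trans (ltW hy) _; rewrite yE ev_crop.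
    have -> : restrict_to (seg lo' hi') h = h; last exact: lexx.
    apply/funext => k; rewrite /restrict_to in_seg; case: ifPn => // hk.
    by rewrite (supp_in_out sh).
have [h|h] := ltP (d / 4) `|J zl|.
  by apply: (fin lo i zl) => //; [exact: crop_seg_supp|nlia|rewrite ltnn andbF].
apply: (fin i.+1 hi zr) => //; [exact: crop_seg_supp|nlia|by rewrite ltnn|lra].
Qed.

Lemma ev_block_diag (h : nat -> nat -> R) (z : nat -> c00 R) (c : nat -> nat) N :
  (forall l, (c l <= c l.+1)%N) -> (forall l, supp_in (c l) (c l.+1) (h l)) ->
  (forall l, supp_in (c l) (c l.+1) (z l)) ->
  ev (\sum_(0 <= l < N) h l) (\sum_(0 <= l < N) z l) = \sum_(0 <= l < N) ev (h l) (z l).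
Proof.
move=> cm sh sz; have cmono := cut_mono cm.
rewrite !big_mkord ev_suml; apply: eq_bigr => i _; rewrite ev_sum (bigD1 i) //=.
rewrite big1 ?addr0 // => j ji; apply: ev_supp_in (sh i) (sz j) _.
by move: ji; rewrite -val_eqE /= neq_ltn => /orP[] /cmono ->; rewrite ?orbT.
Qed.

Lemma lower_value q k p1 phi c C (a : R) (lam : nat -> R) (y : nat -> c00 R) :
  exact_special m n sigma q k p1 phi c C a ->
  (forall i, (i < k)%N -> supp_in (c (2 * i).+1) (c (2 * i).+3) (y i)) ->
  ev ((m q)%:R^-1 *: \sum_(i < k) (lam i.+1 *: fs phi (2 * i.+1).-1 + fs phi (2 * i.+1)))
    (\sum_(i < k) y i) =
  (m q)%:R^-1 * \sum_(i < k) (lam i.+1 * ev (fs phi (2 * i).+1) (y i) + ev (fs phi (2 * i).+2) (y i)).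
Proof.
move=> es sy; rewrite evZl; congr (_ * _).
have e1 i : (2 * i.+1).-1 = (2 * i).+1 by nlia.
have e2 i : (2 * i.+1)%N = (2 * i).+2 by nlia.
have cm := es_mono es.
rewrite (eq_bigr (fun i : 'I_k => lam i.+1 *: fs phi (2 * i).+1 + fs phi (2 * i).+2)); last first.
  by move=> i _; rewrite e1 e2.
have -> := @ev_odd_sum R k (fun i => lam i.+1 *: fs phi (2 * i).+1) (fun i => fs phi (2 * i).+2) y
  (fun l => c l.+1) (fun l => cm l.+1).
  by apply: eq_bigr => i _; rewrite evZl.
move=> i ik; have h1 : (1 <= (2 * i).+1 <= 2 * k)%N by nlia.
have h2 : (1 <= (2 * i).+2 <= 2 * k)%N by nlia.
split; last exact: sy.
- by apply: supp_inZ; apply: supp_inW (es_fs es h1) _ _.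
- by apply: supp_inW (es_fs es h2) _ _.
Qed.

Lemma special_sum_norm q k p1 phi c (a : R) : exact_special m n sigma q k p1 phi c 6 a ->
  `|J (\sum_(0 <= i < k) pair_vec m sigma p1 phi a k i)| <= 960 * (k%:R / (m q)%:R ^+ 2).
Proof.
move=> es; have := norm_le hX (special_sum_nbd hpar hsigma es).
by have -> : 160 * 6 = 960 :> R by ring.
Qed.

(** The vector is an average of the e_i from [far_items], and the functional is
    an average of the functionals found there. *)
Lemma far_even_pair (t : nat -> c00 R) (d : R) N p lo (e0 : R) :
  (forall i, `|T (J (ebase R i)) - J (t i)| <= i.+1%:R^-1) ->
  0 < d -> (forall i a, (N <= i)%N -> d <= `|T (J (ebase R i)) - a *: J (ebase R i)|) ->
  0 < e0 -> (2 <= p)%N -> ~~ odd p -> (1 <= lo)%N ->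
  exists x f hi, [/\ good_pair false p lo x f hi, forall k, f k = 0 \/ x k = 0 &
    exists z : c00 R, [/\ supp_in lo hi z, d / 24 <= ev f z & `|T (J ((m p)%:R *: mkc x)) - J z| <= e0]].
Proof.
move=> tT d0 far e00 p2 op lo1.
have mp0 : 0 < (m p)%:R :> R by rewrite ltr0n (m_gt0 hpar) //; nlia.
have np0 : 0 < (n p)%:R :> R by rewrite ltr0n (n_gt0 hpar) //; nlia.
pose e := Num.min (d / 4) (e0 / (m p)%:R).
have e_gt0 : 0 < e by rewrite lt_min !divr_gt0.
have ed : e <= d / 4 by rewrite ge_min lexx.
have em : (m p)%:R * e <= e0.
  by rewrite -ler_pdivlMl // mulrC ge_min lexx orbT.
have [c [a [c0 cm ca]]] := block_choice (far_items tT d0 far e_gt0 ed) lo1.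
pose ix l := (a l).1.1; pose z l := (a l).1.2; pose h l := (a l).2.
have H l : [/\ (c l <= ix l < c l.+1)%N, supp_in (c l) (c l.+1) (z l),
    K (h l) /\ supp_in (c l) (c l.+1) (h l), h l (ix l) = 0 &
    d / 4 <= ev (h l) (z l) /\ `|T (J (ebase R (ix l))) - J (z l)| <= e].
  by have := ca l; rewrite /ix /z /h; case: (a l) => [[]].
have ci l : (c l <= ix l < c l.+1)%N by case: (H l).
have cmono := cut_mono cm.
have c01 : (1 <= c 0%N)%N by rewrite c0.
have ix1 l : (1 <= ix l)%N by have := ci l; have := cmono 0%N l isT; nlia.
have sz l : supp_in (c l) (c l.+1) (z l) by case: (H l).
have sh l : supp_in (c l) (c l.+1) (h l) by case: (H l) => _ _ [].
have se l : supp_in (c l) (c l.+1) (ebase R (ix l)).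
  by move=> k; rewrite ebaseE //; have [->|] := eqVneq k (ix l); rewrite ?ci ?eqxx.
pose S := \sum_(0 <= l < n p) ebase R (ix l).
pose al : R := 6^-1.
have bE : (m p)%:R *: mkc (basis_avg R n p ix) = ((m p)%:R / (n p)%:R) *: S.
  by rewrite (mkc_basis_avg R n p2 c01 ci) scalerA.
have ev1 : exact_vec 1 p ((al * ((m p)%:R / (n p)%:R)) *: S).
  rewrite -scalerA -bE; have := exact_vecZ al (basis_avg_exact hpar hsigma p2 c01 ci).
  by rewrite ger0_norm ?invr_ge0 // mulVf // pnatr_eq0.
have v0 : (al * ((m p)%:R / (n p)%:R)) *: S != 0.
  rewrite -scalerA -bE; apply/eqP => v0.
  have bp := basis_avg_pair R m n p2 c01 ci.
  have fb : finitely_supported (basis_avg R n p ix).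
    exact: (supp_in_finsupp c01 (@basis_sum_supp_in R n p ix c p2 c01 ci _)).
  have := basic_pair_ev hpar p2 bp fb.
  have : ev ((m p)%:R^-1 *: \sum_(0 <= l < n p) basis_vec R (ix l)) (al *: ((m p)%:R *: mkc (basis_avg R n p ix))) = 0.
    by rewrite v0 (linear0 (ev _)).
  move=> e2 e1; move: e2; rewrite evZ e1 mulr1 => /eqP.
  by rewrite invr_eq0 pnatr_eq0.
pose F := (m p)%:R^-1 *: \sum_(0 <= l < n p) h l.
pose z0 := (al * ((m p)%:R / (n p)%:R)) *: \sum_(0 <= l < n p) z l.
have Fz : d / 24 <= ev F z0.
  rewrite /F /z0 evZ evZl (ev_block_diag _ cm sh sz).
  have -> : forall s0 : R, al * ((m p)%:R / (n p)%:R) * ((m p)%:R^-1 * s0) = al * ((n p)%:R^-1 * s0).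
    by move=> s0; field; rewrite !gt_eqF.
  have -> : d / 24 = al * ((n p)%:R^-1 * ((n p)%:R * (d / 4))).
    by rewrite mulKf ?gt_eqF // /al; field.
  rewrite ler_wpM2l ?invr_ge0 // ler_wpM2l ?invr_ge0 //.
  apply: (@le_trans _ _ (\sum_(0 <= l < n p) (d / 4))); first by rewrite sumr_const_nat subn0 mulr_natl.
  by apply: ler_sum => l _; case: (H l) => _ _ _ _ [].
have F0 : F <> 0.
  by move=> F0; move: Fz; rewrite F0 ev0l leNgt divr_gt0.
have Kh l : K (h l) /\ supp_in (c l) (c l.+1) (h l) by case: (H l).
have re l : rat_valued (ebase R (ix l)) by move=> k; rewrite ebaseE //; exact: is_rat_nat.
have [vE gp] := good_pair_avg hpar hsigma p2 op c01 cm se re Kh (is_ratV (is_rat_nat R 6)) ev1 v0 F0.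
rewrite c0 in gp; eexists; exists F, (c (n p)); split; first exact: gp.
- move=> k; have [Fk|Fk] := eqVneq (F k) 0; first by left.
  right; apply/eqP; apply: contraT => xk.
  have [l hl] : exists l, h l k != 0.
    apply: contrapT => nh; case/eqP: Fk.
    rewrite /F fscale fsum big1 ?mulr0 // => l _; apply/eqP; apply: contraT => hl; by case: nh; exists l.
  have [l' hl'] : exists l', k = ix l'.
    apply: contrapT => nh; case/eqP: xk.
    rewrite fscale fsum big1 ?mulr0 // => l' _; rewrite ebaseE //; case: eqP => // e'.
    by case: nh; exists l'.
  have [ll|ll] := eqVneq l l'.
    by move: hl; rewrite hl' ll; case: (H l') => _ _ _ -> _; rewrite eqxx.
  move: (sh l k hl) (ci l'); rewrite -hl' => k1 k2.
  by rewrite (cell_uniq cm k1 k2) eqxx in ll.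
- exists z0; split=> //.
    rewrite -c0; apply: supp_inZ; rewrite big_nat_cond; apply: supp_in_csum => l /andP[hl _].
    by apply: supp_inW (sz l) _ _; apply: cmono.
  rewrite vE; apply: le_trans (op_sum (eta := e) _ _ _) _; first by move=> l; case: (H l) => _ _ _ _ [].
  rewrite ger0_norm ?mulr_ge0 ?invr_ge0 ?divr_ge0 ?(ltW mp0) ?(ltW np0) //.
  have -> : al * ((m p)%:R / (n p)%:R) * ((n p)%:R * e) = al * ((m p)%:R * e).
    by field; rewrite gt_eqF.
  apply: le_trans em; rewrite ler_piMl ?mulr_ge0 ?(ltW mp0) ?(ltW e_gt0) //.
  by rewrite /al invf_le1 // ler1n.
Qed.

(** If T e_i stays away from the line of e_i, then [far_even_pair] gives the
    even terms of a special sequence in which the supports of x_{2i} and f_{2i}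
    are disjoint, so that [special_sum_norm] applies with a = 0. The odd
    functional of the sequence is at least k d / (24 m_q) on the image of the
    sum, up to the approximation errors. *)
Theorem approx_eigen (d : R) N : 0 < d -> exists i a,
  (N <= i)%N /\ `|T (J (ebase R i)) - a *: J (ebase R i)| < d.
Proof.
move=> d0; apply: contrapT => nex.
have far i a : (N <= i)%N -> d <= `|T (J (ebase R i)) - a *: J (ebase R i)|.
  by move=> Ni; rewrite leNgt; apply/negP => h; apply: nex; exists i, a.
have ht i : exists x : c00 R, `|T (J (ebase R i)) - J x| <= i.+1%:R^-1.
  have [|x hx] := dense_eps hX (T (J (ebase R i))) (e := i.+1%:R^-1).
    by rewrite invr_gt0.
  by exists x; apply: ltW.
have [t tT] := choice ht.
(* With this q, k d / (24 m_q) exceeds the sum of the upper estimate, of order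
   k / m_q^2, and of the k approximation errors e0. *)
have [q [k [q3 oq nq k0 hM]]] := large_odd_weight (4 * 960 * B / (d / 24)).
have M0 : 0 < (m q)%:R :> R by rewrite ltr0n (m_gt0 hpar) //; nlia.
pose M : R := (m q)%:R; rewrite -/M in M0 hM.
pose e0 := d / 24 / (4 * M).
have e00 : 0 < e0 by rewrite !divr_gt0 // mulr_gt0.
pose E (b : bool) p lo (x f : nat -> R) hi :=
  (b = false -> (forall k, f k = 0 \/ x k = 0) /\ exists z : c00 R, [/\ supp_in lo hi z, d / 24 <= ev f z &
     `|T (J ((m p)%:R *: mkc x)) - J z| <= e0]).
have Eex b p lo : (2 <= p)%N -> ~~ odd p -> (1 <= lo)%N ->
    exists x f hi, good_pair b p lo x f hi /\ E b p lo x f hi.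
  move=> p2 op lo1; case: b.
    have [|x [f [hi [idx [gp _ _ _]]]]] := @odd_pair_exists (fun=> True) p lo _ p2 op lo1.
      by move=> N'; exists N'.
    by exists x, f, hi.
  have [x [f [hi [gp dis hz]]]] := far_even_pair tT d0 far e00 p2 op lo1.
  by exists x, f, hi.
have [p1 [phi [c [lam [hL hes _ Kf]]]]] := special_exists_good Eex q3 oq nq.
have hL2 i (p := weight_at sigma p1 phi (2 * i).+2) : (i < k)%N ->
    good_pair false p (c (2 * i).+2) (xs phi (2 * i).+2) (fs phi (2 * i).+2) (c (2 * i).+3) /\
    E false p (c (2 * i).+2) (xs phi (2 * i).+2) (fs phi (2 * i).+2) (c (2 * i).+3).
  move=> ik; have h2 : (1 <= (2 * i).+2 <= 2 * k)%N by nlia.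
  by have := hL _ h2; have -> : odd (2 * i).+2 = false by nlia.
have es : exact_special m n sigma q k p1 phi c 6 0.
  apply: hes; right; split=> // i g hi _ sg.
  have [j ij] : exists j, i = j.+1 by exists i.-1; nlia.
  have e2 : (2 * i)%N = (2 * j).+2 by nlia.
  have jk : (j < k)%N by nlia.
  have [[[_ _ _ [fx _ _ _] _] _ _] /(_ erefl)[dis _]] := hL2 j jk.
  rewrite e2 pairing_mkc //; apply: ev_eq0 => l; rewrite mkcE //.
  have [fl|xl] := dis l; last by rewrite xl mulr0.
  have [->|gl] := eqVneq (g l) 0; first by rewrite mul0r.
  have : supp g l by []; rewrite sg e2 /supp /= fl eqxx //.
have hz' i : exists z : c00 R, (i < k)%N ->
    [/\ supp_in (c (2 * i).+2) (c (2 * i).+3) z, d / 24 <= ev (fs phi (2 * i).+2) z &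
     `|T (J (spec_vec m sigma p1 phi (2 * i).+2)) - J z| <= e0].
  case: (ltnP i k) => ik; last by exists 0.
  by have [_ /(_ erefl)[_ [z hz]]] := hL2 i ik; exists z.
have [z hz] := choice hz'.
have cm := es_mono es.
have sz i : (i < k)%N -> supp_in (c (2 * i).+1) (c (2 * i).+3) (z i).
  by move=> ik; have [h _ _] := hz i ik; apply: supp_inW h _ _.
have low : k%:R * (d / 24) / M <= `|J (\sum_(i < k) z i)|.
  apply: le_trans (ev_le_norm hpar hsigma hX _ Kf).
  apply: le_trans (ler_norm _); rewrite (lower_value lam es sz) mulrC ler_wpM2l ?invr_ge0 ?(ltW M0) //.
  apply: (@le_trans _ _ (\sum_(i < k) (d / 24))); first by rewrite sumr_const card_ord mulr_natl.
  apply: ler_sum => i _; have [h1 h2 _] := hz i (ltn_ord i).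
  have hl : (1 <= (2 * i).+1 <= 2 * k)%N by have := ltn_ord i; nlia.
  by rewrite (ev_supp_in (es_fs es hl) h1) ?leqnn // mulr0 add0r.
have up1 : `|J (\sum_(i < k) z i)| <= `|T (J (\sum_(0 <= i < k) pair_vec m sigma p1 phi 0 k i))| + k%:R * e0.

  have -> : J (\sum_(i < k) z i) = - T (J (\sum_(0 <= i < k) pair_vec m sigma p1 phi 0 k i)) -
     \sum_(i < k) (T (J (spec_vec m sigma p1 phi (2 * i).+2)) - J (z i)).
    have -> : \sum_(0 <= i < k) pair_vec m sigma p1 phi 0 k i =
        - \sum_(i < k) spec_vec m sigma p1 phi (2 * i).+2.
      rewrite big_mkord -sumrN; apply: eq_bigr => i _.
      by rewrite /pair_vec ltn_ord scale0r add0r.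
    rewrite sumrB.
    have -> : T (J (- \sum_(i < k) spec_vec m sigma p1 phi (2 * i).+2)) =
       - \sum_(i < k) T (J (spec_vec m sigma p1 phi (2 * i).+2)).
      by rewrite !linearN !linear_sum.
    by rewrite opprK linear_sum opprB addrCA subrr addr0.
  apply: le_trans (ler_normB _ _) _; rewrite normrN lerD2l.
  apply: le_trans (ler_norm_sum _ _ _) _.
  apply: (@le_trans _ _ (\sum_(i < k) e0)); last by rewrite sumr_const card_ord mulr_natl.
  by apply: ler_sum => i _; have [] := hz i (ltn_ord i).
have up2 : `|T (J (\sum_(0 <= i < k) pair_vec m sigma p1 phi 0 k i))| <= B * (960 * (k%:R / M ^+ 2)).
  by apply: le_trans (TB _) _; rewrite ler_wpM2l // (special_sum_norm es).
have kp : 0 < k%:R :> R by rewrite ltr0n.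
have : k%:R * (d / 24) / M <= B * (960 * (k%:R / M ^+ 2)) + k%:R * e0 by lra.
have -> : k%:R * (d / 24) / M = k%:R / M * (d / 24) by ring.
have -> : B * (960 * (k%:R / M ^+ 2)) + k%:R * e0 = k%:R / M * (960 * B / M + d / 24 / 4).
  by rewrite /e0; field; rewrite gt_eqF.
rewrite ler_pM2l ?divr_gt0 //.
have : 960 * B / M <= d / 24 / 4.
  move: hM; rewrite ler_pdivrMr ?divr_gt0 // => hM; rewrite ler_pdivrMr //; lra.
lra.
Qed.

End Operator.
End Eigen.

(** * Operators that nearly fix infinitely many basis vectors *)
Section Singular.
Variables (R : realType) (m n s : nat -> nat) (sigma : pseq R -> nat).
Hypothesis hpar : ius_parameters m n s.
Hypothesis hsigma : coding_function m sigma.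
Local Notation K := (norming_set m n sigma).
Local Notation Kw := (wclass m n sigma).
Local Notation nbd := (nbd m n sigma).
Local Notation exact_vec := (exact_vec m n sigma).
Local Notation good_pair := (good_pair m n sigma).
Local Notation succ_sum := (succ_sum m n sigma).
Variables (X : completeNormedModType R) (J : {linear c00 R -> X}).
Hypothesis hX : is_completion (ius_norm m n sigma) J.
Implicit Types (f g h : nat -> R).

Lemma rat_approx lo hi (x : c00 R) (e : R) : (1 <= lo)%N -> supp_in lo hi x -> 0 < e ->
  exists b : c00 R, [/\ supp_in lo hi b, rat_valued b & forall k, `|b k - x k| <= e].
Proof.
move=> lo1 sx e0.
have hq k : exists q : rat, `|ratr q - x k| <= e.
  have [|q] := @rat_in_itvoo R (x k - e) (x k + e); first lra.
  rewrite in_itv /= => /andP[q1 q2]; exists q; rewrite ler_norml; apply/andP; split; lra.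
have [qq hqq] := choice hq.
pose b0 k : R := if (lo <= k < hi)%N then ratr (qq k) else 0.
have sb : supp_in lo hi b0 by move=> k; rewrite /b0; case: ifP => //; rewrite eqxx.
have bE : mkc b0 = b0 :> (nat -> R) by rewrite mkcE //; exact: (supp_in_finsupp lo1 sb).
exists (mkc b0); rewrite bE; split=> //.
  by move=> k; rewrite /b0; case: ifP => _; [exists (qq k)|exact: is_rat0].
move=> k; rewrite /b0; case: ifPn => // hk.
by rewrite (supp_in_out sx hk) subrr normr0 ltW.
Qed.

Lemma sum_nat_le_const (a : nat -> R) (r : R) N : (forall l, a l <= r) ->
  \sum_(0 <= l < N) a l <= N%:R * r.
Proof.
move=> h; apply: (@le_trans _ _ (\sum_(0 <= l < N) r)); first by apply: ler_sum.
by rewrite sumr_const_nat subn0 mulr_natl.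
Qed.

Lemma odd_near_pair (A : {linear X -> X}) (e : R) p lo :
  (forall (e : R) N, 0 < e -> exists i, (N <= i)%N /\ `|A (J (ebase R i)) - J (ebase R i)| < e) ->
  0 < e -> (2 <= p)%N -> ~~ odd p -> (1 <= lo)%N ->
  exists x f hi, [/\ good_pair true p lo x f hi, ev f ((m p)%:R *: mkc x) = 1 &
    `|A (J ((m p)%:R *: mkc x)) - J ((m p)%:R *: mkc x)| <= e].
Proof.
move=> near e0 p2 op lo1.
have mp0 : 0 < (m p)%:R :> R by rewrite ltr0n (m_gt0 hpar) //; nlia.
have np0 : 0 < (n p)%:R :> R by rewrite ltr0n (n_gt0 hpar) //; nlia.
have e10 : 0 < e / (m p)%:R by rewrite divr_gt0.
have [x [f [hi [idx [gp Pi _ xE]]]]] := odd_pair_exists hpar hsigma (fun N => near _ N e10) p2 op lo1.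
have [[_ _ _ [fx _ _ _] _] /(_ erefl)[bp _] _] := gp.
exists x, f, hi; split=> //; first exact: (basic_pair_ev hpar p2 bp fx).
have {}Pi l := ltW (Pi l).
rewrite xE scalerA; have := op_sum (a := fun l => ebase R (idx l)) (b := fun l => ebase R (idx l))
   ((m p)%:R / (n p)%:R) (n p) Pi.
move=> h1; apply: le_trans h1 _.
rewrite ger0_norm ?divr_ge0 ?(ltW mp0) ?(ltW np0) //.
have -> : (m p)%:R / (n p)%:R * ((n p)%:R * (e / (m p)%:R)) = e.
  by field; rewrite !gt_eqF.
exact: lexx.
Qed.

Section Operator.
Variables (A : {linear X -> X}) (B : R).
Hypothesis B0 : 0 <= B.
Hypothesis AB : forall x, `|A x| <= B * `|x|.
Hypothesis sing : forall (e : R) N, 0 < e -> exists x : c00 R,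
  (forall k, (k < N)%N -> x k = 0) /\ `|A (J x)| < e * `|J x|.

(** Normalisation and rational approximation of a vector on which A is small;
    the bound on A absorbs the error of the approximation. *)
Lemma small_block (e : R) lo : 0 < e -> (1 <= lo)%N ->
  exists (bh : c00 R * (nat -> R)) hi, (lo <= hi)%N /\
  [/\ supp_in lo hi bh.1, rat_valued bh.1 /\ `|J bh.1| <= 1, `|A (J bh.1)| <= e,
     K bh.2 /\ supp_in lo hi bh.2 & 1 / 2 <= ev bh.2 bh.1].
Proof.
move=> e0 lo1; have e20 : 0 < e / 2 by rewrite divr_gt0.
have [x [x0 hx]] := sing lo e20.
have Jx0 : 0 < `|J x|.
  rewrite normr_gt0; apply/eqP => Jx; move: hx; rewrite Jx normr0 mulr0 ltNge normr_ge0 //.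
have [hi0 hhi0] := supp_in_bound x.
pose hi := maxn lo hi0.
have sx : supp_in lo hi x.
  move=> k xk; apply/andP; split; last by have /andP[_ h] := hhi0 k xk; rewrite /hi; nlia.
  by rewrite leqNgt; apply: contra xk => kl; rewrite x0.
pose r := 3 / 4 / `|J x|; pose x' := r *: x.
have r0 : 0 < r by rewrite !divr_gt0.
have Jx' : `|J x'| = 3 / 4.
  by rewrite linearZ normrZ gtr0_norm // divfK // gt_eqF.
have AJx' : `|A (J x')| <= e / 2.
  have -> : A (J x') = r *: A (J x) by rewrite !linearZ.
  rewrite normrZ gtr0_norm //; apply: (@le_trans _ _ (r * (e / 2 * `|J x|))).
    by rewrite ler_wpM2l ?(ltW hx) ?(ltW r0).
  rewrite mulrCA divfK ?gt_eqF //; lra.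
have sx' : supp_in lo hi x' by apply: supp_inZ.
pose dl := Num.min (1 / 8) (e / (2 * (B + 1))).
have dl0 : 0 < dl by have B0' := B0; rewrite lt_min !divr_gt0 // mulr_gt0 //; lra.
have [b [sb rb bx]] := rat_approx lo1 sx' (divr_gt0 dl0 (ltr0Sn R hi)).
have Jb : `|J b - J x'| <= dl.
  rewrite -linearB; apply: le_trans (norm_le_sum hpar hsigma hX (B := hi) _) _.
    move=> k hk; rewrite c00B (supp_in_out sb) ?(supp_in_out sx') ?subrr //; nlia.
  apply: (@le_trans _ _ (\sum_(k < hi) (dl / hi.+1%:R))).
    by apply: ler_sum => k _; rewrite c00B.
  rewrite sumr_const card_ord -[X in X <= _]mulr_natl mulrCA ler_piMr ?(ltW dl0) //.
  by rewrite ler_pdivrMr // mul1r ler_nat.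
have dl8 : dl <= 1 / 8 by rewrite ge_min lexx.
have dlB : B * dl <= e / 2.
  have B0' := B0; apply: (@le_trans _ _ (B * (e / (2 * (B + 1))))).
    by rewrite ler_wpM2l // ge_min lexx orbT.
  rewrite mulrA ler_pdivrMr ?mulr_gt0 //; last lra.
  have -> : e / 2 * (2 * (B + 1)) = B * e + e by field.
  lra.
have h1 := ler_dist_dist (J b) (J x').
have {h1} : `| `|J b| - `|J x'| | <= 1 / 8 by apply: le_trans h1 (le_trans Jb dl8).
rewrite Jx' ler_norml => /andP[h1 h2].
have [||h [Kh sh hb]] := norming_functional hX (lo := lo) (hi := hi) (x := b) (d := 1 / 2) sb; [lra|lra|].
exists (b, h), hi; split; first exact: leq_maxl.
split=> //=; last exact: ltW.
  by split=> //; lra.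
rewrite -[A (J b)](subrK (A (J x'))) -linearB; apply: le_trans (ler_normD _ _) _.
have := AB (J b - J x'); have : B * `|J b - J x'| <= B * dl by rewrite ler_wpM2l.
lra.
Qed.

Lemma succ_sum_supp d lo hi H : succ_sum d lo hi H -> supp_in lo hi H.
Proof.
move=> [l [_ kl _ ->]]; elim: l kl => [|g l IH] kl; first by rewrite big_nil; exact: supp_in0.
rewrite big_cons; apply: supp_inD; first by case: (kl g (or_introl erefl)).
by apply: IH => g' g'l; apply: kl; right.
Qed.

(** Let N = 4 n_{q-1}. If the sum of N successive vectors of norm at most 1 had
    always norm at most N / 2, then its double average would again be such a
    vector. Repeating this s_{q-1} times gives a vector of the unit ball at
    which the sum H of N^s = n_q successive functionals is at least 2^s / 2,
    although H / m_q belongs to the norming set and 2^s >= m_q^3. Hence some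
    sum of N vectors has norm above N / 2; functionals of weight below q split
    it into few pieces and are small at its average. *)
Lemma l1_average (e : R) q lo : 0 < e -> (2 <= q)%N -> ~~ odd q -> (1 <= lo)%N ->
  exists (y : c00 R) hi, [/\ (lo <= hi)%N, supp_in lo hi y /\ rat_valued y,
    1 < `|J y| /\ `|J y| <= 2, `|A (J y)| <= e &
    forall w f, (2 <= w < q)%N -> Kw w f -> `|ev f y| <= 8 / (m w)%:R].
Proof.
move=> e0 q2 oq lo1; apply: contrapT => nex.
pose N := (4 * n q.-1)%N; pose S := s q.-1.
have q1 : (1 <= q.-1)%N by nlia.
have nq : n q = (N ^ S)%N by rewrite -(n_succ hpar q1); congr n; nlia.
have mS : (m q ^ 3 <= 2 ^ S)%N by have := s_large hpar q1; rewrite (prednK (ltnW q2)).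
have N0 : 0 < N%:R :> R by rewrite ltr0n muln_gt0 (n_gt0 hpar).
have N00 : N%:R != 0 :> R by rewrite gt_eqF.
pose e1 := e / (2 * 2 ^+ S).
have e10 : 0 < e1 by rewrite divr_gt0 // mulr_gt0 // exprn_gt0.
pose lev t lo' (gH : c00 R * (nat -> R)) hi :=
  [/\ supp_in lo' hi gH.1, rat_valued gH.1 /\ `|J gH.1| <= 1, `|A (J gH.1)| <= 2 ^+ t * e1,
     succ_sum (N ^ t) lo' hi gH.2 & 2 ^+ t / 2 <= ev gH.2 gH.1].
have lev_bad t c (a : nat -> c00 R * (nat -> R)) : (t <= S)%N -> (lo <= c 0%N)%N ->
   (forall l, (c l <= c l.+1)%N) -> (forall l, lev t (c l) (a l) (c l.+1)) ->
   `|J (\sum_(0 <= l < N) (a l).1)| <= N%:R / 2.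
  move=> tS c0 cm ha; rewrite leNgt; apply/negP => big; apply: nex.
  have bl : blocks c (fun l => (a l).1) by move=> l; split=> //; case: (ha l).
  set S1 := \sum_(0 <= l < N) (a l).1 in big *.
  have nS a' b' : (a' <= b')%N -> nbd (\sum_(a' <= l < b') (a l).1) (b' - a')%:R.
    move=> ab; have := @nbd_sum _ m n sigma nat (index_iota a' b') xpredT (fun l => (a l).1) (fun=> 1).
    rewrite sumr_const_nat; apply=> l _.
    by apply: nbdW (nbd_norm hpar hsigma hX (a l).1); case: (ha l) => _ [].
  exists ((2 / N%:R) *: S1), (c N).
  have JZ : `|J ((2 / N%:R) *: S1)| = 2 / N%:R * `|J S1|.
    by rewrite linearZ normrZ ger0_norm // divr_ge0.
  split.
  - by apply: leq_trans c0 _; exact: (blocks_mono bl).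
  - split.
      apply: supp_inZ; rewrite /S1 big_nat_cond; apply: supp_in_csum => l /andP[/andP[_ lN] _].
      case: (ha l) => sl _ _ _ _; apply: supp_inW sl _ _; last exact: (blocks_mono bl).
      by apply: leq_trans c0 _; exact: (blocks_mono bl).
    move=> k; rewrite c00Z c00sum; apply: is_ratM.
      by apply: is_ratM; [exact: (is_rat_nat R 2)|apply/is_ratV/is_rat_nat].
    by apply: is_rat_sum => l _; case: (ha l) => _ [].
  - rewrite JZ; split.
      move: big; rewrite ltr_pdivrMr // => big.
      by rewrite mulrAC ltr_pdivlMr // mul1r mulrC.
    have := norm_le hX (nS 0%N N isT); rewrite subn0 => h.
    by rewrite mulrAC ler_pdivrMr // ler_pM2l.
  - have -> : A (J ((2 / N%:R) *: S1)) = (2 / N%:R) *: \sum_(0 <= l < N) A (J (a l).1).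
      by rewrite !linearZ /= !linear_sum.
    rewrite normrZ ger0_norm ?divr_ge0 //.
    apply: (@le_trans _ _ (2 / N%:R * (N%:R * (2 ^+ S * e1)))).
      rewrite ler_wpM2l ?divr_ge0 //; apply: le_trans (ler_norm_sum _ _ _) _.
      apply: sum_nat_le_const => l; case: (ha l) => _ _ h _ _; apply: le_trans h _.
      by rewrite ler_wpM2r ?(ltW e10) // ler_weXn2l // ler1n.
    rewrite le_eqVlt; apply/orP; left; apply/eqP; rewrite /e1; field.
    by rewrite N00 expf_neq0.
  - move=> w f /andP[w2 wq] Kf; rewrite evZ normrM ger0_norm ?divr_ge0 //.
    have mw0 : 0 < (m w)%:R :> R by rewrite ltr0n (m_gt0 hpar) //; nlia.
    have nS' a' b' : (0 <= a' <= b')%N -> (b' <= N)%N ->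
        nbd (\sum_(a' <= l < b') (a l).1) (1 * (b' - a')%:R + 0).
      by move=> /andP[_ ab] _; rewrite mul1r addr0; exact: nS.
    have := split_bound hpar hsigma w2 Kf bl (leq0n N) ler01 (lexx 0) nS'.
    rewrite mul1r mul0r addr0 subn0 => h.
    have nN : (4 * n w <= N)%N.
      by rewrite leq_mul2l /= (n_mono hpar) //; nlia.
    have nN' : 4 * (n w)%:R <= N%:R :> R by rewrite -natrM ler_nat.
    apply: le_trans (ler_wpM2l _ h) _; first by rewrite divr_ge0.
    rewrite natrD; have -> : 2 / N%:R * (2 / (m w)%:R * (N%:R + (n w)%:R)) =
       (4 * (N%:R + (n w)%:R) / N%:R) / (m w)%:R :> R by field; rewrite N00 gt_eqF.
    rewrite ler_pM2r ?invr_gt0 // ler_pdivrMr //.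
    have : 0 <= (n w)%:R :> R by []. lra.
have levs t : (t <= S)%N -> forall lo', (lo <= lo')%N -> exists gH hi, (lo' <= hi)%N /\ lev t lo' gH hi.
  elim: t => [|t IH] tS lo' hlo.
    have [[b h] [hi [lh [/= sb [rb Jb] Ab [Kh sh] hb]]]] := small_block e10 (leq_trans lo1 hlo).
    exists (b, h), hi; split=> //; rewrite /lev expr0 mul1r expn0; split=> //.
    exact: succ_sum1.
  have {}IH := IH (ltnW tS).
  have lo'1 := leq_trans lo1 hlo.
  have [|c [a [c0 cm ha]]] := @block_choice _ (fun l a hi => (lo <= l)%N -> lev t l a hi) _ lo' lo'1.
    move=> l l1; have [ll|ll] := leqP lo l.
      by have [gH [hi [h1 h2]]] := IH l ll; exists gH, hi.
    by exists (0, 0), l; split=> // h; move: ll; rewrite ltnNge h.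
  have cmono := cut_mono cm.
  have loc l : (lo <= c l)%N by apply: leq_trans hlo _; rewrite -c0 cmono.
  have {}ha l : lev t (c l) (a l) (c l.+1) by apply: ha.
  have bad := lev_bad t c a (ltnW tS) (loc 0%N) cm ha.
  pose g := (2 / N%:R) *: \sum_(0 <= l < N) (a l).1.
  pose H := \sum_(0 <= l < N) (a l).2.
  exists (g, H), (c N); rewrite -c0; split; first exact: cmono.
  split=> /=.
  - apply: supp_inZ; rewrite big_nat_cond; apply: supp_in_csum => l /andP[/andP[_ lN] _].
    by case: (ha l) => sl _ _ _ _; apply: supp_inW sl _ _; exact: cmono.
  - split.
      change (rat_valued g); move=> k; have -> : g k = 2 / N%:R * \sum_(0 <= l < N) (a l).1 k.
        by rewrite /g c00Z c00sum.
      apply: is_ratM.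
        by apply: is_ratM; [exact: (is_rat_nat R 2)|apply/is_ratV/is_rat_nat].
      by apply: is_rat_sum => l _; case: (ha l) => _ [].
    rewrite linearZ normrZ ger0_norm ?divr_ge0 //.
    by rewrite mulrAC ler_pdivrMr // mul1r mulrC -ler_pdivlMr.
  - have -> : A (J g) = (2 / N%:R) *: \sum_(0 <= l < N) A (J (a l).1).
      by rewrite !linearZ /= !linear_sum.
    rewrite normrZ ger0_norm ?divr_ge0 //.
    apply: (@le_trans _ _ (2 / N%:R * (N%:R * (2 ^+ t * e1)))).
      rewrite ler_wpM2l ?divr_ge0 //; apply: le_trans (ler_norm_sum _ _ _) _.
      by apply: sum_nat_le_const => l; case: (ha l).
    rewrite le_eqVlt; apply/orP; left; apply/eqP; rewrite exprS; field.
    by rewrite N00.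
  - by rewrite expnS; apply: succ_sum_nat => // l _; case: (ha l).
  - rewrite evZ (@ev_block_diag R (fun l => (a l).2) (fun l => (a l).1) c N cm); first last.
    + by move=> l; case: (ha l).
    + by move=> l; case: (ha l) => _ _ _ /succ_sum_supp.
    apply: (@le_trans _ _ (2 / N%:R * (\sum_(0 <= l < N) (2 ^+ t / 2)))).
      rewrite sumr_const_nat subn0 -[X in 2 / _ * X]mulr_natl.
      by rewrite le_eqVlt; apply/orP; left; apply/eqP; rewrite exprS; field.
    by rewrite ler_wpM2l ?divr_ge0 //; apply: ler_sum => l _; case: (ha l).
have [[g H] [hi [_ [/= sg [rg Jg] _ sH Hg]]]] := levs S (leqnn _) lo (leqnn _).
rewrite -nq in sH.
have mq0 : 0 < (m q)%:R :> R by rewrite ltr0n (m_gt0 hpar) //; nlia.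
have S0 : 0 < (2 : R) ^+ S by rewrite exprn_gt0.
have [H0|KH] := succ_sum_K q2 oq (leqnn _) sH.
  by move: Hg; rewrite H0 ev0l leNgt divr_gt0.
have := le_trans (ev_le_norm hpar hsigma hX g (wclass_K KH)) Jg.
rewrite evZl normrM ger0_norm ?invr_ge0 ?(ltW mq0) // ler_pdivrMl // mulr1 => h1.
have h2 := le_trans (ler_norm _) h1.
have h3 : 2 ^+ S <= 2 * (m q)%:R :> R by lra.
move: h3; rewrite -natrX -natrM ler_nat => h3.
have h4 := leq_trans mS h3.
have m32 := m_ge32 hpar q2; move: (m q) h4 m32 => mq; clear.
by rewrite expnS [(2 * mq)%N]mulnC => h1 h2; rewrite leq_pmul2l in h1; nia.
Qed.

(** Nothing is claimed for the weights between lo + p and hi + p; for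
    successive items these ranges are disjoint. *)
Lemma small_item (e : R) p lo : 0 < e -> (2 <= p)%N -> (1 <= lo)%N ->
  exists (yh : c00 R * (nat -> R)) hi, (lo <= hi)%N /\
  [/\ supp_in lo hi yh.1, rat_valued yh.1 /\ `|J yh.1| <= 2,
     K yh.2 /\ supp_in lo hi yh.2, 1 <= ev yh.2 yh.1 /\ `|A (J yh.1)| <= e &
     forall w f, (2 <= w)%N -> Kw w f ->
       ((w <= lo + p)%N -> `|ev f yh.1| <= 8 / (m w)%:R) /\
       ((hi + p <= w)%N -> `|ev f yh.1| <= 8 / (m p)%:R ^+ 2)].
Proof.
move=> e0 p2 lo1.
have [||y [hi0 [lohi [sy ry] [Jy1 Jy2] Ay hw]]] := @l1_average e (2 * (lo + p)) lo e0 _ _ lo1.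
- nlia.
- by rewrite oddM.
have [h [Kh sh hy]] := norming_functional hX sy ler01 Jy1.
have [C C0 hC] := ev_bounded y.
have mp0 : 0 < (m p)%:R :> R by rewrite ltr0n (m_gt0 hpar) //; nlia.
have [N hN] := bound_nat ((m p)%:R ^+ 2 * C).
pose hi := maxn hi0 N; exists (y, h), hi; split=> /=; first by rewrite /hi; nlia.
have W f : supp_in lo hi0 f -> supp_in lo hi f by move=> sf; apply: supp_inW sf _ _; rewrite /hi; nlia.
split.
- exact: W.
- by [].
- by split=> //; exact: W.
- by split=> //; exact: ltW.
- move=> w f w2 Kf; split=> h1; first by apply: hw => //; nlia.
  apply: le_trans (hC f (m w)%:R^-1 _) _; first by move=> k; exact: (wclass_le hpar hsigma k w2 Kf).
  have mw0 : 0 < (m w)%:R :> R by rewrite ltr0n (m_gt0 hpar) //; nlia.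
  rewrite ler_pdivlMr ?exprn_gt0 // -mulrA ler_pdivrMl //.
  have w1 : (1 <= w)%N by nlia.
  have : (N <= m w)%N by have := m_gtid hpar w1; rewrite /hi in h1; nlia.
  move=> /hN; rewrite mulrC => h2; apply: le_trans h2 _.
  by rewrite ler_peMr ?(ltW mw0) // ler1n.
Qed.

(** The items are rapidly increasing with constant 8, so that their average is
    exact with constant 6 * 8 = 48, which is divided out. *)
Lemma even_small_pair (e : R) p lo : 0 < e -> (2 <= p)%N -> ~~ odd p -> (1 <= lo)%N ->
  exists x f hi, [/\ good_pair false p lo x f hi, 1 / 48 <= ev f ((m p)%:R *: mkc x) &
    `|A (J ((m p)%:R *: mkc x))| <= e].
Proof.
move=> e0 p2 op lo1.
have mp0 : 0 < (m p)%:R :> R by rewrite ltr0n (m_gt0 hpar) //; nlia.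
have np0 : 0 < (n p)%:R :> R by rewrite ltr0n (n_gt0 hpar) //; nlia.
have mp1 : 1 <= (m p)%:R :> R by rewrite ler1n -(ltr0n R).
have e10 : 0 < e / (m p)%:R by rewrite divr_gt0.
have [c [a [c0 cm ca]]] := block_choice (fun lo l1 => small_item e10 p2 l1) lo1.
pose y l := (a l).1; pose h l := (a l).2.
have c01 : (1 <= c 0%N)%N by rewrite c0.
have sy l : supp_in (c l) (c l.+1) (y l) by case: (ca l).
have ry l : rat_valued (y l) by case: (ca l) => _ [].
have Kh l : K (h l) /\ supp_in (c l) (c l.+1) (h l) by case: (ca l).
have sh l : supp_in (c l) (c l.+1) (h l) by case: (Kh l).
have hy l : 1 <= ev (h l) (y l) by case: (ca l) => _ _ _ [].
have Ay l : `|A (J (y l)) - J 0| <= e / (m p)%:R.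
  by rewrite linear0 subr0; case: (ca l) => _ _ _ [].
pose al : R := 48^-1.
pose v := (al * ((m p)%:R / (n p)%:R)) *: \sum_(0 <= l < n p) y l.
have bl : blocks c y by [].
have key w : exists k0, forall k, k != k0 -> (w <= c k + p)%N \/ (c k.+1 + p <= w)%N.
  have [[k0 hk0]|nk] := pselect (exists k, (c k + p < w < c k.+1 + p)%N).
    exists k0 => k kk; case: (leqP w (c k + p)) => h1; first by left.
    right; rewrite leqNgt; apply/negP => h2; case/eqP: kk.
    have cm' i : (c i + p <= c i.+1 + p)%N by rewrite leq_add2r.
    apply: (@cell_uniq (fun i => (c i + p)%N) w.-1) => //; nlia.
  exists 0%N => k _; case: (leqP w (c k + p)) => h1; first by left.
  by right; rewrite leqNgt; apply/negP => h2; apply: nk; exists k; rewrite h1.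
have mpw w : (p <= w)%N -> (m p)%:R <= (m w)%:R :> R.
  by move=> pw; rewrite ler_nat (m_mono hpar) //; nlia.
have RIS1 w : (p < w)%N -> exists k0, forall k f, k != k0 -> Kw w f ->
     `|ev f (y k)| <= 8 / (m p)%:R ^+ 2.
  move=> pw; have [k0 hk0] := key w; exists k0 => k f kk Kf.
  have w2 : (2 <= w)%N by nlia.
  have [_ _ _ _ /(_ w f w2 Kf)[h1 h2]] := ca k.
  case: (hk0 k kk) => [/h1 h3|/h2//]; apply: le_trans h3 _.
  have p1 : (1 <= p)%N by nlia.
  have := m_ltX hpar p1 pw; rewrite -(ler_nat R) natrX => h4.
  rewrite ler_wpM2l // lef_pV2 ?posrE ?exprn_gt0 //; last by rewrite (lt_le_trans mp0) ?mpw // ltnW.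
  by apply: le_trans h4; rewrite ler_weXn2l.
have RIS0 w : (p <= w)%N -> exists k0, forall k f, k != k0 -> Kw w f ->
     `|ev f (y k)| <= 8 / (m p)%:R.
  move=> pw; have [k0 hk0] := key w; exists k0 => k f kk Kf.
  have w2 : (2 <= w)%N by nlia.
  have [_ _ _ _ /(_ w f w2 Kf)[h1 h2]] := ca k.
  case: (hk0 k kk) => [/h1|/h2] h3; apply: le_trans h3 _.
    rewrite ler_wpM2l // lef_pV2 ?posrE ?mpw //; by rewrite (lt_le_trans mp0) ?mpw.
  rewrite ler_wpM2l // lef_pV2 ?posrE ?exprn_gt0 //.
  by rewrite -[X in X <= _]expr1 ler_weXn2l.
have yn k : nbd (y k) 8.
  apply: nbdW (nbd_norm hpar hsigma hX (y k)); case: (ca k) => _ [_ h1] _ _ _.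
  by apply: le_trans h1 _; lra.
have ex := exact_of_RIS hpar hsigma p2 bl (ler0n R 8) yn RIS0 RIS1.
have {}ex : exact_vec 1 p v.
  have := exact_vecZ al ex; rewrite scalerA ger0_norm ?invr_ge0 //.
  have -> : al * (6 * 8) = 1 by rewrite /al -natrM mulVf // pnatr_eq0.
  by [].
pose F := (m p)%:R^-1 *: \sum_(0 <= l < n p) h l.
have Fv : 1 / 48 <= ev F v.
  rewrite /F /v evZ evZl (ev_block_diag _ cm sh sy).
  have -> : forall s0 : R, al * ((m p)%:R / (n p)%:R) * ((m p)%:R^-1 * s0) = al * ((n p)%:R^-1 * s0).
    by move=> s0; field; rewrite !gt_eqF.
  have -> : 1 / 48 = al * ((n p)%:R^-1 * ((n p)%:R * 1)).
    by rewrite mulKf ?gt_eqF // /al; field.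
  rewrite ler_wpM2l ?invr_ge0 // ler_wpM2l ?invr_ge0 //.
  apply: (@le_trans _ _ (\sum_(0 <= l < n p) 1)); first by rewrite sumr_const_nat subn0 mulr_natl.
  exact: ler_sum.
have n48 : 0 < 1 / 48 :> R by rewrite divr_gt0.
have F0 : F <> 0 by move=> F0; move: Fv; rewrite F0 ev0l leNgt n48.
have v0 : v != 0.
  by apply/eqP => v0; move: Fv; rewrite v0 (linear0 (ev F)) leNgt n48.
have [vE gp] := good_pair_avg hpar hsigma p2 op c01 cm sy ry Kh (is_ratV (is_rat_nat R 48)) ex v0 F0.
rewrite c0 in gp; eexists; exists F, (c (n p)); split; first exact: gp.
  by rewrite vE.
rewrite vE; have := op_sum (a := y) (b := fun=> 0) (al * ((m p)%:R / (n p)%:R)) (n p) Ay.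
have -> : \sum_(0 <= l < n p) (0 : c00 R) = 0 by rewrite big1.
rewrite scaler0 linear0 subr0 => h1; apply: le_trans h1 _.
rewrite ger0_norm ?mulr_ge0 ?invr_ge0 ?divr_ge0 ?(ltW mp0) ?(ltW np0) //.
have -> : al * ((m p)%:R / (n p)%:R) * ((n p)%:R * (e / (m p)%:R)) = al * e.
  by field; rewrite !gt_eqF.
by rewrite ler_piMl ?(ltW e0) // /al invf_le1 // ler1n.
Qed.

End Operator.

(** If A is not bounded below, [even_small_pair] gives even terms on which A is
    small, and [odd_near_pair] odd terms that A nearly fixes. The alternating
    sum has norm at most 960 k / m_q^2 by [special_sum_norm] with a = 1. Its
    image is close to the sum of the odd vectors, on which the functional of
    the sequence takes the value sum lam_i / m_q >= k / (48 m_q). *)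
Theorem not_singular (A : {linear X -> X}) (B : R) : 0 <= B ->
  (forall x, `|A x| <= B * `|x|) ->
  (forall (e : R) N, 0 < e -> exists i, (N <= i)%N /\ `|A (J (ebase R i)) - J (ebase R i)| < e) ->
  exists (e : R) N, 0 < e /\ forall x : c00 R, (forall k, (k < N)%N -> x k = 0) ->
    e * `|J x| <= `|A (J x)|.
Proof.
move=> B0 AB near; apply: contrapT => nex.
have sing (e : R) N : 0 < e -> exists x : c00 R,
    (forall k, (k < N)%N -> x k = 0) /\ `|A (J x)| < e * `|J x|.
  move=> e0; apply: contrapT => h; apply: nex; exists e, N; split=> // x x0.
  by rewrite leNgt; apply/negP => h1; apply: h; exists x.
(* With this q, k / (48 m_q) exceeds the sum of the upper estimate, of order
   k / m_q^2, and of the 2 k approximation errors e0. *)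
have [q [k [q3 oq nq k0 hM]]] := large_odd_weight hpar (960 * 96 * B).
have M0 : 0 < (m q)%:R :> R by rewrite ltr0n (m_gt0 hpar) //; nlia.
pose M : R := (m q)%:R; rewrite -/M in M0 hM.
pose e0 := (48 * 8 * M)^-1.
have e00 : 0 < e0 by rewrite invr_gt0 !mulr_gt0.
pose E (b : bool) p (lo : nat) (x f : nat -> R) (hi : nat) :=
  let v := (m p)%:R *: mkc x in
  if b then ev f v = 1 /\ `|A (J v) - J v| <= e0 else 1 / 48 <= ev f v /\ `|A (J v)| <= e0.
have Eex b p lo : (2 <= p)%N -> ~~ odd p -> (1 <= lo)%N ->
    exists x f hi, good_pair b p lo x f hi /\ E b p lo x f hi.
  move=> p2 op lo1; case: b.
    have [x [f [hi [h1 h2 h3]]]] := odd_near_pair near e00 p2 op lo1.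
    by exists x, f, hi.
  have [x [f [hi [h1 h2 h3]]]] := even_small_pair B0 AB sing e00 p2 op lo1.
  by exists x, f, hi.
have [p1 [phi [c [lam [hL hes hlam Kf]]]]] := special_exists_good hpar hsigma Eex q3 oq nq.
have es := hes 1 (or_introl erefl).
pose v i := spec_vec m sigma p1 phi i.
have odd1 i : odd (2 * i).+1 by rewrite /= oddM.
have odd2 i : odd (2 * i).+2 = false by rewrite /= oddM.
have hv1 i : (i < k)%N -> ev (fs phi (2 * i).+1) (v (2 * i).+1) = 1 /\
    `|A (J (v (2 * i).+1)) - J (v (2 * i).+1)| <= e0.
  move=> ik; have h2 : (1 <= (2 * i).+1 <= 2 * k)%N by nlia.
  by have := hL _ h2; rewrite odd1 => -[].
have hv2 i : (i < k)%N -> 1 / 48 <= ev (fs phi (2 * i).+2) (v (2 * i).+2) /\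
    `|A (J (v (2 * i).+2))| <= e0.
  move=> ik; have h2 : (1 <= (2 * i).+2 <= 2 * k)%N by nlia.
  by have := hL _ h2; rewrite odd2 => -[].
have sv1 i : (i < k)%N -> supp_in (c (2 * i).+1) (c (2 * i).+2) (v (2 * i).+1).
  move=> ik; have h2 : (1 <= (2 * i).+1 <= 2 * k)%N by nlia.
  have := es_xs es h2; have := hL _ h2; rewrite odd1 => -[[[_ _ _ [fx _ _ _] _] _ _] _] sx.
  have mE : mkc (xs phi (2 * i).+1) = xs phi (2 * i).+1 :> (nat -> R) by exact: mkcE.
  by move=> l; rewrite /v /spec_vec c00Z mE mulf_eq0 negb_or => /andP[_]; exact: sx.
have cm := es_mono es.
have sv i : (i < k)%N -> supp_in (c (2 * i).+1) (c (2 * i).+3) (v (2 * i).+1).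
  by move=> ik; apply: supp_inW (sv1 i ik) _ _.
have low : k%:R * (1 / 48) / M <= `|J (\sum_(i < k) v (2 * i).+1)|.
  apply: le_trans (ev_le_norm hpar hsigma hX _ Kf).
  apply: le_trans (ler_norm _); rewrite (lower_value lam es sv) mulrC ler_wpM2l ?invr_ge0 ?(ltW M0) //.
  apply: (@le_trans _ _ (\sum_(i < k) (1 / 48))); first by rewrite sumr_const card_ord mulr_natl.
  apply: ler_sum => i _; have [h1 _] := hv1 i (ltn_ord i).
  have hl : (1 <= (2 * i).+2 <= 2 * k)%N by have := ltn_ord i; nlia.
  have hi1 : (1 <= i.+1 <= k)%N by rewrite /= ltn_ord.
  have [h2 _] := hv2 i (ltn_ord i).
  have e2 : (2 * i.+1)%N = (2 * i).+2 by rewrite mulnS.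
  have := hlam i.+1 hi1; rewrite e2 /= => -> //; last by rewrite gt_eqF // (lt_le_trans _ h2) // divr_gt0.
  rewrite h1 mulr1.
  have -> : ev (fs phi (2 * i).+2) (v (2 * i).+1) = 0.
    by apply: ev_supp_in (es_fs es hl) (sv1 i (ltn_ord i)) _; rewrite leqnn orbT.
  by rewrite addr0.
have kE (r : R) : \sum_(i < k) r = k%:R * r by rewrite sumr_const card_ord mulr_natl.
have up1 : `|J (\sum_(i < k) v (2 * i).+1)| <=
    `|A (J (\sum_(0 <= i < k) pair_vec m sigma p1 phi 1 k i))| + k%:R * e0 + k%:R * e0.
  have -> : J (\sum_(i < k) v (2 * i).+1) = A (J (\sum_(0 <= i < k) pair_vec m sigma p1 phi 1 k i)) -
     \sum_(i < k) (A (J (v (2 * i).+1)) - J (v (2 * i).+1)) + \sum_(i < k) A (J (v (2 * i).+2)).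
    have -> : \sum_(0 <= i < k) pair_vec m sigma p1 phi 1 k i =
        \sum_(i < k) v (2 * i).+1 - \sum_(i < k) v (2 * i).+2.
      rewrite big_mkord -sumrB; apply: eq_bigr => i _.
      by rewrite /pair_vec ltn_ord scale1r.
    have G (a b d : X) : d = a - b - (a - d) + b.
      by rewrite opprB addrCA [a - b - a]addrAC subrr add0r subrK.
    have JA (w : nat -> c00 R) : A (J (\sum_(i < k) w i)) = \sum_(i < k) A (J (w i)).
      by rewrite !linear_sum.
    have JB (u w : c00 R) : A (J (u - w)) = A (J u) - A (J w) by rewrite !linearB.
    rewrite JB (JA (fun i => v (2 * i).+1)) (JA (fun i => v (2 * i).+2)).
    by rewrite sumrB linear_sum; exact: G.
  apply: le_trans (ler_normD _ _) _; apply: lerD.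
    apply: le_trans (ler_normB _ _) _; rewrite lerD2l.
    apply: le_trans (ler_norm_sum _ _ _) _; rewrite -kE.
    by apply: ler_sum => i _; have [] := hv1 i (ltn_ord i).
  apply: le_trans (ler_norm_sum _ _ _) _; rewrite -kE.
  by apply: ler_sum => i _; have [] := hv2 i (ltn_ord i).
have up2 : `|A (J (\sum_(0 <= i < k) pair_vec m sigma p1 phi 1 k i))| <= B * (960 * (k%:R / M ^+ 2)).
  by apply: le_trans (AB _) _; rewrite ler_wpM2l // (special_sum_norm hpar hsigma hX es).
have kp : 0 < k%:R :> R by rewrite ltr0n.
have : k%:R * (1 / 48) / M <= B * (960 * (k%:R / M ^+ 2)) + k%:R * e0 + k%:R * e0 by lra.
have -> : k%:R * (1 / 48) / M = k%:R / M * (1 / 48) by ring.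
have -> : B * (960 * (k%:R / M ^+ 2)) + k%:R * e0 + k%:R * e0 = k%:R / M * (960 * B / M + 1 / 48 / 4).
  by rewrite /e0; field; rewrite gt_eqF.
rewrite ler_pM2l ?divr_gt0 //.
have : 960 * B / M <= 1 / 96.
  rewrite ler_pdivrMr //; lra.
lra.
Qed.

End Singular.

(** * Codimension up to closure *)
Section Codimension.
Variables (R : realType) (X : normedModType R).
Implicit Types (V W : set X) (u v w x : X) (a e : R).

Definition add_line V w : set X := [set x | exists v a, V v /\ x = v + a *: w].

Definition subspace V := V 0 /\ forall a v w, V v -> V w -> V (a *: v + w).

(** Membership in the closure of V. *)
Definition approx V x := forall e, 0 < e -> exists v, V v /\ `|x - v| < e.

(** The closure of V has codimension at most N. The vectors that complete V are
    added one at a time, which suits inductions on N. *)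
Fixpoint codim_le N V : Prop :=
  if N is N'.+1 then exists w, codim_le N' (add_line V w) else forall x, approx V x.

Lemma subspace_add_line V w : subspace V -> subspace (add_line V w).
Proof.
move=> [V0 VD]; split; first by exists 0, 0; rewrite scale0r addr0.
move=> a _ _ [v [b [Vv ->]]] [v' [b' [Vv' ->]]].
exists (a *: v + v'), (a * b + b'); split; first exact: VD.
by rewrite scalerDr scalerA scalerDl addrACA.
Qed.

Lemma subspaceN V v : subspace V -> V v -> V (- v).
Proof. by move=> [V0 VD] Vv; have := VD (-1) v 0 Vv V0; rewrite scaleN1r addr0. Qed.

Lemma subspaceZ V a v : subspace V -> V v -> V (a *: v).
Proof. by move=> [V0 VD] Vv; have := VD a v 0 Vv V0; rewrite addr0. Qed.

Lemma subspaceD V v w : subspace V -> V v -> V w -> V (v + w).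
Proof. by move=> [V0 VD] Vv Vw; have := VD 1 v w Vv Vw; rewrite scale1r. Qed.

Lemma sub_add_line V w : V `<=` add_line V w.
Proof. by move=> v Vv; exists v, 0; rewrite scale0r addr0. Qed.

Lemma add_line_approx V W w x : V `<=` approx W -> add_line V w x -> approx (add_line W w) x.
Proof.
move=> VW [v [a [Vv ->]]] e e0; have [v' [Wv' vv']] := VW v Vv e e0.
exists (v' + a *: w); split; first by exists v', a.
by rewrite opprD addrACA subrr addr0.
Qed.

Lemma codim_le_approx N V W : V `<=` approx W -> codim_le N V -> codim_le N W.
Proof.
elim: N V W => [|N IH] V W VW /=.
  move=> h x e e0; have e20 : 0 < e / 2 by rewrite divr_gt0.
  have [v [Vv xv]] := h x _ e20; have [v' [Wv' vv']] := VW v Vv _ e20.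
  exists v'; split=> //; rewrite -(subrKA v); apply: le_lt_trans (ler_normD _ _) _; lra.
by move=> [w h]; exists w; apply: IH h; move=> x; apply: add_line_approx.
Qed.

Lemma approx_sub V : V `<=` approx V.
Proof. by move=> v Vv e e0; exists v; rewrite subrr normr0. Qed.

Lemma codim_leS N V W : V `<=` W -> codim_le N V -> codim_le N W.
Proof. by move=> VW; apply: codim_le_approx => v /VW; apply: approx_sub. Qed.

Lemma add_line_comm V u w : add_line (add_line V u) w `<=` add_line (add_line V w) u.
Proof.
move=> _ [_ [a [[v [b [Vv ->]]] ->]]]; exists (v + a *: w), b.
by split; [exists v, a|rewrite addrAC].
Qed.

Lemma approx_linear V a v w : subspace V -> V v -> approx V w -> approx V (v + a *: w).
Proof.
move=> [_ VD] Vv Vw e e0; have a1 : 0 < `|a| + 1 by rewrite ltr_wpDl.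
have [w' [Vw' hw]] := Vw _ (divr_gt0 e0 a1).
exists (a *: w' + v); split; first exact: VD.
rewrite [a *: w' + v]addrC opprD addrACA subrr add0r -scalerBr normrZ.
apply: (@le_lt_trans _ _ (`|a| * (e / (`|a| + 1)))); first by rewrite ler_wpM2l // ltW.
by rewrite mulrA ltr_pdivrMr // mulrC ltr_pM2l // ltrDl.
Qed.

Lemma add_line_approx_sub V w u : subspace V -> approx (add_line V u) w ->
  add_line V w `<=` approx (add_line V u).
Proof.
move=> sV h _ [v [a [Vv ->]]]; apply: approx_linear => //; first exact: subspace_add_line.
exact: sub_add_line.
Qed.

Lemma dist_gt0 V x : ~ approx V x -> exists d, 0 < d /\ forall v, V v -> d <= `|x - v|.
Proof.
move=> nx; apply: contrapT => nd; apply: nx => d d0; apply: contrapT => nv; apply: nd.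
by exists d; split=> // v Vv; rewrite leNgt; apply/negP => hv; apply: nv; exists v.
Qed.

(** A point of V closest to x need not exist, but the distance is positive, so
    it is attained up to any factor r > 1. *)
Lemma near_closest V x (r : R) : subspace V -> ~ approx V x -> 1 < r ->
  exists D v0, [/\ 0 < D, V v0, forall v, V v -> D <= `|x - v0 - v| & `|x - v0| < r * D].
Proof.
move=> sV /dist_gt0[d [d0 hd]] r1; pose E := [set `|x - v| | v in V].
have infE : has_inf E.
  split; first by exists `|x - 0|, 0 => //; case: sV.
  by exists d => _ [v Vv <-]; apply: hd.
have dE : d <= inf E by apply: lb_le_inf => [|_ [v Vv <-]]; [case: infE|apply: hd].
have D0 : 0 < inf E by exact: lt_le_trans dE.
have [|_ [v0 Vv0 <-] hv0] := @inf_adherent _ E ((r - 1) * inf E) _ infE.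
  by rewrite mulr_gt0 // subr_gt0.
exists (inf E), v0; split=> // [v Vv|]; last by move: hv0; rewrite mulrBl mul1r addrCA subrr addr0.
rewrite -addrA -opprD; apply: ge_inf; first by exists d => _ [v' Vv' <-]; apply: hd.
by exists (v0 + v) => //; apply: subspaceD.
Qed.

(** As u is not in the closure of V, the coefficient of w in an approximation
    of u stays away from 0. *)
Lemma approx_exchange V w u : subspace V -> ~ approx V u -> approx (add_line V w) u ->
  approx (add_line V u) w.
Proof.
move=> sV /dist_gt0[d [d0 hd]] h e e0.
pose e1 := Num.min (d / 2) (e * (d / 2) / (`|w| + 1)).
have w1 : 0 < `|w| + 1 by rewrite ltr_wpDl.
have e10 : 0 < e1 by rewrite lt_min !divr_gt0 // !mulr_gt0 // divr_gt0.
have [_ [[v [a [Vv ->]]] hv]] := h _ e10.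
have aw : d / 2 <= `|a| * `|w|.
  have := hd v Vv; have : `|u - v| <= `|u - (v + a *: w)| + `|a *: w|.
    by apply: le_trans _ (ler_normD _ _); rewrite opprD addrA subrK.
  have : e1 <= d / 2 by rewrite ge_min lexx.
  rewrite normrZ; lra.
have a0 : a != 0.
  by apply/eqP => a0; move: aw; rewrite a0 normr0 mul0r leNgt divr_gt0.
have na : 0 < `|a| by rewrite normr_gt0.
exists (a^-1 *: (u - v)); split.
  exists (a^-1 *: (- v)), a^-1; split; first by apply: subspaceZ => //; apply: subspaceN.
  by rewrite -scalerDr addrC.
have -> : w - a^-1 *: (u - v) = - (a^-1 *: (u - (v + a *: w))).
  by rewrite [v + _]addrC opprD addrA addrAC [in RHS]scalerBr scalerA mulVf // scale1r opprB.
rewrite normrN normrZ normfV ltr_pdivrMl //; apply: lt_le_trans hv _.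
apply: (@le_trans _ _ (e * (d / 2) / (`|w| + 1))); first by rewrite ge_min lexx orbT.
rewrite ler_pdivrMr //; apply: (@le_trans _ _ (e * (`|a| * `|w|))).
  by rewrite ler_pM2l.
rewrite [X in _ <= X * _]mulrC -mulrA ler_pM2l // ler_pM2l // lerDl //.
Qed.

Lemma codim_le_exchange k V u : subspace V -> ~ approx V u -> codim_le k.+1 V ->
  codim_le k (add_line V u).
Proof.
elim: k V => [|k IH] V sV nu [w hw].
  apply: (@codim_le_approx 0 (add_line V w)) => //; apply: add_line_approx_sub => //.
  exact: (approx_exchange sV nu (hw u)).
have [hu|hu] := pselect (approx (add_line V w) u).
  apply: (@codim_le_approx k.+1 (add_line V w)) => //; apply: add_line_approx_sub => //.
  exact: (approx_exchange sV nu hu).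
exists w; apply: codim_leS (@add_line_comm V w u) _.
by apply: IH => //; apply: subspace_add_line.
Qed.

(** For N = 0, a vector of V' nearly closest to a given x outside the closure
    could be improved. For the step, w is first replaced by w - v0 with v0
    nearly closest to w in V, as in the lemma of Riesz; then adding the same
    line to V and V' multiplies the gap by at most 3. *)
Lemma codim_le_gap N V V' : subspace V -> subspace V' ->
  (forall v, V v -> exists v', V' v' /\ `|v - v'| <= (2 * 3 ^+ N)^-1 * `|v|) ->
  codim_le N V -> codim_le N V'.
Proof.
elim: N V V' => [|N IH] V V' sV sV' gap.
  move=> dV x; apply: contrapT => nx.
  have r1 : 1 < 5 / 4 :> R by lra.
  have [D [v0 [D0 Vv0 hD hv0]]] := near_closest sV' nx r1.
  have [|v [Vv hv]] := dV (x - v0) (D / 16); first by lra.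
  have [v' [Vv' hv']] := gap v Vv; rewrite expr0 mulr1 in hv'.
  have := hD v' Vv'; have h1 : `|x - v0 - v'| <= `|x - v0 - v| + `|v - v'|.
    by apply: le_trans _ (ler_normD _ _); rewrite subrKA.
  have h2 : `|v| <= `|x - v0| + `|x - v0 - v|.
    by rewrite -[v in leLHS](subKr (x - v0)); apply: ler_normB.
  lra.
move=> [w hw].
have N3 : 0 < (2 * 3 ^+ N : R) by rewrite mulr_gt0 // exprn_gt0.
pose et : R := (2 * 3 ^+ N)^-1.
have et0 : 0 < et by rewrite invr_gt0.
have et1 : et <= 1.
  have h3 : 1 <= (3 : R) ^+ N by rewrite exprn_ege1 // ler1n.
  by rewrite invf_le1 //; lra.
have etS : (2 * 3 ^+ N.+1)^-1 = et / 3 :> R by rewrite /et exprS; field; rewrite expf_neq0.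
rewrite etS in gap.
have [aw|naw] := pselect (approx V w).
  exists 0; apply: (codim_leS (@sub_add_line V' 0)).
  apply: IH hw => //; first exact: subspace_add_line.
  move=> _ [v [a [Vv ->]]]; set x := v + a *: w.
  have [->|x0] := eqVneq x 0; first by exists 0; rewrite subrr normr0 mulr0; split=> //; case: sV'.
  have nx : 0 < `|x| by rewrite normr_gt0.
  have ax : approx V x by exact: approx_linear.
  have [|v1 [Vv1 h1]] := ax (et / 3 * `|x|); first by rewrite !mulr_gt0 // invr_gt0.
  have [v' [Vv' h']] := gap v1 Vv1; exists v'; split=> //.
  have h2 : `|x - v'| <= `|x - v1| + `|v1 - v'| by apply: le_trans _ (ler_normD _ _); rewrite subrKA.
  have h3 : `|v1| <= `|x| + `|x - v1| by rewrite -[v1 in leLHS](subKr x); apply: ler_normB.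
  have h4 : et / 3 * `|v1| <= et / 3 * (2 * `|x|).
    rewrite ler_pM2l ?divr_gt0 //; have : et * `|x| <= 1 * `|x| by rewrite ler_pM2r.
    lra.
  rewrite -/et; lra.
have r1 : 1 < 2 :> R by lra.
have [D [v0 [D0 Vv0 hD hv0]]] := near_closest sV naw r1.
pose w' := w - v0; rewrite -/w' in hD hv0.
exists w'; apply: (IH (add_line V w')).
- exact: subspace_add_line.
- exact: subspace_add_line.
- move=> _ [v [a [Vv ->]]]; have [v' [Vv' h']] := gap v Vv.
  exists (v' + a *: w'); split; first by exists v', a.
  have -> : v + a *: w' - (v' + a *: w') = v - v' by rewrite opprD addrACA subrr addr0.
  apply: le_trans h' _; rewrite -/et -mulrA ler_pM2l // ler_pdivrMl //.
  have h1 : `|a| * `|w'| <= 2 * `|v + a *: w'|.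
    have [->|a0] := eqVneq a 0; first by rewrite normr0 mul0r mulr_ge0.
    have na : 0 < `|a| by rewrite normr_gt0.
    have : D <= `|w' - (- a^-1 *: v)| by apply: hD; apply: subspaceZ.
    have -> : w' - (- a^-1 *: v) = a^-1 *: (v + a *: w').
      by rewrite scaleNr opprK scalerDr scalerA mulVf // scale1r addrC.
    rewrite normrZ normfV ler_pdivlMl // => h.
    have : `|a| * `|w'| <= `|a| * (2 * D) by rewrite ler_pM2l // ltW.
    lra.
  have h2 : `|v| <= `|v + a *: w'| + `|a *: w'|.
    by apply: le_trans _ (ler_normB _ _); rewrite addrK.
  rewrite normrZ in h2; lra.
- apply: codim_leS hw => _ [v [a [Vv ->]]]; exists (v + a *: v0), a; split.
    by rewrite addrC; case: sV => _; apply.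
  by rewrite /w' scalerBr addrA addrAC addrK.
Qed.

End Codimension.

Lemma cluster_point (R : realType) (u : nat -> R) (C : R) : (forall j, `|u j| <= C) ->
  exists l, forall e N, 0 < e -> exists j, (N <= j)%N /\ `|u j - l| < e.
Proof.
move=> uC.
have uI j : `[- C, C]%classic (u j) by rewrite /= in_itv /= -ler_norml.
have uF : ProperFilter (u @ \oo) by exact: fmap_proper_filter.
have uA : (u @ \oo) `[- C, C]%classic by exists 0%N => // j _; exact: uI.
have [l [_ cl]] := @segment_compact R (- C) C (u @ \oo) uF uA.
exists l => e N e0.
have [||_ [[j Nj <-] hj]] := cl (u @` [set j | (N <= j)%N]) (ball l e).
- by exists N => // j /= Nj; exists j.
- exact: nbhsx_ballx.
by exists j; split=> //; rewrite -ball_normE /= distrC in hj.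
Qed.

Lemma homogeneous_bound (R : realType) (X : lmodType R) (p q : X -> R) (d : R) :
  (forall a x, p (a *: x) = `|a| * p x) -> (forall a x, q (a *: x) = `|a| * q x) ->
  (forall x, 0 <= p x) -> (forall x, 0 <= q x) -> 0 < d -> (forall x, p x < d -> q x < 1) ->
  forall x, q x <= 2 / d * p x.
Proof.
move=> pZ qZ p0 q0 d0 h x; have := p0 x; rewrite le_eqVlt => /orP[/eqP px|px].
  have := q0 x; rewrite le_eqVlt => /orP[/eqP qx|qx]; first by rewrite -px -qx mulr0.
  have := h ((q x)^-1 *: x); rewrite pZ -px mulr0 => /(_ d0).
  by rewrite qZ gtr0_norm ?invr_gt0 // mulVf ?gt_eqF // ltxx.
have := h ((d / 2 / p x) *: x); rewrite pZ qZ gtr0_norm ?divr_gt0 // divfK ?gt_eqF //.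
have dd : d / 2 < d by lra.
move=> /(_ dd); rewrite mulrAC ltr_pdivrMr // mul1r => /ltW h1.
rewrite mulrAC ler_pdivlMr //; lra.
Qed.

(** * The index argument *)
Section Index.
Variables (R : realType) (m n s : nat -> nat) (sigma : pseq R -> nat).
Hypothesis hpar : ius_parameters m n s.
Hypothesis hsigma : coding_function m sigma.
Variables (X : completeNormedModType R) (J : {linear c00 R -> X}).
Hypothesis hX : is_completion (ius_norm m n sigma) J.

Definition tail N : set (c00 R) := [set x | forall k, (k <= N)%N -> x k = 0].

Definition tail_image (A : X -> X) N : set X := [set A (J x) | x in tail N].

Lemma tail_image_subspace (A : {linear X -> X}) N : subspace (tail_image A N).
Proof.
split; first by exists 0; rewrite ?linear0.
move=> a _ _ [x xN <-] [y yN <-]; exists (a *: x + y); last by rewrite !linearP.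
by move=> k kN; rewrite c00D c00Z xN // yN // mulr0 addr0.
Qed.

Lemma tail_split N (x : c00 R) : tail N x ->
  exists y a, tail N.+1 y /\ x = y + a *: ebase R N.+1.
Proof.
move=> xN; exists (x - x N.+1 *: ebase R N.+1), (x N.+1); split; last by rewrite subrK.
move=> k; rewrite c00B c00Z ebaseE // leq_eqVlt => /orP[/eqP->|kN].
  by rewrite eqxx mulr1 subrr.
by rewrite xN // ltn_eqF // mulr0 subr0.
Qed.

Lemma tail_image_step (A : {linear X -> X}) N :
  tail_image A N `<=` add_line (tail_image A N.+1) (A (J (ebase R N.+1))).
Proof.
move=> _ [x /tail_split[y [a [yN ->]]] <-].
by exists (A (J y)), a; split; [exists y|rewrite !linearD !linearZ].
Qed.

Lemma codim_le_tail N : codim_le N (tail_image idfun N).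
Proof.
elim: N => [|N IH].
  move=> x e e0; have [y hy] := dense_eps hX x e0; exists (J y); split=> //.
  by exists y => // k; rewrite leqn0 => /eqP->; rewrite c00_0.
by exists (J (ebase R N.+1)); apply: codim_leS IH; exact: (@tail_image_step [the {linear X -> X} of idfun] N).
Qed.

(** The coordinate functional at N + 1 has norm 1, so that T e_{N+1} has
    distance at least c to the image of the tail. Hence T e_N, ..., T e_1 can
    replace, one after the other, the vectors that complete the image. *)
Lemma codim_le0_range (T : {linear X -> X}) (c : R) N : 0 < c ->
  (forall x, c * `|x| <= `|T x|) -> codim_le N (tail_image T N) -> codim_le 0 (range T).
Proof.
move=> c0 Tc; elim: N => [|N IH].
  by apply: codim_leS => _ [x _ <-]; exists (J x).
move=> /(codim_le_exchange (u := T (J (ebase R N.+1))) (tail_image_subspace T N.+1)) h.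
apply: IH; apply: codim_leS (h _).
  move=> _ [_ [a [[x xN <-] ->]]]; exists (x + a *: ebase R N.+1).
    move=> k kN; rewrite c00D c00Z ebaseE // xN ?(leqW kN) // ltn_eqF ?ltnS //.
    by rewrite mulr0 addr0.
  by rewrite !linearD !linearZ.
move=> /(_ c c0)[_ [[x xN <-] hx]].
have := le_lt_trans (Tc (J (ebase R N.+1) - J x)); rewrite linearB => /(_ _ hx).
rewrite gtr_pMr // -linearB => h1.
have := coord_le_norm hpar hsigma hX (ebase R N.+1 - x) N.+1.
by rewrite c00B ebaseE // eqxx xN // subr0 normr1 leNgt h1.
Qed.

Lemma closed_range (T : {linear X -> X}) (B c : R) : 0 < c ->
  (forall x, `|T x| <= B * `|x|) -> (forall x, c * `|x| <= `|T x|) ->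
  forall z, approx (range T) z -> range T z.
Proof.
move=> c0 TB Tc z hz.
have hx j : exists x, `|z - T x| < j.+1%:R^-1.
  by have [|_ [[x _ <-] h]] := hz j.+1%:R^-1; [rewrite invr_gt0|exists x].
have [x xz] := choice hx.
have small (e : R) : 0 < e -> exists N, forall j, (N <= j)%N -> j.+1%:R^-1 < e.
  move=> e0; have [N hN] := bound_nat (e^-1); exists N => j Nj.
  by rewrite invf_plt ?posrE // (le_lt_trans (hN j Nj)) // ltr_nat.
have cx : cvg (x @ \oo).
  apply/cauchy_cvgP/cauchy_exP => e e0.
  have [N hN] := small (c * e / 2) (divr_gt0 (mulr_gt0 c0 e0) (ltr0Sn _ _)).
  exists (x N); exists N => // j Nj /=; rewrite -ball_normE /=.
  have h1 := Tc (x N - x j); rewrite linearB in h1.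
  have h2 : `|T (x N) - T (x j)| <= `|z - T (x N)| + `|z - T (x j)|.
    rewrite distrC -[T (x j) - _](subrKA z) addrC; apply: le_trans (ler_normD _ _) _.
    by rewrite [`|T (x j) - z|]distrC.
  have h3 := lt_trans (xz N) (hN N (leqnn N)).
  have h4 := lt_trans (xz j) (hN j Nj).
  have : c * `|x N - x j| < c * e by lra.
  by rewrite ltr_pM2l.
pose l := lim (x @ \oo).
have xl : x @ \oo --> l by exact: cx.
exists l => //; apply/eqP; rewrite eq_sym -subr_eq0 -normr_le0 leNgt; apply/negP => d0.
set d := `|z - T l| in d0 *.
have B1 : 0 < `|B| + 1 by rewrite ltr_wpDl.
have [N1 hN1] := small (d / 2) (divr_gt0 d0 (ltr0Sn _ _)).
have /cvgrPdist_lt/(_ (d / 2 / (`|B| + 1))) := xl.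
case; first by rewrite !divr_gt0.
move=> N2 _ hN2; pose j := maxn N1 N2.
have h1 := lt_trans (xz j) (hN1 j (leq_maxl _ _)).
have h2 := hN2 j (leq_maxr _ _); rewrite /= in h2.
have h3 : d <= `|z - T (x j)| + `|T l - T (x j)|.
  by rewrite [X in _ <= _ + X]distrC; apply: le_trans _ (ler_normD _ _); rewrite subrKA.
have h4 : `|T l - T (x j)| <= (`|B| + 1) * `|l - x j|.
  rewrite -linearB; apply: le_trans (TB _) _; rewrite ler_wpM2r //.
  by have := ler_norm B; lra.
have h5 : (`|B| + 1) * `|l - x j| < d / 2 by rewrite -ltr_pdivlMl // mulrC.
lra.
Qed.

Lemma isomorphism_bounds (Y : set X) (T : {linear X -> X}) (S : X -> X) :
  (forall x, Y (T x)) -> cancel T S -> continuous T -> {within Y, continuous S} ->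
  exists B c, [/\ 0 <= B, 0 < c, forall x, `|T x| <= B * `|x| & forall x, c * `|x| <= `|T x|].
Proof.
move=> YT TS Tc Sc.
have TZ a x : T (a *: x) = a *: T x by rewrite linearZ.
have [d1 d10 hd1] : exists2 d : R, 0 < d & forall x, `|x| < d -> `|T x| < 1.
  have : T x @[x --> 0] --> T 0 by exact: Tc.
  rewrite linear0 => /cvgrPdist_lt/(_ 1 ltr01) /nbhs_ballP[d /= d0 hd].
  exists d => // x xd; have := hd x; rewrite -ball_normE /= !sub0r !normrN; exact.
have [d2 d20 hd2] : exists2 d : R, 0 < d & forall x, `|T x| < d -> `|x| < 1.
  have Y0 : Y 0 by rewrite -(linear0 T); exact: YT.
  have S0 : S 0 = 0 by rewrite -[in LHS](linear0 T) TS.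
  have := (subspace_continuousP Y S).1 Sc 0 Y0.
  rewrite S0 => /cvgrPdist_lt/(_ 1 ltr01); rewrite near_withinE => /nbhs_ballP[d /= d0 hd].
  exists d => // x xd; have := hd (T x); rewrite -ball_normE /= !sub0r !normrN TS.
  by apply.
have h1 := homogeneous_bound (p := fun x : X => `|x|) (q := fun x => `|T x|).
have h2 := homogeneous_bound (p := fun x : X => `|T x|) (q := fun x : X => `|x|).
exists (2 / d1), (d2 / 2); split; rewrite ?divr_ge0 ?divr_gt0 // ?ltW //.
- by apply: h1 => // [a x|a x]; rewrite ?TZ normrZ.
- move=> x; have := h2 d2; move=> /(_ _ _ _ _ d20 hd2 x) h.
  have {h} : `|x| <= 2 / d2 * `|T x| by apply: h => // a y; rewrite ?TZ normrZ.
  by rewrite mulrAC ler_pdivlMr // => h; lra.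
Qed.

Definition homotopy (T : {linear X -> X}) (l th : R) : {linear X -> X} :=
  [the {linear X -> X} of ((1 - th) \*: idfun) \+ ((th / l) \*: T)].

Lemma homotopyE T l th x : homotopy T l th x = (1 - th) *: x + (th / l) *: T x.
Proof. by []. Qed.

Lemma homotopy_lip (T : {linear X -> X}) (l th th' : R) (x : X) (B : R) : l != 0 -> (forall x, `|T x| <= B * `|x|) ->
  `|homotopy T l th x - homotopy T l th' x| <= `|th - th'| * ((1 + B / `|l|) * `|x|).
Proof.
move=> l0 TB; rewrite !homotopyE.
have -> : (1 - th) *: x + (th / l) *: T x - ((1 - th') *: x + (th' / l) *: T x) =
   (th - th') *: (l^-1 *: T x - x).
  have -> : (th - th') *: (l^-1 *: T x - x) = (th / l - th' / l) *: T x - (th - th') *: x.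
    by rewrite scalerBr scalerA mulrBl.
  rewrite opprD addrACA -!scalerBl addrC; congr (_ + _).
  have -> : 1 - th - (1 - th') = - (th - th') by ring.
  by rewrite scaleNr.
rewrite normrZ ler_wpM2l //; apply: le_trans (ler_normB _ _) _.
rewrite mulrDl mul1r addrC lerD2l normrZ normfV [B / _]mulrC -mulrA.
by rewrite ler_wpM2l ?invr_ge0.
Qed.

(** If the lower bounds degenerated, [not_singular] would fail at a cluster
    point of the bad parameters, because the operators depend on the parameter
    in a Lipschitz way. *)
Lemma homotopy_bounded_below (T : {linear X -> X}) (l B : R) : l != 0 -> 0 <= B ->
  (forall x, `|T x| <= B * `|x|) ->
  (forall (e : R) N, 0 < e -> exists i, (N <= i)%N /\
     `|T (J (ebase R i)) - l *: J (ebase R i)| < e) ->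
  exists c N, 0 < c /\ forall th x, 0 <= th <= 1 -> tail N x ->
    c * `|J x| <= `|homotopy T l th (J x)|.
Proof.
move=> l0 B0 TB near; apply: contrapT => nex.
have l1 : 0 < `|l| by rewrite normr_gt0.
have bad N : exists th, (0 <= th <= 1) /\ exists2 x, tail N x &
    `|homotopy T l th (J x)| < N.+1%:R^-1 * `|J x|.
  apply: contrapT => nb; apply: nex; exists N.+1%:R^-1, N; rewrite invr_gt0; split=> // th x th01 xN.
  by rewrite leNgt; apply/negP => h; apply: nb; exists th; split=> //; exists x.
have [u hu] := choice bad.
have [|t ht] := @cluster_point R u 1.
  by move=> j; have [/andP[h1 h2] _] := hu j; rewrite ger0_norm.
have t01 : 0 <= t <= 1.
  rewrite !leNgt; apply/andP; split; apply/negP => h.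
    have h' : 0 < - t by lra.
    have [j [_]] := ht _ 0%N h'; have [/andP[h1 h2] _] := hu j.
    by rewrite ltr_norml => /andP[]; lra.
  have h' : 0 < t - 1 by lra.
  have [j [_]] := ht _ 0%N h'; have [/andP[h1 h2] _] := hu j.
  by rewrite ltr_norml => /andP[]; lra.
have /andP[t0 t1] := t01.
pose B' := 1 + B / `|l|.
have Bl : 0 <= B / `|l| by rewrite divr_ge0.
have AB x : `|homotopy T l t x| <= B' * `|x|.
  rewrite homotopyE; apply: le_trans (ler_normD _ _) _.
  rewrite !normrZ mulrDl; apply: lerD; first by rewrite ler_wpM2r // ger0_norm; lra.
  have -> : `|t| * `|l^-1| * `|T x| = t * (`|l|^-1 * `|T x|).
    by rewrite normfV (ger0_norm t0) mulrA.
  rewrite [B / _]mulrC -mulrA.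
  apply: (@le_trans _ _ (1 * (`|l|^-1 * `|T x|))); first by rewrite ler_wpM2r // mulr_ge0 ?invr_ge0.
  by rewrite mul1r ler_wpM2l ?invr_ge0.
have nearA (e : R) N : 0 < e -> exists i, (N <= i)%N /\
    `|homotopy T l t (J (ebase R i)) - J (ebase R i)| < e.
  move=> e0; have [i [Ni hi]] := near (e * `|l|) N (mulr_gt0 e0 l1); exists i; split=> //.
  rewrite homotopyE; move: (J _) hi => y hi.
  have -> : (1 - t) *: y + (t / l) *: T y - y = (t / l) *: (T y - l *: y).
    rewrite scalerBr scalerA divfK // scalerBl scale1r addrAC addrC.
    by rewrite addrAC subrr add0r.
  have -> : `|(t / l) *: (T y - l *: y)| = t * (`|l|^-1 * `|T y - l *: y|).
    by rewrite normrZ normrM normfV (ger0_norm t0) mulrA.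
  apply: (@le_lt_trans _ _ (1 * (`|l|^-1 * `|T y - l *: y|))).
    by rewrite ler_wpM2r // mulr_ge0 ?invr_ge0.
  by rewrite mul1r ltr_pdivrMl // mulrC.
have B'0 : 0 <= B' by rewrite addr_ge0.
have [c [N [c0 hc]]] := not_singular hpar hsigma hX B'0 AB nearA.
have B'1 : 0 < B' by rewrite ltr_wpDr.
have [N2 hN2] := bound_nat (2 / c).
have c2 : 0 < c / 2 / B' by rewrite !divr_gt0.
have [j [Nj hj]] := ht _ (maxn N N2) c2.
have [_ [x xj hx]] := hu j.
have h1 : c * `|J x| <= `|homotopy T l t (J x)|.
  by apply: hc => k kN; apply: xj; apply: leq_trans (ltnW kN) (leq_trans (leq_maxl _ _) Nj).
have h2 := homotopy_lip (u j) t (J x) l0 TB; rewrite -/B' in h2.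
have h3 : `|homotopy T l t (J x)| <= `|homotopy T l (u j) (J x)| +
    `|homotopy T l (u j) (J x) - homotopy T l t (J x)|.
  by rewrite -[X in `|X| <= _](subKr (homotopy T l (u j) (J x))); apply: ler_normB.
have Jx0 : 0 < `|J x|.
  by rewrite lt_neqAle normr_ge0 andbT; apply/eqP => Jx; move: hx; rewrite -Jx mulr0 ltNge normr_ge0.
have h4 : j.+1%:R^-1 * `|J x| <= c / 2 * `|J x|.
  rewrite ler_pM2r //; have := hN2 j.+1 (leq_trans (leq_maxr _ _) (leqW Nj)).
  rewrite ler_pdivrMr // => h5.
  rewrite ler_pdivlMr // -ler_pdivlMl ?invr_gt0 ?ltr0n // invrK; lra.
have h5 : `|u j - t| * (B' * `|J x|) < c / 2 * `|J x|.
  by rewrite mulrA ltr_pM2r // -ltr_pdivlMr.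
have h6 := le_lt_trans (le_trans h1 h3) (ltr_leD (lt_le_trans hx h4) (le_trans h2 (ltW h5))).
by move: h6; rewrite -mulrDl -splitr ltxx.
Qed.

(** The parameter moves from 0 to 1 in K1 steps that are short enough for
    [codim_le_gap]. *)
Lemma homotopy_codim (T : {linear X -> X}) (l B c : R) N : l != 0 -> 0 <= B ->
  (forall x, `|T x| <= B * `|x|) -> 0 < c ->
  (forall th x, 0 <= th <= 1 -> tail N x -> c * `|J x| <= `|homotopy T l th (J x)|) ->
  codim_le N (tail_image T N).
Proof.
move=> l0 B0 TB c0 hc.
have l1 : 0 < `|l| by rewrite normr_gt0.
pose B' := 1 + B / `|l|.
have B'0 : 0 < B' by rewrite ltr_wpDr // divr_ge0.
pose et : R := (2 * 3 ^+ N)^-1.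
have et0 : 0 < et by rewrite invr_gt0 mulr_gt0 // exprn_gt0.
have [K0 hK0] := bound_nat (B' / (et * c)).
pose K1 := K0.+1.
have K10 : 0 < K1%:R :> R by rewrite ltr0n.
have step j : (j <= K1)%N -> codim_le N (tail_image (homotopy T l (j%:R / K1%:R)) N).
  elim: j => [|j IH] jK.
    apply: codim_leS (codim_le_tail N) => _ [x xN <-]; exists x => //.
    by rewrite homotopyE !mul0r subr0 scale1r scale0r addr0.
  apply: codim_le_gap (IH (ltnW jK)); try exact: tail_image_subspace.
  move=> _ [x xN <-]; exists (homotopy T l (j.+1%:R / K1%:R) (J x)); split; first by exists x.
  apply: le_trans (homotopy_lip _ _ _ l0 TB) _; rewrite -/B' -/et.
  have -> : `|j%:R / K1%:R - j.+1%:R / K1%:R| = K1%:R^-1 :> R.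
    rewrite -mulrBl -[j.+1]addn1 natrD opprD addrA subrr add0r mulN1r normrN.
    by rewrite ger0_norm ?invr_ge0.
  have h1 : c * `|J x| <= `|homotopy T l (j%:R / K1%:R) (J x)|.
    apply: hc => //; rewrite divr_ge0 //= ler_pdivrMr // mul1r ler_nat; exact: ltnW.
  apply: (@le_trans _ _ (et * (c * `|J x|))); last by rewrite ler_pM2l.
  rewrite !mulrA ler_wpM2r // mulrC ler_pdivrMr // mulrC -ler_pdivrMr ?mulr_gt0 //.
  by apply: hK0; exact: leqnSn.
have := step K1 (leqnn _); rewrite divff ?gt_eqF //; apply: codim_leS.
move=> _ [x xN <-]; exists (l^-1 *: x).
  by move=> k kN; rewrite c00Z xN // mulr0.
by rewrite homotopyE subrr scale0r add0r mul1r !linearZ.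
Qed.

(** The approximate eigenvalues are bounded because T is; a cluster point
    cannot be 0 because T is bounded below and the e_i have norm 1. *)
Lemma eigenvalue_exists (T : {linear X -> X}) (B c : R) : 0 <= B ->
  (forall x, `|T x| <= B * `|x|) -> 0 < c -> (forall x, c * `|x| <= `|T x|) ->
  exists l, l != 0 /\ forall (e : R) N, 0 < e -> exists i, (N <= i)%N /\
     `|T (J (ebase R i)) - l *: J (ebase R i)| < e.
Proof.
move=> B0 TB c0 Tc.
have ex j : exists ia : nat * R, (j.+1 <= ia.1)%N /\
    `|T (J (ebase R ia.1)) - ia.2 *: J (ebase R ia.1)| < j.+1%:R^-1.
  have j0 : 0 < j.+1%:R^-1 :> R by rewrite invr_gt0.
  have [i [a [h1 h2]]] := approx_eigen hpar hsigma hX B0 TB j.+1 j0.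
  by exists (i, a).
have [ia hia] := choice ex.
pose i j := (ia j).1; pose a j := (ia j).2.
have Je j : `|J (ebase R (i j))| = 1.
  by apply: (norm_ebase hpar hsigma hX); have [h _] := hia j; exact: leq_trans h.
have j1 (j : nat) : j.+1%:R^-1 <= 1 :> R by rewrite invf_le1 // ler1n.
have aB j : `|a j| <= B + 1.
  have [_ h] := hia j; rewrite -/(i j) -/(a j) in h.
  have := TB (J (ebase R (i j))); rewrite Je mulr1 => h1.
  have h2 : `|a j *: J (ebase R (i j))| <= `|T (J (ebase R (i j)))| +
     `|T (J (ebase R (i j))) - a j *: J (ebase R (i j))|.
    by rewrite -[X in `|X| <= _](subKr (T (J (ebase R (i j))))); apply: ler_normB.
  have e : `|a j *: J (ebase R (i j))| = `|a j| by rewrite normrZ Je mulr1.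
  rewrite -e; apply: le_trans h2 _; apply: lerD => //.
  exact: le_trans (ltW h) (j1 j).
have [l hl] := cluster_point aB; exists l.
have near (e : R) N : 0 < e -> exists i, (N <= i)%N /\
     `|T (J (ebase R i)) - l *: J (ebase R i)| < e.
  move=> e0; have [N2 hN2] := bound_nat (2 / e).
  have [j [Nj hj]] := hl (e / 2) (maxn N N2) (divr_gt0 e0 (ltr0Sn _ _)).
  have [h1 h2] := hia j; rewrite -/(i j) -/(a j) in h1 h2.
  exists (i j); split; first by apply: leq_trans (leq_maxl _ _) (leq_trans Nj (ltnW h1)).
  have h3 : j.+1%:R^-1 <= e / 2.
    have := hN2 j.+1 (leq_trans (leq_maxr _ _) (leqW Nj)); rewrite ler_pdivrMr // => h5.
    rewrite ler_pdivlMr // -ler_pdivlMl ?invr_gt0 ?ltr0n // invrK; lra.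
  rewrite -(subrKA (a j *: J (ebase R (i j)))) -scalerBl; apply: le_lt_trans (ler_normD _ _) _.
  have -> : `|(a j - l) *: J (ebase R (i j))| = `|a j - l| by rewrite normrZ Je mulr1.
  by rewrite [e]splitr; apply: ltrD => //; exact: lt_le_trans h2 h3.
split=> //; apply/eqP => l0.
have [k [k1 hk]] := near c 1%N c0; rewrite l0 scale0r subr0 in hk.
have := Tc (J (ebase R k)); rewrite (norm_ebase hpar hsigma hX k1) mulr1 => h.
by have := le_lt_trans h hk; rewrite ltxx.
Qed.

End Index.

Theorem corollary4p20 (R : realType) (m n s : nat -> nat)
    (sigma : pseq R -> nat)
    (hpar : ius_parameters m n s) (hsigma : coding_function m sigma)
    (X : completeNormedModType R) (J : {linear c00 R -> X})
    (hX : is_completion (ius_norm m n sigma) J)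
    (Y : set X) (hY : submod_closed (mem Y)) (hproper : Y `<` [set: X]) :
  ~ isomorphic_to_subspace Y.
Proof.
move=> [T [S [YT TS ST Tc Sc]]].
have [B [c [B0 c0 TB Tb]]] := isomorphism_bounds YT TS Tc Sc.
have [l [l0 near]] := eigenvalue_exists hpar hsigma hX B0 TB c0 Tb.
have [c' [N [c'0 hc]]] := homotopy_bounded_below hpar hsigma hX l0 B0 TB near.
have cod := homotopy_codim hX l0 B0 TB c'0 hc.
have dT := codim_le0_range hpar hsigma hX c0 Tb cod.
have [_ nY] := hproper; apply: nY => z _.
by have [x _ <-] := closed_range c0 TB Tb (dT z); exact: YT.
Qed.
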